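(* Let $d\ge 1$ and let $B=\{z\in\mathbb{C}^d : |z|<1\}$. Let $f_n\colon B\to B$, $n\in\mathbb{N}$, be a sequence of holomorphic maps such that, for some constants $0<\nu\le\lambda<1$, $$\nu|z|\le |f_n(z)|\le \lambda|z|\qquad \forall z\in B,\ \forall n\in\mathbb{N}.$$ Assume that for every $n$ the matrix $L_n:=Df_n(0)$ is lower triangular, and denote by $\lambda_n(j)$ its $j$-th diagonal entry, $1\le j\le d$. Assume that there is a constant $0<\lambda'<1$ such that for every $\theta>1$ there exists a number $C(\theta)$ with $$\max_{1\le h\le d}\ \prod_{k=n}^{n+\ell-1}|\lambda_k(h)|\ \cdot\ \max_{1\le i\le j\le d}\ \prod_{k=n}^{n+\ell-1}\frac{|\lambda_k(j)|}{|\lambda_k(i)|}\ \le\ C(\theta)\,\theta^n\,(\lambda')^{\ell}\qquad \forall n,\ell\in\mathbb{N}.$$ Then the abstract basin of attraction of $0$ with respect to $(f_n)$ is biholomorphic to $\mathbb{C}^d$.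
   Context: $\mathbb{N}=\{0,1,2,\dots\}$, and $|z|=\max_{1\le j\le d}|z_j|$ on $\mathbb{C}^d$. Write $B_r=\{|z|<r\}$. An empty product equals $1$. Abstract basin of attraction of $0$ with respect to $f=(f_n)$: this is the set $Wf$ of all sequences $(z_n)_{n\ge m}$ (with $m\in\mathbb{N}$ depending on the sequence) in $B$ such that $z_{n+1}=f_n(z_n)$ for every $n\ge m$, where two sequences are identified if they coincide for all sufficiently large indices. In other words, it is the inductive limit of the sequence of maps $f_n\colon B\to B$. It carries a natural structure of $d$-dimensional complex manifold: writing $f_{n,m}=f_{n-1}\circ\cdots\circ f_m$ and $f_{m,m}=\mathrm{id}$, it is the unique complex structure for which, for all sufficiently small $r>0$ and every $m\in\mathbb{N}$, the map $B_r\to Wf$, $z\mapsto[(f_{n,m}(z))_{n\ge m}]$, is a biholomorphism onto an open subset of $Wf$ (under the bounds assumed on $f_n$, the maps $f_n$ are all injective on $B_r$ for some $r>0$ independent of $n$, and map $B_r$ into itself). When all $f_n$ are injective on $B$ the same holds with $B$ in place of $B_r$. *)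

(* Defs.v *)
From HB Require Import structures.
From mathcomp Require Import all_boot all_order all_algebra.
From mathcomp Require Import complex lra.
From mathcomp Require Import all_classical all_reals all_analysis.

Set Implicit Arguments.
Unset Strict Implicit.
Unset Printing Implicit Defensive.

Import Order.TTheory GRing.Theory Num.Theory.
Import numFieldNormedType.Exports.

Local Open Scope classical_set_scope.
Local Open Scope complex_scope.
Local Open Scope ring_scope.
Local Open Scope quotient_scope.

(* The instances that the library attaches to any numClosedFieldType, made
   available on the syntactic form R[i]. *)
#[non_forgetful_inheritance]
HB.instance Definition _ (R : rcfType) := PseudoPointedMetric.copy R[i] R[i]^o.
#[non_forgetful_inheritance]
HB.instance Definition _ (R : rcfType) := NormedModule.copy R[i] R[i]^o.

(* The library norm of 'rV[R[i]]_d is the maximum of the moduli of the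
   entries; it takes its values in R[i], whence the cast of the radius. *)
Definition polydisc (R : realType) (d : nat) (r : R) : set 'rV[R[i]]_d :=
  [set z | `|z| < r%:C].
Arguments polydisc {R d} r.

(* [jacobian] is the matrix of the differential acting on row vectors by right
   multiplication: its (i, j) entry is the i-th partial derivative of the j-th
   component.  The usual matrix Dg(z) is its transpose. *)
Definition Dmx (R : realType) (d : nat) (g : 'rV[R[i]]_d -> 'rV[R[i]]_d)
    (z : 'rV[R[i]]_d) : 'M[R[i]]_d := (jacobian g z)^T.

Section ComplexManifolds.
Context {R : realType} {d : nat}.
Local Notation V := 'rV[R[i]]_d.

(* A local parametrization, i.e. the inverse of a chart.  Values outside [dom]
   are irrelevant. *)
Record param (X : Type) := Param {
  dom : set V;
  pmap :> V -> X;
  dom_open : open dom;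
  pmap_inj : forall z w, dom z -> dom w -> pmap z = pmap w -> z = w }.

(* In the parametrizations p and q, the map F restricted to A is holomorphic:
   q^-1 o F o p is defined on an open set, and complex differentiable there. *)
Definition holo_in_params (X Y : Type) (A : set X) (F : X -> Y)
    (p : param X) (q : param Y) : Prop :=
  let O := [set z | [/\ dom p z, A (p z) & (q @` dom q) (F (p z))]] in
  open O /\
  exists g : V -> V, forall z, O z ->
    [/\ differentiable g z, dom q (g z) & q (g z) = F (p z)].

(* X with the topology coinduced by the parametrizations in A. *)
Definition atlas_space (X : choiceType) (A : set (param X)) : Type := X.

Section AtlasTopology.
Variables (X : choiceType) (A : set (param X)).

HB.instance Definition _ := Choice.on (atlas_space A).

Definition atlas_open : set (set (atlas_space A)) :=
  [set U | forall p, A p -> open (dom p `&` p @^-1` U)].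

Lemma atlas_openT : atlas_open setT.
Proof. by move=> p _; rewrite preimage_setT setIT; exact: dom_open. Qed.

Lemma atlas_openI : setI_closed atlas_open.
Proof.
move=> U W oU oW p Ap; rewrite preimage_setI setIIr.
by apply: openI; [exact: oU | exact: oW].
Qed.

Lemma atlas_open_bigU (I : Type) (U : I -> set (atlas_space A)) :
  (forall i, atlas_open (U i)) -> atlas_open (\bigcup_i U i).
Proof.
move=> oU p Ap; rewrite preimage_bigcup setI_bigcupr.
by apply: bigcup_open => i _; exact: oU.
Qed.

HB.instance Definition _ := isOpenTopological.Build (atlas_space A)
  atlas_openT atlas_openI atlas_open_bigU.

Lemma atlas_openE : open = atlas_open.
Proof. by []. Qed.

End AtlasTopology.

(* The atlas is not required to be maximal: two structures are regarded as the
   same when the identity is biholomorphic. *)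
Record complex_structure (X : choiceType) := ComplexStructure {
  atlas : set (param X);
  atlas_cover : forall x, exists p z, [/\ atlas p, dom p z & p z = x];
  atlas_compat : forall p q, atlas p -> atlas q ->
    holo_in_params setT id p q;
  atlas_hausdorff : hausdorff_space (atlas_space atlas);
  atlas_countable : @second_countable (atlas_space atlas) }.

Definition manifold (X : choiceType) (S : complex_structure X) :=
  atlas_space (atlas S).
HB.instance Definition _ (X : choiceType) (S : complex_structure X) :=
  Topological.on (manifold S).

Definition holo_on (X Y : choiceType) (S : complex_structure X)
    (T : complex_structure Y) (A : set X) (F : X -> Y) : Prop :=
  forall p q, atlas S p -> atlas T q -> holo_in_params A F p q.

(* F maps the open subset A of X biholomorphically onto the open subset B of
   Y. *)
Definition biholomorphism (X Y : choiceType) (S : complex_structure X)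
    (T : complex_structure Y) (A : set (manifold S)) (B : set (manifold T))
    (F : X -> Y) : Prop :=
  [/\ open A, open B, set_fun A B F, holo_on S T A F &
   exists G : Y -> X, [/\ set_fun B A G, {in A, cancel F G},
                         {in B, cancel G F} & holo_on T S B G]].

Definition biholomorphic (X Y : choiceType) (S : complex_structure X)
    (T : complex_structure Y) : Prop :=
  exists F : X -> Y, biholomorphism (S := S) (T := T) setT setT F.

Definition std_param : param V :=
  @Param V setT id openT (fun _ _ _ _ => id).

Lemma std_openE (U : set (atlas_space [set std_param])) :
  open U <-> open (U : set V).
Proof.
rewrite atlas_openE; split=> [/(_ _ erefl)|oU p ->]; by rewrite setTI.
Qed.

Lemma std_nbhsE (z : V) :
  nbhs (z : atlas_space [set std_param]) = nbhs z :> set (set V).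
Proof.
rewrite predeqE => U; rewrite !nbhsE.
by split=> -[W [oW Wz] WU]; exists W => //; split=> //; apply/std_openE.
Qed.

Lemma std_cover (x : V) :
  exists p z, [/\ [set std_param] p, dom p z & p z = x].
Proof. by exists std_param, x. Qed.

Lemma std_compat (p q : param V) :
  [set std_param] p -> [set std_param] q -> holo_in_params setT id p q.
Proof.
move=> -> ->; split.
  rewrite (_ : [set _ | _] = setT); first exact: openT.
  by apply/seteqP; split=> // z _; split=> //; exists z.
by exists id => z _; split.
Qed.

Lemma std_hausdorff : hausdorff_space (atlas_space [set std_param]).
Proof.
move=> x y xy; apply: (@norm_hausdorff _ V) => A B; rewrite -!std_nbhsE.
exact: xy.
Qed.

Let approx (q : rat * rat) : R[i] := ratr q.1 +i* ratr q.2.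

Lemma approx_dense (x e : R[i]) : 0 < e -> exists q, `|x - approx q| < e.
Proof.
case: e x => r s [a b]; rewrite ltcE/= => /andP[/eqP-> r0].
have near_rat (t : R) : exists q : rat, `|t - ratr q| < r / 2.
  have [q] : exists q, ratr q \in `]t - r / 2, t + r / 2[.
    by apply: rat_in_itvoo; rewrite ltrD2l gt0_cp// divr_gt0.
  by rewrite in_itv/= => /andP[q1 q2]; exists q; rewrite ltr_norml; apply/andP;
    split; lra.
have [p pa] := near_rat a; have [q qb] := near_rat b; exists (p, q).
have /le_lt_trans -> // : `|(a +i* b - approx (p, q) : R[i])| <=
    (`|a - ratr p| + `|b - ratr q|)%:C.
  rewrite normc_def lecR /= -[leRHS]ger0_norm ?addr_ge0// -sqrtr_sqr.
  rewrite ler_wsqrtr// -(real_normK (num_real (a - _))).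
  rewrite -(real_normK (num_real (b - _))) sqrrD addrAC lerDl.
  by rewrite mulrn_wge0// mulr_ge0.
by rewrite -[_ +i* 0]/(r%:C) ltcR; lra.
Qed.

Lemma std_countable : @second_countable (atlas_space [set std_param]).
Proof.
pose center (q : 'rV[rat * rat]_d) : V := map_mx approx q.
pose U (c : 'rV[rat * rat]_d * nat) : set V :=
  ball (center c.1) (c.2.+1%:R^-1 : R[i]).
exists (range U).
  exact: sub_countable (card_image_le _ _) (countableP _).
split=> [_ [c _ <-]|z W].
  by apply/std_openE; exact: (@ball_open _ V).
rewrite std_nbhsE => /nbhs_ballP[e /= e0 eW].
have [k ke] : exists k : nat, (k.+1%:R^-1 : R[i]) < e / 2.
  have : 0 < e / 2 by rewrite divr_gt0.
  case: (e / 2) => r s; rewrite ltcE/= => /andP[/eqP-> r0].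
  have [k _ /(_ _ (leqnn k))/= kr] := near_infty_natSinv_lt (PosNum r0).
  by exists k; rewrite -[_ +i* 0]/(r%:C) -[k.+1%:R](rmorph_nat (real_complex R))
    -fmorphV ltcR.
have k0 : (0 : R[i]) < k.+1%:R^-1 by rewrite invr_gt0 ltr0n.
have /choice[q qz] : forall j, exists q, `|z 0 j - approx q| < k.+1%:R^-1.
  by move=> j; exact: approx_dense.
have zq : ball (center (\row_j q j)) (k.+1%:R^-1 : R[i]) z.
  split=> // i j; rewrite !mxE ord1; apply: ball_sym.
  by rewrite -ball_normE; exact: qz.
exists (U (\row_j q j, k)); first by split=> //; exists (\row_j q j, k).
move=> w zw; apply: eW; apply: (@ball_split _ _ (center (\row_j q j))).
  by apply: le_ball (ball_sym zq); exact: ltW.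
by apply: le_ball zw; exact: ltW.
Qed.

(* The standard structure of C^d *)
Definition std_structure : complex_structure V :=
  ComplexStructure std_cover std_compat std_hausdorff std_countable.

End ComplexManifolds.

Section Basin.
Context {R : realType} {d : nat}.
Local Notation V := 'rV[R[i]]_d.
Local Notation B := (@polydisc R d 1).
Variable f : nat -> {fun B >-> B}.

(* [oseq] is constrained only at the indices n >= ostart; its other values
   disappear in the quotient below. *)
Record orbit := Orbit {
  ostart : nat;
  oseq :> nat -> V;
  orbitP : forall n, (ostart <= n)%N ->
    B (oseq n) /\ oseq n.+1 = f n (oseq n) }.

HB.instance Definition _ := gen_eqMixin orbit.
HB.instance Definition _ := gen_choiceMixin orbit.

Definition tail_eq (s t : orbit) : bool := `[< \forall n \near \oo, s n = t n >].

Lemma tail_eq_equiv : equiv_class_of tail_eq.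
Proof.
split=> [s|s t|t s u].
- by apply/asboolP; exact: nearW.
- by apply/asboolP/asboolP; apply: filterS => n ->.
- move=> /asboolP st /asboolP tu; apply/asboolP.
  by apply: filterS2 st tu => n -> ->.
Qed.

Canonical tail_equiv := EquivRelPack tail_eq_equiv.

Definition basin : choiceType := {eq_quot tail_equiv}.

(* f_{m+k,m} = f_{m+k-1} o ... o f_m *)
Fixpoint comp_from (m k : nat) (z : V) : V :=
  if k is k'.+1 then f (m + k')%N (comp_from m k' z) else z.

Lemma polydisc1_0 : B 0.
Proof. by rewrite /polydisc/= normr0 ltcR. Qed.

(* Only the values at z in B matter; 0 is a placeholder for the others. *)
Let base (z : V) : V := if `[< B z >] then z else 0.

Lemma orbit_from_subproof (m : nat) (z : V) n : (m <= n)%N ->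
  B (comp_from m (n - m) (base z)) /\
  comp_from m (n.+1 - m) (base z) = f n (comp_from m (n - m) (base z)).
Proof.
move=> mn; split; last by rewrite subSn//= subnKC.
elim: (n - m)%N => [|k IH] /=; last exact: funS.
by rewrite /base; case: asboolP => // _; exact: polydisc1_0.
Qed.

Definition orbit_from (m : nat) (z : V) : orbit :=
  Orbit (@orbit_from_subproof m z).

Definition basin_map (m : nat) (z : V) : basin := \pi_basin (orbit_from m z).

(* For all small r > 0 and all m, the map z |-> [(f_{n,m}(z))_{n >= m}] is
   biholomorphic from the polydisc of radius r onto an open subset.  This
   determines the structure up to equivalence of atlases, since |f_n(z)| <=
   lambda |z| makes every orbit enter that polydisc. *)
Definition natural_structure (S : complex_structure (d := d) basin) : Prop :=
  \forall r \near (0 : R)^'+, forall m, exists U : set (manifold S),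
    biholomorphism (S := std_structure) (T := S) (polydisc r) U (basin_map m).

End Basin.

(* Main.v *)
Require Import Defs.
From mathcomp Require Import all_boot all_order all_algebra.
From mathcomp Require Import complex ring lra zify.
From mathcomp Require Import all_classical all_reals all_analysis.

(** Write f_{n,m} for f_{n-1} o ... o f_m.  Suppose that near 0 the maps f_n are
    conjugate, by changes of coordinates H_n, to automorphisms g_n of C^d all of
    whose orbits tend to 0.  For an orbit (z_n), the point
    (g_{n-1} o ... o g_0)^-1 (H_n (z_n)), for a suitable origin of time, does not
    depend on n once the orbit has entered the domains of the H_n.  This defines
    a coordinate psi on the basin.  It is injective because the H_n and g_n are,
    it is onto because every orbit of the g_n enters the images of the H_n, and
    it is a local biholomorphism because z |-> [(f_{n,m} z)_n] followed by psi is
    one near 0 ([psi_chart]).  So the standard structure of C^d, transported by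
    psi, is a natural structure, and psi is biholomorphic for every natural
    structure, since locally it is the composition of a parametrization with such
    a local biholomorphism ([natural_exists], [natural_biholomorphic]).

    The g_n will be triangular: the i-th component of g_n is
    lambda_n(i) z_i + T_n^i(z_1, ..., z_{i-1}) with T_n^i entire.  Such a map is
    inverted by back substitution, and its orbits tend to 0 one coordinate after
    the other ([tri_orbit]).

    The conjugation starts with a rescaling: z_i is multiplied at time n by
    tau^(n (2 d + 1 - i)), with tau > 1 close to 1.  This makes the strictly
    triangular linear terms and the nonlinear terms as small as sigma^n |z|, for
    some sigma < 1, on a fixed ball ([rescaled_triform]).  The bunching condition
    pays for it: the factor lambda'^l is lost, but the products of
    |lambda_k(h)| |lambda_k(j)| / |lambda_k(i)|, i <= j, are still bounded by
    C(theta) theta^n ([rescaled_tame]).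

    Then the components are treated one after the other ([triangular_step]).
    When the components before the i-th one are triangular, the new i-th
    coordinate z_i + chi_n(z) must satisfy

      f_n^i + chi_{n+1} o f_n = lambda_n(i) (z_i + chi_n) + T_n(z_1, ..., z_{i-1}).

    Points with the same first i - 1 coordinates are mapped to such points.  For
    two of them, z and w, the difference of the values of the nonlinear part of
    f_n^i is at most of order sigma^n |z - w| (|z| + |w|), and an iteration
    multiplies the terms |z_j - w_j| (|z_h| + |w_h|), j >= i, by about
    |lambda_n(j)| |lambda_n(h)|.  The suprema of the forward products in the
    bunching condition are weights that turn this into |lambda_n(i)|
    ([bunching_weights], [Q_step]), and the factor sigma^n makes the series that
    solves the equation for these differences converge
    ([fibre_linearization]).  What is left is a function of the first i - 1
    coordinates.  It need not be entire, but it differs from its Taylor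
    polynomial of order N by O(|z|^N), and for large N this difference is removed
    by a similar series, since then lambda^N < nu <= |lambda_n(i)|
    ([solve_component]).  After d steps the maps are triangular
    ([global_normal_form]).

    The complex analysis rests on a single estimate, [taylor2], which bounds the
    second-order Taylor remainder of a function that is complex differentiable at
    every point of a disc by its supremum.  It follows from Cauchy's formula on
    the boundary of a square, obtained by Goursat's bisection with trapezoidal
    sums in place of contour integrals ([goursat], [cauchy_divdiff]).  Applied on
    complex lines it yields Cauchy's inequalities ([cauchy_lipschitz]), the
    holomorphy of uniform limits and of derivatives ([hol_limit], [hol_dd]) and
    Taylor polynomials with uniform bounds ([taylor_entire]).  Cauchy's
    inequalities also provide the Lipschitz constants with which perturbations of
    the identity are inverted on explicit domains ([lbih_perturb]). *)

Set Implicit Arguments.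
Unset Strict Implicit.
Unset Printing Implicit Defensive.

Import Order.TTheory GRing.Theory Num.Theory.
Import numFieldNormedType.Exports.

Local Open Scope classical_set_scope.
Local Open Scope complex_scope.
Local Open Scope ring_scope.

(** * The modulus of a complex number *)

Section Modulus.
Context {R : realType}.
Local Notation C := R[i].

(** The norm of R[i], as a real number; see [ncE]. *)
Definition nc (z : C) : R := Normc.normc z.

Lemma ncE (z : C) : `|z| = (nc z)%:C.
Proof. by case: z. Qed.

Lemma nc_ge0 z : 0 <= nc z.
Proof. by case: z => a b; rewrite /nc /= sqrtr_ge0. Qed.

Lemma nc0 : nc 0 = 0.
Proof. exact: Normc.normc0. Qed.

Lemma nc1 : nc 1 = 1.
Proof. exact: Normc.normc1. Qed.

Lemma ncM x y : nc (x * y) = nc x * nc y.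
Proof. exact: Normc.normcM. Qed.

Lemma ncV x : nc x^-1 = (nc x)^-1.
Proof. exact: Normc.normcV. Qed.

Lemma ncN x : nc (- x) = nc x.
Proof. exact: normcN. Qed.

Lemma ncD x y : nc (x + y) <= nc x + nc y.
Proof. exact: le_normcD. Qed.

Lemma ncB x y : nc (x - y) <= nc x + nc y.
Proof. by rewrite -[nc y]ncN ncD. Qed.

Lemma ncBC x y : nc (x - y) = nc (y - x).
Proof. by rewrite -ncN opprB. Qed.

Lemma ncBD x y z : nc (x - z) <= nc (x - y) + nc (y - z).
Proof. by rewrite -[x - z](subrKA y) ncD. Qed.

Lemma ncB_ge x y : nc x - nc y <= nc (x - y).
Proof. by rewrite lerBlDr -[X in nc X <= _](subrK y) ncD. Qed.

Lemma nc_eq0 z : (nc z == 0) = (z == 0).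
Proof. by apply/eqP/eqP => [/Normc.eq0_normc|->]; rewrite ?nc0. Qed.

Lemma nc_gt0 z : (0 < nc z) = (z != 0).
Proof. by rewrite lt_def nc_eq0 nc_ge0 andbT. Qed.

Lemma ncX z n : nc (z ^+ n) = nc z ^+ n.
Proof. by elim: n => [|n IH]; rewrite ?expr0 ?nc1 // !exprS ncM IH. Qed.

Lemma nc_real (r : R) : nc r%:C = `|r|.
Proof. by rewrite /nc /= expr0n /= addr0 sqrtr_sqr. Qed.

Lemma nc_nat n : nc n%:R = n%:R.
Proof. by rewrite -(rmorph_nat (real_complex R)) nc_real normr_nat. Qed.

Lemma nc_i : nc 'i = 1.
Proof. by rewrite /nc /= expr0n /= add0r expr1n sqrtr1. Qed.

Lemma nc_sum (I : Type) (s : seq I) (P : pred I) (F : I -> C) :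
  nc (\sum_(i <- s | P i) F i) <= \sum_(i <- s | P i) nc (F i).
Proof.
elim/big_rec2: _ => [|i x y _ h]; first by rewrite nc0.
by apply: le_trans (ncD _ _) _; rewrite lerD2l.
Qed.

Lemma Re_le_nc (z : C) : `|complex.Re z| <= nc z.
Proof.
by case: z => a b; rewrite /nc /= -sqrtr_sqr ler_wsqrtr // lerDl sqr_ge0.
Qed.

Lemma Im_le_nc (z : C) : `|complex.Im z| <= nc z.
Proof.
by case: z => a b; rewrite /nc /= -sqrtr_sqr ler_wsqrtr // lerDr sqr_ge0.
Qed.

Lemma nc_le_ReIm (z : C) : nc z <= `|complex.Re z| + `|complex.Im z|.
Proof.
rewrite {1}[z]complexE.
by apply: le_trans (ncD _ _) _; rewrite ncM nc_i mul1r !nc_real.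
Qed.

Lemma le_of_eps (x y : R) : (forall e, 0 < e -> x <= y + e) -> x <= y.
Proof. by move=> h; apply/ler_addgt0Pr. Qed.

Lemma exp_small (q e : R) : 0 <= q -> q < 1 -> 0 < e ->
  exists N, forall n, (N <= n)%N -> q ^+ n < e.
Proof.
move=> q0 q1 e0.
have : q ^+ n @[n --> \oo] --> (0 : R) by apply: cvg_expr; rewrite ger0_norm.
move/cvgrPdist_lt => /(_ _ e0) [N _ h]; exists N => n Nn.
by have := h n Nn; rewrite /= sub0r normrN ger0_norm // exprn_ge0.
Qed.

End Modulus.

(** * Goursat's theorem for trapezoidal sums *)

Section Goursat.
Context {R : realType}.
Local Notation C := R[i].

Definition cdiff (g : C -> C) (z a : C) := forall e : R, 0 < e ->
  exists2 dl : R, 0 < dl & forall w, nc (w - z) < dl ->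
    nc (g w - g z - a * (w - z)) <= e * nc (w - z).

(** The trapezoidal rule replaces contour integrals: like them, and unlike
    Riemann sums, it vanishes on closed polygons when g is affine. *)
Definition trap (g : C -> C) (P : nat -> C) (N : nat) : C :=
  \sum_(i < N) (g (P i) + g (P i.+1)) / 2 * (P i.+1 - P i).

Lemma eq_trap g g' P P' N : (forall i, (i <= N)%N -> P i = P' i) ->
  (forall i, (i <= N)%N -> g (P' i) = g' (P' i)) ->
  trap g P N = trap g' P' N.
Proof.
move=> eP eg; apply: eq_bigr => i _.
by rewrite !eP ?eg // ltnW.
Qed.

Lemma trapD g g' P N : trap (fun z => g z + g' z) P N = trap g P N + trap g' P N.
Proof. by rewrite -big_split; apply: eq_bigr => i _ /=; field. Qed.

Lemma trapZ a g P N : trap (fun z => a * g z) P N = a * trap g P N.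
Proof. by rewrite mulr_sumr; apply: eq_bigr => i _; field. Qed.

Lemma trap_affine a b P N : trap (fun z => a + b * z) P N =
  (a * P N + b * P N ^+ 2 / 2) - (a * P 0%N + b * P 0%N ^+ 2 / 2).
Proof.
rewrite /trap -(big_mkord predT (fun i =>
  (a + b * P i + (a + b * P i.+1)) / 2 * (P i.+1 - P i))).
rewrite -[RHS](telescope_sumr (fun i => a * P i + b * P i ^+ 2 / 2)) //.
by apply: eq_bigr => i _; field.
Qed.

Lemma trap_split g P N N' :
  trap g P (N + N') = trap g P N + trap g (fun i => P (N + i)%N) N'.
Proof. by rewrite /trap big_split_ord /=; under [X in _ + X]eq_bigr do rewrite -addnS. Qed.

Lemma trap_le g P N M l : (forall i, (i <= N)%N -> nc (g (P i)) <= M) ->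
  0 <= M ->
  (forall i, (i < N)%N -> nc (P i.+1 - P i) <= l) ->
  nc (trap g P N) <= M * (N%:R * l).
Proof.
move=> gM M0 Pl; apply: le_trans (nc_sum _ _ _) _.
have -> : M * (N%:R * l) = \sum_(i < N) (M * l).
  by rewrite sumr_const card_ord -[RHS]mulr_natl; ring.
apply: ler_sum => i _; rewrite ncM; apply: ler_pM => //; rewrite ?nc_ge0 ?Pl //.
rewrite ncM ncV nc_nat ler_pdivrMr // mulr_natr.
by apply: le_trans (ncD _ _) _; rewrite mulr2n lerD // gM // ltnW.
Qed.

Section Square.
Variables (g : C -> C) (Phi : R -> R -> C).

Definition hor N (a b h : R) :=
  trap g (fun i => Phi (a + h * (i%:R / N%:R)) b) N.
Definition ver N (a b h : R) :=
  trap g (fun i => Phi a (b + h * (i%:R / N%:R))) N.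
(** The contour is the image under Phi of the boundary of the square
    [a, a + h] x [b, b + h], each side being divided into N parts. *)
Definition bnd N a b h :=
  hor N a b h + ver N (a + h) b h - hor N a (b + h) h - ver N a b h.

Lemma hor_split N a b h : (0 < N)%N ->
  hor (N + N) a b (h + h) = hor N a b h + hor N (a + h) b h.
Proof.
move=> N0; have N0' : N%:R != 0 :> R by rewrite pnatr_eq0 -lt0n.
have N2 : N%:R + N%:R != 0 :> R by rewrite -natrD pnatr_eq0; lia.
rewrite /hor trap_split; congr (_ + _); apply: eq_trap => // i _.
  by rewrite natrD; congr Phi; field; rewrite ?N0' ?N2.
by rewrite !natrD; congr Phi; field; rewrite ?N0' ?N2.
Qed.

Lemma ver_split N a b h : (0 < N)%N ->
  ver (N + N) a b (h + h) = ver N a b h + ver N a (b + h) h.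
Proof.
move=> N0; have N0' : N%:R != 0 :> R by rewrite pnatr_eq0 -lt0n.
have N2 : N%:R + N%:R != 0 :> R by rewrite -natrD pnatr_eq0; lia.
rewrite /ver trap_split; congr (_ + _); apply: eq_trap => // i _.
  by rewrite natrD; congr Phi; field; rewrite ?N0' ?N2.
by rewrite !natrD; congr Phi; field; rewrite ?N0' ?N2.
Qed.

Lemma bnd_split N a b h : (0 < N)%N ->
  bnd (N + N) a b (h + h) =
  bnd N a b h + bnd N (a + h) b h + bnd N a (b + h) h + bnd N (a + h) (b + h) h.
Proof. by move=> N0; rewrite /bnd !hor_split // !ver_split // !addrA; ring. Qed.

(** Only subdivisions into 2 ^ K parts are considered, since bisection halves
    the number of parts on each side. *)
Definition bnd_small (c a b h : R) :=
  exists K0, forall K, (K0 <= K)%N -> nc (bnd (2 ^ K) a b h) <= c.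

Lemma bnd_small_split c a b h :
  bnd_small (c / 4) a b h -> bnd_small (c / 4) (a + h) b h ->
  bnd_small (c / 4) a (b + h) h -> bnd_small (c / 4) (a + h) (b + h) h ->
  bnd_small c a b (h + h).
Proof.
move=> [K1 h1] [K2 h2] [K3 h3] [K4 h4].
exists (K1 + K2 + K3 + K4).+1 => -[//|K]; rewrite ltnS => KK.
rewrite expnS mul2n -addnn bnd_split ?expn_gt0 //.
have /h1 {}h1 : (K1 <= K)%N by apply: leq_trans KK; lia.
have /h2 {}h2 : (K2 <= K)%N by apply: leq_trans KK; lia.
have /h3 {}h3 : (K3 <= K)%N by apply: leq_trans KK; lia.
have /h4 {}h4 : (K4 <= K)%N by apply: leq_trans KK; lia.
have -> : c = c / 4 + c / 4 + c / 4 + c / 4 by field.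
by do 3!(apply: le_trans (ncD _ _) _; apply: lerD => //).
Qed.

Variable L : R.
Hypothesis L0 : 0 < L.
Hypothesis PhiL : forall s t s' t', 0 <= s <= 1 -> 0 <= t <= 1 ->
  0 <= s' <= 1 -> 0 <= t' <= 1 ->
  nc (Phi s t - Phi s' t') <= L * (`|s - s'| + `|t - t'|).

(** Near a point of differentiability the contour sum around a square is small
    compared with its area: the affine part of g contributes 0. *)
Lemma bnd_le a0 b0 a b h al e dl N :
  0 <= a -> 0 <= b -> 0 <= h -> a + h <= 1 -> b + h <= 1 ->
  a <= a0 <= a + h -> b <= b0 <= b + h -> 0 <= e ->
  (forall w, nc (w - Phi a0 b0) < dl ->
    nc (g w - g (Phi a0 b0) - al * (w - Phi a0 b0)) <=
      e * nc (w - Phi a0 b0)) ->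
  L * (h + h) < dl -> (0 < N)%N ->
  nc (bnd N a b h) <= 8 * e * L ^+ 2 * h ^+ 2.
Proof.
move=> a_0 b_0 h0 ah bh /andP[aa0 a0h] /andP[bb0 b0h] e0 gd Ldl N0.
set z := Phi a0 b0.
have N0' : 0 < N%:R :> R by rewrite ltr0n.
pose r w := g w - g z - al * (w - z).
have gE w : g w = (g z - al * z + al * w) + r w by rewrite /r; ring.
have frac i : (i <= N)%N -> 0 <= (i%:R / N%:R : R) <= 1.
  move=> iN; rewrite divr_ge0 //= ler_pdivrMr // mul1r ler_nat //.
have step i : (i.+1%:R / N%:R : R) = i%:R / N%:R + N%:R^-1.
  by rewrite -[i.+1]addn1 natrD mulrDl mul1r.
have bnd_r s t : a <= s <= a + h -> b <= t <= b + h ->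
    nc (r (Phi s t)) <= e * (L * (h + h)).
  move=> /andP[s1 s2] /andP[t1 t2].
  have d : nc (Phi s t - z) <= L * (h + h).
    apply: le_trans (PhiL _ _ _ _) _; try by (apply/andP; split; lra).
    rewrite ler_pM2l // lerD // ler_norml; apply/andP; split; lra.
  apply: le_trans (gd _ _) _; first exact: le_lt_trans d Ldl.
  exact: ler_wpM2l.
have tr P : (forall i, (i <= N)%N -> exists s t,
     [/\ P i = Phi s t, a <= s <= a + h & b <= t <= b + h]) ->
   (forall i, (i < N)%N -> nc (P i.+1 - P i) <= L * (h / N%:R)) ->
   nc (trap r P N) <= e * (L * (h + h)) * (L * h).
  move=> P1 P2.
  have -> : L * h = N%:R * (L * (h / N%:R)) by field; rewrite gt_eqF.
  apply: trap_le => //; last by rewrite !mulr_ge0 // ?addr_ge0 // ltW.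
  by move=> i /P1[s [t [-> ? ?]]]; exact: bnd_r.
pose A w := (g z - al * z) * w + al * w ^+ 2 / 2.
have horE t : b <= t <= b + h -> exists2 x,
    hor N a t h = A (Phi (a + h) t) - A (Phi a t) + x &
    nc x <= e * (L * (h + h)) * (L * h).
  move=> th; exists (trap r (fun i => Phi (a + h * (i%:R / N%:R)) t) N).
    rewrite /hor (eq_trap (P' := fun i => Phi (a + h * (i%:R / N%:R)) t)
       (g' := fun w => (g z - al * z + al * w) + r w)) //.
    rewrite trapD trap_affine /A mul0r mulr0 addr0 divff ?gt_eqF // mulr1 //.
  apply: tr => i iN.
    have /andP[? ?] := frac i iN.
    exists (a + h * (i%:R / N%:R)), t; split => //.
    by apply/andP; split; nra.
  have /andP[f1 f2] := frac i (ltnW iN); have /andP[f3 f4] := frac i.+1 iN.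
  apply: le_trans (PhiL _ _ _ _) _; try by (apply/andP; split; nra).
  rewrite subrr normr0 addr0 ler_pM2l // step.
  have -> : a + h * (i%:R / N%:R + N%:R^-1) - (a + h * (i%:R / N%:R)) = h / N%:R.
    by ring.
  by rewrite ger0_norm // divr_ge0 // ltW.
have verE s : a <= s <= a + h -> exists2 x,
    ver N s b h = A (Phi s (b + h)) - A (Phi s b) + x &
    nc x <= e * (L * (h + h)) * (L * h).
  move=> sh; exists (trap r (fun i => Phi s (b + h * (i%:R / N%:R))) N).
    rewrite /ver (eq_trap (P' := fun i => Phi s (b + h * (i%:R / N%:R)))
       (g' := fun w => (g z - al * z + al * w) + r w)) //.
    rewrite trapD trap_affine /A mul0r mulr0 addr0 divff ?gt_eqF // mulr1 //.
  apply: tr => i iN.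
    have /andP[? ?] := frac i iN.
    exists s, (b + h * (i%:R / N%:R)); split => //.
    by apply/andP; split; nra.
  have /andP[f1 f2] := frac i (ltnW iN); have /andP[f3 f4] := frac i.+1 iN.
  apply: le_trans (PhiL _ _ _ _) _; try by (apply/andP; split; nra).
  rewrite subrr normr0 add0r ler_pM2l // step.
  have -> : b + h * (i%:R / N%:R + N%:R^-1) - (b + h * (i%:R / N%:R)) = h / N%:R.
    by ring.
  by rewrite ger0_norm // divr_ge0 // ltW.
have [|x1 h1 n1] := horE b; first by apply/andP; split; lra.
have [|x2 h2 n2] := horE (b + h); first by apply/andP; split; lra.
have [|x3 h3 n3] := verE a; first by apply/andP; split; lra.
have [|x4 h4 n4] := verE (a + h); first by apply/andP; split; lra.
have -> : bnd N a b h = x1 + x4 - x2 - x3 by rewrite /bnd h1 h2 h3 h4; ring.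
have -> : 8 * e * L ^+ 2 * h ^+ 2 =
   e * (L * (h + h)) * (L * h) + e * (L * (h + h)) * (L * h) +
   e * (L * (h + h)) * (L * h) + e * (L * (h + h)) * (L * h) by ring.
apply: le_trans (ncB _ _) _; apply: lerD => //.
apply: le_trans (ncB _ _) _; apply: lerD => //.
by apply: le_trans (ncD _ _) _; apply: lerD.
Qed.

Hypothesis gdiff : forall s t, 0 <= s <= 1 -> 0 <= t <= 1 ->
  exists a, cdiff g (Phi s t) a.

(** Goursat's theorem, for contour integrals replaced by trapezoidal sums:
    bisecting a square on which the sums do not tend to 0 would lead to a point
    where [bnd_le] fails. *)
Lemma goursat c : 0 < c -> bnd_small c 0 0 1.
Proof.
move=> c0; apply: contrapT => bad.
pose h k : R := 2^-1 ^+ k.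
have h0 k : 0 < h k by rewrite exprn_gt0.
have hS k : h k = h k.+1 + h k.+1 by rewrite /h exprS; lra.
pose B k (p : R * R) := ~ bnd_small (c / 4 ^+ k) p.1 p.2 (h k).
(* One of the four quarters on which the contour sums stay large. *)
pose next k (p : R * R) : R * R := let h' := h k.+1 in
  if `[< B k.+1 p >] then p
  else if `[< B k.+1 (p.1 + h', p.2) >] then (p.1 + h', p.2)
  else if `[< B k.+1 (p.1, p.2 + h') >] then (p.1, p.2 + h')
  else (p.1 + h', p.2 + h').
pose fix s k : R * R := if k is k'.+1 then next k' (s k') else (0, 0).
have Bs k : B k (s k).
  elim: k => [|k IH]; first by rewrite /B /= /h expr0 divr1.
  rewrite /= /next; case: asboolP => // n1; case: asboolP => // n2.
  case: asboolP => // n3 n4; apply: IH; rewrite hS.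
  have -> : c / 4 ^+ k = c / 4 ^+ k.+1 * 4.
    by rewrite exprS; field; rewrite expf_neq0.
  apply: bnd_small_split; rewrite mulfK //; exact: contrapT.
have s1 k : (s k).1 <= (s k.+1).1 /\ (s k.+1).1 + h k.+1 <= (s k).1 + h k.
  have := h0 k.+1; rewrite [h k]hS /= /next.
  by case: asboolP => _ /=; [|case: asboolP => _ /=; [|case: asboolP => _ /=]];
    split; lra.
have s2 k : (s k).2 <= (s k.+1).2 /\ (s k.+1).2 + h k.+1 <= (s k).2 + h k.
  have := h0 k.+1; rewrite [h k]hS /= /next.
  by case: asboolP => _ /=; [|case: asboolP => _ /=; [|case: asboolP => _ /=]];
    split; lra.
have nested (u : nat -> R) : (forall k, u k <= u k.+1 /\
     u k.+1 + h k.+1 <= u k + h k) -> exists x, forall k, u k <= x <= u k + h k.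
  move=> hu.
  have mono k l : u k <= u (k + l)%N /\ u (k + l)%N + h (k + l)%N <= u k + h k.
    elim: l => [|l [IH1 IH2]]; first by rewrite addn0.
    by rewrite addnS; have [? ?] := hu (k + l)%N; split; lra.
  have ub k l : u l <= u k + h k.
    have [kl|lk] := leqP k l.
      have := mono k (l - k)%N; rewrite subnKC //; have := h0 l; lra.
    have := mono l (k - l)%N; rewrite subnKC ?(ltnW lk) //; have := h0 k; lra.
  exists (sup (range u)) => k; apply/andP; split.
    apply: ub_le_sup; last by exists k.
    by exists (u 0%N + h 0%N) => _ [l _ <-]; exact: ub.
  apply: ge_sup; first by exists (u 0%N), 0%N.
  by move=> _ [l _ <-]; exact: ub.
have [a ha] := nested _ s1; have [b hb] := nested _ s2.
have in1 k : 0 <= (s k).1 /\ (s k).1 + h k <= 1.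
  elim: k => [|k [? ?]]; first by rewrite /= /h expr0; lra.
  by have := s1 k; lra.
have in2 k : 0 <= (s k).2 /\ (s k).2 + h k <= 1.
  elim: k => [|k [? ?]]; first by rewrite /= /h expr0; lra.
  by have := s2 k; lra.
have h1 : h 0%N = 1 by rewrite /h expr0.
have [al gd] : exists al, cdiff g (Phi a b) al.
  by apply: gdiff; [have := ha 0%N|have := hb 0%N]; rewrite /= h1; lra.
pose e := c / (8 * L ^+ 2).
have e0 : 0 < e by rewrite divr_gt0 // mulr_gt0 // exprn_gt0.
have [dl dl0 gdl] := gd e e0.
have [k hk] : exists N, forall n, (N <= n)%N -> (2^-1 : R) ^+ n < dl / (2 * L).
  by apply: exp_small; [lra|lra|rewrite divr_gt0 // mulr_gt0].
apply: (Bs k); exists 0%N => K _.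
have [? ?] := in1 k; have [? ?] := in2 k.
apply: le_trans (bnd_le _ _ _ _ _ (ha k) (hb k) (ltW e0) gdl _ _) _ => //.
- exact: ltW.
- have := hk k (leqnn k); rewrite -/(h k) ltr_pdivlMr ?mulr_gt0 //; lra.
- by rewrite expn_gt0.
have -> : 8 * e * L ^+ 2 = c by rewrite /e; field; rewrite gt_eqF.
by rewrite /h -exprM mulnC exprM !exprVn [2 ^+ 2](_ : _ = 4) //; lra.
Qed.

End Square.
End Goursat.

(** * The boundary of a square *)

Section SquareContour.
Context {R : realType}.
Local Notation C := R[i].

(** The k-th side of the boundary of the square [-1, 1]^2, described
    counterclockwise. *)
Definition side (k : nat) (t : R) : C := 'i ^+ k * (1 + 'i * (2 * t - 1)%:C).

Lemma nc_side_ge1 k t : 1 <= nc (side k t).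
Proof.
rewrite ncM ncX nc_i expr1n mul1r; apply: le_trans (Re_le_nc _).
by simpc => /=; rewrite !(mul0r, mul1r, subr0, addr0, normr1).
Qed.

Lemma nc_side_le2 k t : 0 <= t <= 1 -> nc (side k t) <= 2.
Proof.
move=> /andP[t0 t1]; rewrite ncM ncX nc_i expr1n mul1r.
apply: le_trans (ncD _ _) _; rewrite nc1 ncM nc_i mul1r nc_real.
have : `|2 * t - 1| <= 1 by rewrite ler_norml; apply/andP; split; lra.
lra.
Qed.

Lemma nc_sideB k t t' : nc (side k t - side k t') = 2 * `|t - t'|.
Proof.
have -> : side k t - side k t' = 'i ^+ k * ('i * (2 * (t - t'))%:C).
  by rewrite /side !(rmorphB, rmorphM) /=; ring.
by rewrite !ncM ncX nc_i expr1n !mul1r nc_real normrM normr_nat.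
Qed.

Lemma side_joint k : side k 1 = side k.+1 0.
Proof.
have ii : 'i * 'i = - 1 :> C by rewrite -expr2 sqr_i.
rewrite /side exprS mulr0 sub0r rmorphN1 mulr1 -mulrA mulrCA; congr (_ * _).
rewrite [2 - 1](_ : _ = 1); last by ring.
by rewrite rmorph1 mulrDr mulrA ii; ring.
Qed.

Lemma side_period : side 4 0 = side 0 0.
Proof.
have i4 : 'i ^+ 4 = 1 :> C by rewrite (exprM _ 2 2) sqr_i expr2 mulrNN mulr1.
by rewrite /side i4 expr0.
Qed.

Lemma Im_sum n (F : 'I_n -> C) :
  complex.Im (\sum_(i < n) F i) = \sum_(i < n) complex.Im (F i).
Proof. by elim/big_rec2: _ => //= i x y _ <-; case: (F i) y => ? ? []. Qed.

Lemma Im_mulir (x y : C) (r : R) :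
  complex.Im ((x + y) * ('i * r%:C)) = (complex.Re x + complex.Re y) * r.
Proof. by case: x y => [x1 x2] [y1 y2] /=; ring. Qed.

(** Contour sum along that boundary. *)
Definition bint (u : C -> C) (N : nat) : C :=
  \sum_(k < 4) trap u (fun i => side k (i%:R / N%:R)) N.

Lemma frac01 i N : (i <= N)%N -> (0 < N)%N -> 0 <= (i%:R / N%:R : R) <= 1.
Proof.
move=> iN N0; have N0' : 0 < N%:R :> R by rewrite ltr0n.
by rewrite divr_ge0 //= ler_pdivrMr // mul1r ler_nat.
Qed.

Lemma frac_step i N : (i.+1%:R / N%:R : R) - i%:R / N%:R = N%:R^-1.
Proof. by rewrite -[i.+1]addn1 natrD; ring. Qed.

Lemma bint_le u N M : (0 < N)%N -> 0 <= M ->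
  (forall k t, 0 <= t <= 1 -> nc (u (side k t)) <= M) -> nc (bint u N) <= 8 * M.
Proof.
move=> N0 M0 uM; apply: le_trans (nc_sum _ _ _) _.
have -> : 8 * M = \sum_(k < 4) (M * (N%:R * (2 / N%:R))).
  rewrite sumr_const card_ord; field; by rewrite pnatr_eq0 -lt0n.
apply: ler_sum => k _; apply: trap_le => //.
  by move=> i iN; apply: uM; exact: frac01.
move=> i iN; rewrite nc_sideB frac_step ger0_norm // invr_ge0 ler0n //.
Qed.

Lemma bintD u v N : bint (fun z => u z + v z) N = bint u N + bint v N.
Proof. by rewrite -big_split; apply: eq_bigr => k _; rewrite trapD. Qed.

Lemma bintZ a u N : bint (fun z => a * u z) N = a * bint u N.
Proof. by rewrite mulr_sumr; apply: eq_bigr => k _; rewrite trapZ. Qed.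

Lemma eq_bint u v N : (0 < N)%N ->
  (forall k t, 0 <= t <= 1 -> u (side k t) = v (side k t)) -> bint u N = bint v N.
Proof.
move=> N0 uv; apply: eq_bigr => k _; apply: eq_trap => // i iN.
by apply: uv; exact: frac01.
Qed.

(** A substitute for the value 2 pi i of the integral of dz / z: on each side,
    the imaginary part of z^-1 dz is at least dt. *)
Lemma bint_inv_ge N : (0 < N)%N -> 4 <= nc (bint (fun z => z^-1) N).
Proof.
move=> N0; have N0' : 0 < N%:R :> R by rewrite ltr0n.
apply: le_trans (Im_le_nc _); apply: le_trans (ler_norm _).
rewrite Im_sum.
have -> : 4 = \sum_(k < 4) (1 : R) by rewrite sumr_const card_ord.
apply: ler_sum => k _.
rewrite Im_sum.
rewrite [leLHS](_ : 1 = \sum_(i < N) (N%:R^-1 : R)); last first.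
  by rewrite sumr_const card_ord -[RHS]mulr_natr mulVf ?gt_eqF.
apply: ler_sum => i _.
have inv_side t : (side k t)^-1 = 'i ^- k * (1 + 'i * (2 * t - 1)%:C)^-1.
  by rewrite /side invfM mulrC.
have i0 : 'i ^+ k != 0 :> C by rewrite expf_neq0 // -nc_gt0 nc_i.
have half (t : R) : 0 <= t <= 1 ->
    2^-1 <= complex.Re (1 + 'i * (2 * t - 1)%:C)^-1.
  move=> /andP[t0 t1]; simpc => /=.
  rewrite !(mul0r, mul1r, subr0, add0r, addr0) expr1n.
  by rewrite lef_pV2 ?posrE; nra.
rewrite [X in complex.Im X](_ : _ =
   ((1 + 'i * (2 * (i%:R / N%:R) - 1)%:C)^-1 +
   (1 + 'i * (2 * (i.+1%:R / N%:R) - 1)%:C)^-1) * ('i * (i.+1%:R / N%:R - i%:R / N%:R : R)%:C)); last first.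
  rewrite !inv_side.
  set A := (1 + _)^-1; set B := (1 + _)^-1.
  rewrite /side !(rmorphB, rmorphM) /= (rmorph_nat (real_complex R)).
  by field; rewrite i0 pnatr_eq0 -lt0n N0.
rewrite (frac_step i N).
have := half _ (frac01 (ltnW (ltn_ord i)) N0).
have := half _ (frac01 (ltn_ord i) N0).
rewrite Im_mulir; set x := complex.Re _; set y := complex.Re _ => h1 h2.
rewrite -[leLHS]mul1r ler_wpM2r ?invr_ge0 //; lra.
Qed.
End SquareContour.

(** * Cauchy's theorem for difference quotients *)

Section Cauchy.
Context {R : realType}.
Local Notation C := R[i].

Lemma cdiff_divdiff (f : C -> C) (zt z a : C) : z != zt -> cdiff f z a ->
  exists a', cdiff (fun w => (f w - f zt) / (w - zt)) z a'.
Proof.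
move=> zzt fz; pose g w := (f w - f zt) / (w - zt); rewrite -/g; exists ((a - g z) / (z - zt)) => e e0.
have m0 : 0 < nc (z - zt) by rewrite nc_gt0 subr_eq0.
set m := nc (z - zt) in m0.
have n0 : z - zt != 0 by rewrite subr_eq0.
pose A := nc (a - g z).
have A0 : 0 <= A := nc_ge0 _.
have [dl dl0 h] := fz (e * m / 4) (divr_gt0 (mulr_gt0 e0 m0) (ltr0n _ 4)).
exists (Num.min dl (Num.min (m / 2) (e * m ^+ 2 / (4 * (A + 1))))).
  rewrite !lt_min dl0 !divr_gt0 //= ?mulr_gt0 ?exprn_gt0 //; lra.
move=> w; rewrite !lt_min => /and3P[w1 w2 w3].
have n1 : m / 2 <= nc (w - zt).
  have := ncB_ge (z - zt) (z - w); rewrite -/m.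
  rewrite [z - zt - (z - w)](_ : _ = w - zt); last by ring.
  rewrite (ncBC z w); lra.
have n2 : w - zt != 0 by rewrite -nc_gt0; lra.
have -> : g w - g z - (a - g z) / (z - zt) * (w - z) =
   (f w - f z - a * (w - z)) / (w - zt) -
    (a - g z) * (w - z) ^+ 2 / ((w - zt) * (z - zt)).
  by rewrite /g; field; rewrite n0 n2.
apply: le_trans (ncB _ _) _.
rewrite !ncM !ncV !ncM -/A -/m.
set t := nc (w - z) in w1 w2 w3 *; set u := nc (w - zt) in n1 *.
have t0 : 0 <= t := nc_ge0 _.
have u0 : 0 < u by lra.
have h1 := h w w1; rewrite -/t in h1.
have -> : e * t = e / 2 * t + e / 2 * t by field.
apply: lerD.
  rewrite ler_pdivrMr //; apply: le_trans h1 _.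
  have -> : e * m / 4 * t = e / 2 * t * (m / 2) by field.
  by rewrite ler_wpM2l // mulr_ge0 // ltW // divr_gt0.
rewrite ler_pdivrMr ?mulr_gt0 //.
have h3 : A * t <= e * m ^+ 2 / 4.
  move/ltW: w3; rewrite ler_pdivlMr; last by lra.
  by nra.
apply: (@le_trans _ _ (t * (e * m ^+ 2 / 4))); first by nra.
have -> : e / 2 * t * (u * m) = t * (e * m / 2) * u by field.
have -> : t * (e * m ^+ 2 / 4) = t * (e * m / 2) * (m / 2) by field.
by rewrite ler_wpM2l // !mulr_ge0 // ?invr_ge0 //; lra.
Qed.

Section Disc.
Variables (f : C -> C).
Hypothesis fdiff : forall z, nc z < 3 -> exists a, cdiff f z a.

(** Cauchy's theorem for the difference quotient at zt, on the boundary of the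
    square: contract that boundary towards zt.  The quotient is bounded near
    zt, hence the integral along the contracted contour is small. *)
Lemma cauchy_divdiff zt e : nc zt <= 2^-1 -> 0 < e ->
  exists K0, forall K, (K0 <= K)%N ->
    nc (bint (fun z => (f z - f zt) / (z - zt)) (2 ^ K)) <= e.
Proof.
move=> zt1 e0; pose g z := (f z - f zt) / (z - zt); rewrite -/g.
have [|a0 fzt] := fdiff (z := zt); first by lra.
have [dl dl0 gb] : exists2 dl, 0 < dl &
    forall w, nc (w - zt) < dl -> nc (g w) <= nc a0 + 1.
  have [dl dl0 h] := fzt 1 ltr01; exists dl => // w wd.
  have [->|wz] := eqVneq w zt.
    by rewrite /g !subrr mul0r nc0; have := nc_ge0 a0; lra.
  have w0 : 0 < nc (w - zt) by rewrite nc_gt0 subr_eq0.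
  rewrite /g ncM ncV ler_pdivrMr //.
  have := h w wd; have := ncD (f w - f zt - a0 * (w - zt)) (a0 * (w - zt)).
  by rewrite subrK ncM; lra.
pose B := nc a0 + 1.
have B0 : 0 < B by have := nc_ge0 a0; rewrite /B; lra.
pose d := Num.min (2^-1) (Num.min (dl / 3) (e / (16 * B))).
have d0 : 0 < d by rewrite /d !lt_min !divr_gt0 //; lra.
have [d1 d2 d3] : [/\ d <= 2^-1, d <= dl / 3 & d * (16 * B) <= e].
  split; [by rewrite /d ge_min lexx| |].
    by rewrite /d !ge_min lexx /= orbT.
  by rewrite -ler_pdivlMr ?mulr_gt0 // /d !ge_min lexx /= !orbT.
(* For s from 0 to 1, Phi k s runs from the k-th side of a square of size d
   around zt to the k-th side of the original square. *)
pose lm (s : R) := d + (1 - d) * s.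
pose Phi k s t := zt + (lm s)%:C * (side k t - zt).
have lmP s : 0 <= s <= 1 -> d <= lm s <= 1.
  by move=> /andP[s0 s1]; rewrite /lm; apply/andP; split; nra.
have side_zt k t : 0 <= t <= 1 -> 2^-1 <= nc (side k t - zt) <= 5 / 2.
  move=> tt; have := nc_side_ge1 k t; have := nc_side_le2 k tt.
  have := ncB_ge (side k t) zt; have := ncB (side k t) zt.
  by move=> *; apply/andP; split; lra.
have PhiL k s t s' t' : 0 <= s <= 1 -> 0 <= t <= 1 ->
    0 <= s' <= 1 -> 0 <= t' <= 1 ->
    nc (Phi k s t - Phi k s' t') <= 3 * (`|s - s'| + `|t - t'|).
  move=> /lmP/andP[l1 l2] tt /lmP/andP[l3 l4] tt'.
  have -> : Phi k s t - Phi k s' t' =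
    (lm s)%:C * (side k t - side k t') + ((1 - d) * (s - s'))%:C * (side k t' - zt).
    by rewrite /Phi /lm !(rmorphB, rmorphD, rmorphM) /=; ring.
  apply: le_trans (ncD _ _) _.
  rewrite (ncM (lm s)%:C) (ncM ((1 - d) * _)%:C) !nc_real nc_sideB normrM.
  rewrite (ger0_norm (x := lm s)) ?(ger0_norm (x := 1 - d)); try lra.
  have := normr_ge0 (s - s'); have := normr_ge0 (t - t').
  set x := `|s - s'|; set y := `|t - t'|; set u := nc _ => y0 x0.
  have /andP[u1 u2] : 2^-1 <= u <= 5 / 2 by exact: side_zt.
  have : lm s * (2 * y) <= 2 * y by nra.
  have xu0 : 0 <= x * u by rewrite mulr_ge0; lra.
  have : (1 - d) * x * u <= x * u by rewrite -mulrA; nra.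
  have : x * u <= x * (5 / 2) by rewrite ler_wpM2l.
  by lra.
have gPhi k s t : 0 <= s <= 1 -> 0 <= t <= 1 -> exists a, cdiff g (Phi k s t) a.
  move=> /lmP/andP[l1 l2] tt; have /andP[u1 u2] := side_zt k t tt.
  have [|a ha] := fdiff (z := Phi k s t).
    have -> : Phi k s t = (1 - lm s)%:C * zt + (lm s)%:C * side k t.
      by rewrite /Phi rmorphB rmorph1; ring.
    apply: le_lt_trans (ncD _ _) _.
    rewrite (ncM (1 - _)%:C) (ncM (lm s)%:C) !nc_real !ger0_norm; try lra.
    have := nc_side_le2 k tt.
    have : lm s * nc (side k t) <= nc (side k t) by rewrite ler_piMl ?nc_ge0.
    have : (1 - lm s) * nc zt <= nc zt by rewrite ler_piMl ?nc_ge0 //; lra.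
    lra.
  apply: cdiff_divdiff ha; rewrite -subr_eq0 /Phi addrC addKr -nc_gt0 ncM nc_real.
  by rewrite mulr_gt0 // ?normr_gt0; [rewrite gt_eqF //; lra|lra].
have small k : bnd_small g (Phi k) (e / 8) 0 0 1.
  by apply: (@goursat _ _ _ 3) => //; [exact: PhiL|exact: gPhi|lra].
have joint k N s : (0 < N)%N -> hor g (Phi k) N 0 (0 + 1) s = hor g (Phi k.+1) N 0 0 s.
  by move=> N0; apply: eq_trap => // i _; rewrite !add0r /Phi side_joint.
have period N s : hor g (Phi 4) N 0 0 s = hor g (Phi 0%N) N 0 0 s.
  by apply: eq_trap => // i _; rewrite /Phi side_period.
have [K0 [K1 [K2 [K3 hK]]]] : exists K0 K1 K2 K3, forall K (k : 'I_4),
    (K0 + K1 + K2 + K3 <= K)%N -> nc (bnd g (Phi k) (2 ^ K) 0 0 1) <= e / 8.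
  have [K0 h0] := small 0%N; have [K1 h1] := small 1%N.
  have [K2 h2] := small 2%N; have [K3 h3] := small 3%N.
  exists K0, K1, K2, K3 => K [[|[|[|[|//]]]] ?] KK /=; [apply: h0|apply: h1|
    apply: h2|apply: h3]; apply: leq_trans KK; lia.
exists (K0 + K1 + K2 + K3)%N => K KK; set N := (2 ^ K)%N.
have N0 : (0 < N)%N by rewrite expn_gt0.
have N0' : 0 < N%:R :> R by rewrite ltr0n.
have inner k : nc (ver g (Phi k) N 0 0 1) <= e / 8.
  have -> : e / 8 = e / (16 * B) * (N%:R * (2 * B / N%:R)).
    by field; rewrite !gt_eqF.
  apply: (@le_trans _ _ (B * (N%:R * (2 * d / N%:R)))); last first.
    rewrite mulrCA [leRHS]mulrCA; apply: ler_wpM2l; first exact: ltW.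
    have -> : B * (2 * d / N%:R) = 2 * B / N%:R * d by ring.
    have -> : e / (16 * B) * (2 * B / N%:R) = 2 * B / N%:R * (e / (16 * B)) by ring.
    apply: ler_wpM2l; first by rewrite divr_ge0 ?mulr_ge0 // ltW.
    by rewrite ler_pdivlMr // mulr_gt0.
  apply: trap_le; [|exact: ltW|].
    move=> i iN; apply: gb; rewrite /Phi addrC addKr ncM nc_real /lm mulr0 addr0.
    rewrite gtr0_norm // add0r mul1r.
    have /andP[_ u2] := side_zt k _ (frac01 iN N0); nra.
  move=> i iN; rewrite /Phi /lm mulr0 addr0 !add0r !mul1r.
  rewrite [X in nc X](_ : _ = d%:C * (side k (i.+1%:R / N%:R) - side k (i%:R / N%:R)));
    last by ring.
  by rewrite ncM nc_real gtr0_norm // nc_sideB frac_step ger0_norm ?invr_ge0 // mulrA [d * 2]mulrC.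
(* The radial sides of the four contours cancel. *)
have -> : bint g N = \sum_(k < 4) (bnd g (Phi k) N 0 0 1 + ver g (Phi k) N 0 0 1).
  have E k : bnd g (Phi k) N 0 0 1 + ver g (Phi k) N 0 0 1 =
     hor g (Phi k) N 0 0 1 - hor g (Phi k.+1) N 0 0 1 +
       trap g (fun i => side k (i%:R / N%:R)) N.
    rewrite /bnd joint // subrK addrAC; congr (_ + _).
    rewrite /ver add0r; apply: eq_trap => // i _.
    by rewrite /Phi /lm add0r mul1r mulr1 subrKC rmorph1 mul1r subrKC.
  under eq_bigr do rewrite E.
  rewrite big_split /= [X in X + _](_ : _ = 0) ?add0r //.
  by rewrite !big_ord_recr big_ord0 /= period; ring.
apply: le_trans (nc_sum _ _ _) _.
have -> : e = \sum_(k < 4) (e / 8 + e / 8).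
  by rewrite sumr_const card_ord; field.
apply: ler_sum => k _; apply: le_trans (ncD _ _) _; apply: lerD => //.
exact: hK.
Qed.

End Disc.
End Cauchy.

(** * Second-order Taylor estimate in one variable *)

Section Taylor2.
Context {R : realType}.
Local Notation C := R[i].

(** Cauchy's formula, with 1 / (z - x) expanded as
    1 / z + x / z ^ 2 + x ^ 2 / (z ^ 2 * (z - x)).  The coefficient b depends on
    the fineness of the contour sums, hence on e, but it is the same for the two
    points zt and w. *)
Lemma cauchy_expansion (f : C -> C) (M e : R) (zt w : C) :
  (forall z, nc z < 3 -> exists a, cdiff f z a) ->
  (forall z, nc z < 3 -> nc (f z) <= M) -> f 0 = 0 ->
  nc zt <= 8^-1 -> nc w <= 8^-1 -> 0 < e ->
  exists b, nc (f zt - zt * b) <= e + 24 * M * nc zt ^+ 2 /\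
            nc (f w - w * b) <= e + 24 * M * nc w ^+ 2.
Proof.
move=> fd fM f0 zt1 w1 e0.
have M0 : 0 <= M by apply: le_trans (nc_ge0 _) (fM 0 _); rewrite nc0.
have zt2 : nc zt <= 2^-1 by lra.
have w2 : nc w <= 2^-1 by lra.
have [K1 h1] := cauchy_divdiff fd zt2 e0.
have [K2 h2] := cauchy_divdiff fd w2 e0.
have [|K3 h3] := cauchy_divdiff fd (zt := 0) _ e0; first by rewrite nc0.
pose K := (K1 + K2 + K3)%N; pose N := (2 ^ K)%N.
have /h1 {}h1 : (K1 <= K)%N by rewrite /K; lia.
have /h2 {}h2 : (K2 <= K)%N by rewrite /K; lia.
have /h3 {}h3 : (K3 <= K)%N by rewrite /K; lia.
rewrite -/N in h1 h2 h3.
have N0 : (0 < N)%N by rewrite expn_gt0.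
pose ka := bint (fun z : C => z^-1) N.
have ka4 : 4 <= nc ka := bint_inv_ge N0.
have kan0 : ka != 0 by rewrite -nc_gt0; lra.
pose B := bint (fun z => f z / z ^+ 2) N.
exists (B / ka).
have main x : nc x <= 8^-1 ->
    nc (bint (fun z => (f z - f x) / (z - x)) N) <= e ->
    nc (f x - x * (B / ka)) <= e + 24 * M * nc x ^+ 2.
  move=> x1 hx.
  have sd k t : 0 <= t <= 1 -> [/\ side k t != 0, side k t - x != 0,
      nc (side k t)^-1 <= 1, nc (side k t - x)^-1 <= 2 & nc (f (side k t)) <= M].
    move=> tt; have s1 := @nc_side_ge1 R k t; have s2 := nc_side_le2 k tt.
    have s3 : 2^-1 <= nc (side k t - x) by have := ncB_ge (side k t) x; lra.
    split; rewrite -?nc_gt0 ?ncV; try lra.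
    - by rewrite invf_le1 //; lra.
    - by rewrite -[2 in leRHS]invrK lef_pV2 ?posrE //; lra.
    - by apply: fM; lra.
  pose A := bint (fun z => (f z - f 0) / (z - 0)) N.
  pose Cx := bint (fun z => f z / (z ^+ 2 * (z - x))) N.
  pose k1 := bint (fun z => (z * (z - x))^-1) N.
  have Cx1 : nc Cx <= 8 * (2 * M).
    apply: bint_le => //; first by lra.
    move=> k t /(sd k)[n1 n2 i1 i2 fs]; rewrite ncM invfM ncM -exprVn ncX.
    have := nc_ge0 (side k t)^-1; have := nc_ge0 (side k t - x)^-1.
    have := nc_ge0 (f (side k t)).
    set a := nc (f _) in fs *; set b := nc _ in i1 *; set c := nc _ in i2 *.
    move=> a0 c0 b0.
    have : b ^+ 2 <= 1 by rewrite expr_le1.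
    have := exprn_ge0 2 b0; set b2 := b ^+ 2 => b20 b21.
    have : b2 * c <= 1 * 2 by apply: ler_pM.
    by move=> bc; rewrite [2 * M]mulrC; apply: ler_pM => //; [rewrite mulr_ge0|lra].
  have k11 : nc k1 <= 8 * 2.
    apply: bint_le => // k t /(sd k)[n1 n2 i1 i2 fs]; rewrite invfM ncM.
    by rewrite -[leRHS]mul1r; apply: ler_pM => //; rewrite nc_ge0.
  have B1 : nc B <= 8 * M.
    apply: bint_le => // k t /(sd k)[n1 n2 i1 i2 fs]; rewrite ncM -exprVn ncX.
    rewrite -[leRHS]mulr1; apply: ler_pM => //; rewrite ?nc_ge0 ?exprn_ge0 ?nc_ge0 //.
    by rewrite expr_le1 // nc_ge0.
  pose S := bint (fun z => (f z - f x) / (z - x)) N.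
  have E : f x * (ka + x * k1) = A + x * B + x ^+ 2 * Cx - S.
    apply/eqP; rewrite eq_sym subr_eq eq_sym; apply/eqP.
    rewrite /A /B /Cx /S /ka /k1 -!bintZ -!bintD -!bintZ -!bintD.
    apply: eq_bint => // k t /(sd k)[n1 n2 _ _ _].
    by rewrite f0; field; rewrite n1 n2.
  have nk : 2 <= nc (ka + x * k1).
    have := ncB_ge ka (- (x * k1)); rewrite opprK ncN ncM.
    have := nc_ge0 x; have : nc x * nc k1 <= 8^-1 * (8 * 2).
      by apply: ler_pM; rewrite ?nc_ge0.
    lra.
  have x0 := nc_ge0 x.
  have S1 : nc S <= e := hx.
  have A1 : nc A <= e := h3.
  have xB : nc (x * B) <= nc x * (8 * M) by rewrite ncM ler_wpM2l.
  have xC : nc (x ^+ 2 * Cx) <= nc x ^+ 2 * (8 * (2 * M)).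
    by rewrite ncM ncX ler_wpM2l // exprn_ge0.
  have fx1 : nc (f x) <= e + 5 * M * nc x.
    have : nc (f x * (ka + x * k1)) <= 2 * e + nc x * (8 * M) + nc x ^+ 2 * (8 * (2 * M)).
      rewrite E; apply: le_trans (ncB _ _) _.
      have := ncD (A + x * B) (x ^+ 2 * Cx); have := ncD A (x * B); lra.
    rewrite ncM; have := nc_ge0 (f x).
    have x8 : 0 <= 8^-1 - nc x by lra.
    have := mulr_ge0 (mulr_ge0 M0 x0) x8; rewrite expr2.
    move=> h1' fx0 h2'.
    have := ler_wpM2l fx0 nk; lra.
  have E2 : f x - x * (B / ka) = (A - S + x ^+ 2 * Cx - f x * x * k1) / ka.
    have -> : A - S = f x * (ka + x * k1) - x * B - x ^+ 2 * Cx by rewrite E; ring.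
    by field.
  rewrite E2 ncM ncV ler_pdivrMr; last by lra.
  apply: le_trans (ncB _ _) _.
  have h4 : nc (f x * x * k1) <= (e + 5 * M * nc x) * nc x * (8 * 2).
    rewrite !ncM; apply: ler_pM => //; rewrite ?mulr_ge0 ?nc_ge0 //.
    by apply: ler_pM; rewrite ?nc_ge0.
  have h5 := ncD (A - S) (x ^+ 2 * Cx); have h6 := ncB A S.
  apply: (@le_trans _ _ ((e + 24 * M * nc x ^+ 2) * 4)); last first.
    by apply: ler_wpM2l => //; rewrite addr_ge0 ?mulr_ge0 ?exprn_ge0 //; lra.
  have h7 : e * nc x <= e * 8^-1 by rewrite ler_wpM2l // ltW.
  have : (e + 5 * M * nc x) * nc x * (8 * 2) = 16 * (e * nc x) + 80 * (M * nc x ^+ 2) by ring.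
  by nra.
by split; apply: main.
Qed.

(** Applied to a second point s close to 0, [cauchy_expansion] shows that its
    coefficient b is close to the derivative. *)
Lemma taylor2_unit (f : C -> C) (M : R) (a zt : C) :
  (forall z, nc z < 3 -> exists a, cdiff f z a) ->
  (forall z, nc z < 3 -> nc (f z) <= M) -> cdiff f 0 a -> nc zt <= 8^-1 ->
  nc (f zt - f 0 - a * zt) <= 48 * M * nc zt ^+ 2.
Proof.
move=> fd fM fa zt1.
have M0 : 0 <= M by apply: le_trans (nc_ge0 _) (fM 0 _); rewrite nc0.
pose g z := f z - f 0.
have gd z : nc z < 3 -> exists a, cdiff g z a.
  move=> /fd[c hc]; exists c => e e0; have [dl dl0 h] := hc e e0.
  by exists dl => // w /h; rewrite /g opprB addrA subrK.
have gM z : nc z < 3 -> nc (g z) <= 2 * M.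
  move=> z3; apply: le_trans (ncB _ _) _; have := fM z z3.
  have := fM 0; rewrite nc0 => /(_ (ltr0n _ 3)); lra.
have g0 : g 0 = 0 by rewrite /g subrr.
apply: le_of_eps => e e0.
pose t := nc zt; have t0 : 0 <= t := nc_ge0 _.
(* eta is chosen so that all the error terms below add up to at most e. *)
pose eta := Num.min (8^-1) (e / (4 + 48 * M)).
have D0 : 0 < 4 + 48 * M by nra.
have eta0 : 0 < eta by rewrite /eta lt_min divr_gt0 // andbT.
have eta1 : eta <= 8^-1 by rewrite /eta ge_min lexx.
have eta2 : eta * (4 + 48 * M) <= e.
  by rewrite -ler_pdivlMr // /eta ge_min lexx orbT.
have [dl dl0 h] := fa eta eta0.
pose s := Num.min eta (dl / 2).
have s0 : 0 < s by rewrite /s lt_min eta0 divr_gt0.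
have s1 : s <= eta by rewrite /s ge_min lexx.
have s2 : s < dl by apply: (@le_lt_trans _ _ (dl / 2)); [rewrite /s ge_min lexx orbT|lra].
have ns : nc s%:C = s by rewrite nc_real gtr0_norm.
have [b [b1 b2]] : exists b, nc (g zt - zt * b) <= eta * s + 24 * (2 * M) * nc zt ^+ 2 /\
    nc (g s%:C - s%:C * b) <= eta * s + 24 * (2 * M) * nc s%:C ^+ 2.
  by apply: cauchy_expansion => //; rewrite ?ns ?mulr_gt0 //; lra.
have := h s%:C; rewrite subr0 ns => /(_ s2) hs.
have ab : nc (b - a) <= eta * (2 + 48 * M).
  have sab : nc (s%:C * (b - a)) <= eta * s + eta * s + 24 * (2 * M) * s ^+ 2.
    have -> : s%:C * (b - a) = (f s%:C - f 0 - a * s%:C) - (g s%:C - s%:C * b).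
      by rewrite /g; ring.
    apply: le_trans (ncB _ _) _; rewrite ns in b2; lra.
  rewrite ncM ns in sab.
  have : s * nc (b - a) <= s * (eta * (2 + 48 * M)).
    apply: le_trans sab _; rewrite expr2.
    have : M * s * s <= M * s * eta by rewrite ler_wpM2l // mulr_ge0 // ltW.
    lra.
  by rewrite ler_pM2l.
have -> : f zt - f 0 - a * zt = (g zt - zt * b) + zt * (b - a) by rewrite /g; ring.
apply: le_trans (ncD _ _) _; rewrite ncM -/t; rewrite -/t in b1.
have : t * nc (b - a) <= 8^-1 * (eta * (2 + 48 * M)).
  by apply: ler_pM => //; rewrite nc_ge0.
have : eta * s <= eta * 1 by rewrite ler_pM2l //; lra.
have : 0 <= eta * M by rewrite mulr_ge0 // ltW.
lra.
Qed.

(** The quantitative consequence of differentiability from which all the later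
    estimates are derived: the constant depends only on M and r. *)
Lemma taylor2 (f : C -> C) (M r : R) (a v : C) : 0 < r ->
  (forall z, nc z < r -> exists a, cdiff f z a) ->
  (forall z, nc z < r -> nc (f z) <= M) -> cdiff f 0 a -> nc v <= r / 24 ->
  nc (f v - f 0 - a * v) <= 432 * M * (nc v / r) ^+ 2.
Proof.
move=> r0 fd fM fa v1.
pose c := r / 3; have c0 : 0 < c by rewrite divr_gt0.
have cn0 : c%:C != 0 by rewrite -nc_gt0 nc_real normr_gt0 gt_eqF.
have scale z b : cdiff f (c%:C * z) b -> cdiff (fun z => f (c%:C * z)) z (b * c%:C).
  move=> h e e0; have [dl dl0 {}h] := h (e / c) (divr_gt0 e0 c0).
  exists (dl / c); first by rewrite divr_gt0.
  move=> w; rewrite ltr_pdivlMr // => wz.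
  have E : nc (c%:C * w - c%:C * z) = nc (w - z) * c.
    by rewrite -mulrBr ncM nc_real gtr0_norm // mulrC.
  have := h (c%:C * w); rewrite E => /(_ wz).
  have -> : e / c * (nc (w - z) * c) = e * nc (w - z) by field; rewrite gt_eqF.
  by rewrite -mulrBr mulrA.
have := @taylor2_unit (fun z => f (c%:C * z)) M (a * c%:C) (v / c%:C).
have e1 : c%:C * (v / c%:C) = v by rewrite mulrC divfK.
have e2 : a * c%:C * (v / c%:C) = a * v by rewrite -mulrA e1.
rewrite mulr0 e2 e1.
rewrite ncM ncV nc_real gtr0_norm //.
have -> : 432 * M * (nc v / r) ^+ 2 = 48 * M * (nc v / c) ^+ 2.
  by rewrite /c; field; rewrite gt_eqF.
have dom z : nc z < 3 -> nc (c%:C * z) < r.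
  by rewrite ncM nc_real gtr0_norm // /c; nra.
apply.
- by move=> z /dom/fd[b /scale]; exists (b * c%:C).
- by move=> z /dom/fM.
- by apply: scale; rewrite mulr0.
- by rewrite ler_pdivrMr // /c; lra.
Qed.

End Taylor2.

(** * Maximum norm and derivatives *)

Section MaxNorm.
Context {R : realType} {d : nat}.
Local Notation C := R[i].
Local Notation V := 'rV[C]_d.
Implicit Types z w v : V.

(** The norm of row vectors, as a real number; see [nvE]. *)
Definition nv (z : V) : R := \big[Num.max/0]_(i < d) nc (z 0 i).

Lemma nv_ge0 z : 0 <= nv z.
Proof. by rewrite /nv; elim/big_rec: _ => // i x _ x0; rewrite le_max x0 orbT. Qed.

Lemma nc_le_nv z i : nc (z 0 i) <= nv z.
Proof. by rewrite /nv (bigD1 i) //= le_max lexx. Qed.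

Lemma nv_le z (r : R) : 0 <= r -> (forall i, nc (z 0 i) <= r) -> nv z <= r.
Proof. by move=> r0 h; rewrite /nv; elim/big_rec: _ => // i x _ xr; rewrite ge_max h. Qed.

Lemma nv_lt z (r : R) : 0 < r -> (forall i, nc (z 0 i) < r) -> nv z < r.
Proof. by move=> r0 h; rewrite /nv; elim/big_rec: _ => // i x _ xr; rewrite gt_max h. Qed.

Lemma nv0 : nv 0 = 0.
Proof.
apply/eqP; rewrite eq_le nv_ge0 andbT; apply: nv_le => // i; by rewrite mxE nc0.
Qed.

Lemma nvN z : nv (- z) = nv z.
Proof. by apply: eq_bigr => i _; rewrite mxE ncN. Qed.

Lemma nvD z w : nv (z + w) <= nv z + nv w.
Proof.
apply: nv_le => [|i]; first by rewrite addr_ge0 ?nv_ge0.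
by rewrite mxE; apply: le_trans (ncD _ _) _; rewrite lerD ?nc_le_nv.
Qed.

Lemma nvB z w : nv (z - w) <= nv z + nv w.
Proof. by rewrite -[nv w]nvN nvD. Qed.

Lemma nvBC z w : nv (z - w) = nv (w - z).
Proof. by rewrite -nvN opprB. Qed.

Lemma nvBD x z w : nv (z - w) <= nv (z - x) + nv (x - w).
Proof. by rewrite -[z - w](subrKA x) nvD. Qed.

Lemma nvB_ge z w : nv z - nv w <= nv (z - w).
Proof. by rewrite lerBlDr -[X in nv X <= _](subrK w) nvD. Qed.

Lemma nvZ (a : C) z : nv (a *: z) = nc a * nv z.
Proof.
rewrite /nv; elim/big_rec2: _ => [|i x y _ ->]; first by rewrite mulr0.
by rewrite mxE ncM maxr_pMr ?nc_ge0.
Qed.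

Lemma nv_eq0 z : (nv z == 0) = (z == 0).
Proof.
apply/eqP/eqP => [h|->]; last exact: nv0.
apply/rowP => i; rewrite mxE; apply/eqP; rewrite -nc_eq0 eq_le nc_ge0 andbT.
by rewrite -h nc_le_nv.
Qed.

Lemma nv_gt0 z : (0 < nv z) = (z != 0).
Proof. by rewrite lt_def nv_eq0 nv_ge0 andbT. Qed.

Lemma nv_delta (i : 'I_d) (a : C) : nv (a *: delta_mx 0 i) = nc a.
Proof.
apply/eqP; rewrite eq_le; apply/andP; split.
  apply: nv_le => [|j]; first exact: nc_ge0.
  by rewrite !mxE eqxx /=; case: eqP => _; rewrite ?mulr1 ?mulr0 ?nc0 ?nc_ge0.
by have := nc_le_nv (a *: delta_mx 0 i) i; rewrite !mxE !eqxx mulr1.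
Qed.

Definition lin (D : 'I_d -> C) (v : V) : C := \sum_i D i * v 0 i.

Lemma linDr D v w : lin D (v + w) = lin D v + lin D w.
Proof. by rewrite -big_split; apply: eq_bigr => i _; rewrite mxE mulrDr. Qed.

Lemma linZr D a v : lin D (a *: v) = a * lin D v.
Proof. by rewrite mulr_sumr; apply: eq_bigr => i _; rewrite mxE; ring. Qed.

Lemma linNr D v : lin D (- v) = - lin D v.
Proof. by rewrite -scaleN1r linZr mulN1r. Qed.

Lemma linBr D v w : lin D (v - w) = lin D v - lin D w.
Proof. by rewrite linDr linNr. Qed.

Lemma lin_delta D i : lin D (delta_mx 0 i) = D i.
Proof.
rewrite /lin (bigD1 i) //= mxE !eqxx mulr1 big1 ?addr0 // => j ji.
by rewrite mxE eqxx (negbTE ji) mulr0.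
Qed.

Lemma lin_le D v : nc (lin D v) <= (\sum_i nc (D i)) * nv v.
Proof.
apply: le_trans (nc_sum _ _ _) _; rewrite mulr_suml; apply: ler_sum => i _.
by rewrite ncM ler_wpM2l ?nc_ge0 ?nc_le_nv.
Qed.

End MaxNorm.

Section Holomorphic.
Context {R : realType}.
Local Notation C := R[i].

Section Dim.
Context {d : nat}.
Local Notation V := 'rV[C]_d.

(** D i is the i-th partial derivative of a at z. *)
Definition sd (a : V -> C) (z : V) (D : 'I_d -> C) := forall e : R, 0 < e ->
  exists2 dl : R, 0 < dl & forall v, nv v < dl ->
    nc (a (z + v) - a z - lin D v) <= e * nv v.

Definition hol (a : V -> C) (z : V) := exists D, sd a z D.

Lemma eq_near_sd (a b : V -> C) z D r : 0 < r ->
  (forall v, nv v < r -> a (z + v) = b (z + v)) -> sd b z D -> sd a z D.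
Proof.
move=> r0 ab h e e0; have [dl dl0 {}h] := h e e0.
exists (Num.min dl r); first by rewrite lt_min dl0.
move=> v; rewrite lt_min => /andP[v1 v2]; rewrite ab //.
by have := ab 0; rewrite nv0 addr0 => -> //; exact: h.
Qed.

Lemma eq_near_hol (a b : V -> C) z r : 0 < r ->
  (forall v, nv v < r -> a (z + v) = b (z + v)) -> hol b z -> hol a z.
Proof. by move=> r0 ab [D /(eq_near_sd r0 ab)]; exists D. Qed.

(** It is enough to find the error terms e * nv v up to a constant factor. *)
Lemma sd_weak (a : V -> C) z D (K : R) :
  (forall e, 0 < e -> e <= 1 -> exists2 dl : R, 0 < dl & forall v, nv v < dl ->
    nc (a (z + v) - a z - lin D v) <= K * e * nv v) -> sd a z D.
Proof.
move=> h e e0.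
have K1 : 0 < `|K| + 1 by rewrite ltr_wpDl.
have [||dl dl0 hd] := h (Num.min 1 (e / (`|K| + 1))).
- by rewrite lt_min ltr01 divr_gt0.
- by rewrite ge_min lexx.
exists dl => // v /hd{}hd; apply: le_trans hd _.
rewrite ler_wpM2r ?nv_ge0 //.
apply: (@le_trans _ _ ((`|K| + 1) * (e / (`|K| + 1)))); last first.
  by rewrite mulrC divfK // gt_eqF.
apply: (@le_trans _ _ ((`|K| + 1) * Num.min 1 (e / (`|K| + 1)))).
  apply: ler_wpM2r; first by rewrite le_min ler01 divr_ge0 // ltW.
  by have := ler_norm K; lra.
by apply: ler_wpM2l; [exact: ltW|rewrite ge_min lexx orbT].
Qed.

Lemma sd_const c z : sd (fun=> c) z (fun=> 0).
Proof.
move=> e e0; exists 1 => // v _; rewrite subrr sub0r ncN /lin big1 ?nc0.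
  by rewrite mulr_ge0 ?nv_ge0 // ltW.
by move=> i _; rewrite mul0r.
Qed.

Lemma sd_lin D z : sd (lin D) z D.
Proof.
move=> e e0; exists 1 => // v _; rewrite linDr [X in nc X](_ : _ = 0) ?nc0; last by ring.
by rewrite mulr_ge0 ?nv_ge0 // ltW.
Qed.

Lemma sd_coord i z : sd (fun x => x 0 i) z (fun j => (i == j)%:R).
Proof.
have E v : lin (fun j => (i == j)%:R) v = v 0 i.
  rewrite /lin (bigD1 i) //= eqxx mul1r big1 ?addr0 // => j ji.
  by rewrite eq_sym (negbTE ji) mul0r.
move=> e e0; exists 1 => // v _; rewrite E mxE [X in nc X](_ : _ = 0) ?nc0; last by ring.
by rewrite mulr_ge0 ?nv_ge0 // ltW.
Qed.

Lemma sdD a b z D E : sd a z D -> sd b z E ->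
  sd (fun x => a x + b x) z (fun i => D i + E i).
Proof.
move=> ha hb; apply: (@sd_weak _ _ _ 2) => e e0 _.
have [d1 d10 {}ha] := ha e e0; have [d2 d20 {}hb] := hb e e0.
exists (Num.min d1 d2); first by rewrite lt_min d10.
move=> v; rewrite lt_min => /andP[/ha{}ha /hb{}hb].
have -> : lin (fun i => D i + E i) v = lin D v + lin E v.
  by rewrite /lin -big_split; apply: eq_bigr => i _; rewrite mulrDl.
rewrite [X in nc X](_ : _ = (a (z + v) - a z - lin D v) +
  (b (z + v) - b z - lin E v)); last by ring.
by apply: le_trans (ncD _ _) _; lra.
Qed.

Lemma sd_bound a z D : sd a z D -> exists2 dl : R, 0 < dl &
  forall v, nv v < dl -> nc (a (z + v) - a z) <= (\sum_i nc (D i) + 1) * nv v.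
Proof.
move=> /(_ 1 ltr01)[dl dl0 h]; exists dl => // v /h{}h.
rewrite -[X in nc X](subrK (lin D v)); apply: le_trans (ncD _ _) _.
by have := lin_le D v; lra.
Qed.

Lemma sdM a b z D E : sd a z D -> sd b z E ->
  sd (fun x => a x * b x) z (fun i => D i * b z + a z * E i).
Proof.
move=> ha hb; have [d3 d30 h3] := sd_bound ha.
set LA := \sum_i nc (D i) + 1 in h3.
have LA0 : 0 <= LA by rewrite addr_ge0 // sumr_ge0 // => *; exact: nc_ge0.
have [d4 d40 h4] := sd_bound hb.
set LB := \sum_i nc (E i) + 1 in h4.
have LB0 : 0 <= LB by rewrite addr_ge0 // sumr_ge0 // => *; exact: nc_ge0.
apply: (@sd_weak _ _ _ (nc (b z) + nc (a z) + LA * LB)) => e e0 e1.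
have [d1 d10 {}ha] := ha e e0; have [d2 d20 {}hb] := hb e e0.
exists (Num.min (Num.min d1 d2) (Num.min (Num.min d3 d4) e)).
  by rewrite !lt_min d10 d20 d30 d40.
move=> v; rewrite !lt_min => /and3P[/andP[/ha{}ha /hb{}hb] /andP[/h3{}h3 /h4{}h4] ve].
have -> : lin (fun i => D i * b z + a z * E i) v = lin D v * b z + a z * lin E v.
  rewrite /lin mulr_suml mulr_sumr -big_split; apply: eq_bigr => i _ /=; ring.
rewrite [X in nc X](_ : _ = (a (z + v) - a z - lin D v) * b z +
  a z * (b (z + v) - b z - lin E v) + (a (z + v) - a z) * (b (z + v) - b z));
  last by ring.
have -> : (nc (b z) + nc (a z) + LA * LB) * e * nv v =
  (e * nv v) * nc (b z) + nc (a z) * (e * nv v) + LA * LB * nv v * e by ring.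
apply: le_trans (ncD _ _) _; apply: lerD.
  apply: le_trans (ncD _ _) _; rewrite (ncM _ (b z)) (ncM (a z)); apply: lerD.
    by rewrite ler_wpM2r ?nc_ge0.
  by rewrite ler_wpM2l ?nc_ge0.
rewrite ncM; apply: (@le_trans _ _ ((LA * nv v) * (LB * nv v))).
  by apply: ler_pM; rewrite ?nc_ge0.
have -> : LA * nv v * (LB * nv v) = LA * LB * nv v * nv v by ring.
apply: ler_wpM2l; last exact: ltW.
by rewrite !mulr_ge0 ?nv_ge0.
Qed.

End Dim.

Lemma sd_comp {d d' : nat} (a : 'rV[C]_d -> C) (F : 'rV[C]_d' -> 'rV[C]_d) z
    (D : 'I_d -> C) (E : 'I_d -> 'I_d' -> C) :
  sd a (F z) D -> (forall i, sd (fun x => F x 0 i) z (E i)) ->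
  sd (a \o F) z (fun k => \sum_i D i * E i k).
Proof.
move=> ha hF.
pose LF := \sum_i (\sum_k nc (E i k) + 1).
have LF0 : 0 <= LF.
  by rewrite sumr_ge0 // => i _; rewrite addr_ge0 // sumr_ge0 // => *; exact: nc_ge0.
have LFi i : \sum_k nc (E i k) + 1 <= LF.
  rewrite /LF (bigD1 i) //= lerDl sumr_ge0 // => j _.
  by rewrite addr_ge0 // sumr_ge0 // => *; exact: nc_ge0.
have [d1 d10 h1] : exists2 dl : R, 0 < dl & forall v, nv v < dl ->
    nv (F (z + v) - F z) <= LF * nv v.
  have /choice[dl hdl] : forall i, exists dl : R, 0 < dl /\ forall v, nv v < dl ->
      nc (F (z + v) 0 i - F z 0 i) <= LF * nv v.
    move=> i; have [dl dl0 h] := sd_bound (hF i); exists dl; split=> // v /h{}h.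
    by apply: le_trans h _; rewrite ler_wpM2r ?nv_ge0.
  exists (\big[Num.min/1]_i dl i).
    by elim/big_rec: _ => // i x _ x0; rewrite lt_min x0; have [->] := hdl i.
  move=> v hv; apply: nv_le => [|i]; first by rewrite mulr_ge0 ?nv_ge0.
  rewrite !mxE; have [_] := hdl i; apply; apply: lt_le_trans hv _.
  by rewrite (bigD1 i) //= ge_min lexx.
pose DS := \sum_i nc (D i).
apply: (@sd_weak _ _ _ _ (LF + DS)) => e e0 _.
have [d2 d20 h2] := ha e e0.
have [d3 d30 h3] : exists2 dl : R, 0 < dl & forall v, nv v < dl -> forall i,
    nc (F (z + v) 0 i - F z 0 i - lin (E i) v) <= e * nv v.
  have /choice[dl hdl] : forall i, exists dl : R, 0 < dl /\ forall v, nv v < dl ->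
      nc (F (z + v) 0 i - F z 0 i - lin (E i) v) <= e * nv v.
    by move=> i; have [dl dl0 h] := hF i e e0; exists dl.
  exists (\big[Num.min/1]_i dl i).
    by elim/big_rec: _ => // i x _ x0; rewrite lt_min x0; have [->] := hdl i.
  move=> v hv i; have [_] := hdl i; apply; apply: lt_le_trans hv _.
  by rewrite (bigD1 i) //= ge_min lexx.
have LF1 : 0 < LF + 1 by lra.
exists (Num.min (Num.min d1 d3) (d2 / (LF + 1))).
  by rewrite !lt_min d10 d30 divr_gt0.
move=> v; rewrite !lt_min => /andP[/andP[/h1{}h1 /h3{}h3]]; rewrite ltr_pdivlMr // => v2.
have := h2 (F (z + v) - F z).
have -> : F z + (F (z + v) - F z) = F (z + v) by rewrite addrC subrK.
have lt2 : nv (F (z + v) - F z) < d2.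
  by apply: le_lt_trans h1 _; have := nv_ge0 v; nra.
move=> /(_ lt2) {}h2.
have -> : lin (fun k => \sum_i D i * E i k) v = \sum_i D i * lin (E i) v.
  rewrite /lin; under eq_bigr do rewrite mulr_suml.
  rewrite exchange_big; apply: eq_bigr => i _; rewrite mulr_sumr.
  by apply: eq_bigr => k _; rewrite mulrA.
have S : \sum_i D i * (F (z + v) 0 i - F z 0 i - lin (E i) v) =
    lin D (F (z + v) - F z) - \sum_i D i * lin (E i) v.
  rewrite -[lin D _]/(\sum_i D i * (F (z + v) - F z) 0 i) -sumrB.
  by apply: eq_bigr => i _; rewrite !mxE mulrBr.
rewrite [X in nc X](_ : _ = (a (F (z + v)) - a (F z) - lin D (F (z + v) - F z)) +
   \sum_i D i * (F (z + v) 0 i - F z 0 i - lin (E i) v)); last first.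
  by rewrite S /=; ring.
have -> : (LF + DS) * e * nv v = e * (LF * nv v) + DS * (e * nv v) by ring.
apply: le_trans (ncD _ _) _; apply: lerD.
  by apply: le_trans h2 _; apply: ler_wpM2l => //; exact: ltW.
apply: le_trans (nc_sum _ _ _) _; rewrite /DS !mulr_suml; apply: ler_sum => i _.
by rewrite ncM ler_wpM2l ?nc_ge0.
Qed.

End Holomorphic.

(** * Cauchy estimates in several variables *)

Section HolCalculus.
Context {R : realType} {d : nat}.
Local Notation C := R[i].
Local Notation V := 'rV[C]_d.
Implicit Types (a b : V -> C) (z v w p : V).

Lemma hol_const c z : hol (fun=> c) z.
Proof. by exists (fun=> 0); exact: sd_const. Qed.

Lemma hol_lin D z : hol (lin D) z.
Proof. by exists D; exact: sd_lin. Qed.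

Lemma hol_coord i z : hol (fun x : V => x 0 i) z.
Proof. by exists (fun j => (i == j)%:R); exact: sd_coord. Qed.

Lemma holD a b z : hol a z -> hol b z -> hol (fun x => a x + b x) z.
Proof. by move=> [D hD] [E hE]; eexists; apply: sdD hD hE. Qed.

Lemma holM a b z : hol a z -> hol b z -> hol (fun x => a x * b x) z.
Proof. by move=> [D hD] [E hE]; eexists; apply: sdM hD hE. Qed.

Lemma holZ c a z : hol a z -> hol (fun x => c * a x) z.
Proof. by apply: holM; exact: hol_const. Qed.

Lemma holN a z : hol a z -> hol (fun x => - a x) z.
Proof.
move=> h; have -> : (fun x => - a x) = (fun x => (-1) * a x).
  by apply/funext => x; rewrite mulN1r.
exact: holZ.
Qed.

Lemma holB a b z : hol a z -> hol b z -> hol (fun x => a x - b x) z.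
Proof. by move=> ha hb; apply: holD => //; exact: holN. Qed.

Lemma hol_sum (I : Type) (s : seq I) (P : pred I) (F : I -> V -> C) z :
  (forall i, P i -> hol (F i) z) -> hol (fun x => \sum_(i <- s | P i) F i x) z.
Proof.
move=> h; elim: s => [|i s IH].
  have -> : (fun x => \sum_(i <- [::] | P i) F i x) = fun=> 0.
    by apply/funext => x; rewrite big_nil.
  exact: hol_const.
have [Pi|Pi] := boolP (P i).
  have -> : (fun x => \sum_(j <- i :: s | P j) F j x) =
            (fun x => F i x + \sum_(j <- s | P j) F j x).
    by apply/funext => x; rewrite big_cons Pi.
  by apply: holD => //; exact: h.
have -> : (fun x => \sum_(j <- i :: s | P j) F j x) =
            (fun x => \sum_(j <- s | P j) F j x).
  by apply/funext => x; rewrite big_cons (negbTE Pi).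
exact: IH.
Qed.

End HolCalculus.

Section VHol.
Context {R : realType}.
Local Notation C := R[i].

Definition vhol {d d' : nat} (F : 'rV[C]_d -> 'rV[C]_d') (z : 'rV[C]_d) :=
  forall i, hol (fun x => F x 0 i) z.

Lemma hol_comp {d d' : nat} (a : 'rV[C]_d' -> C) (F : 'rV[C]_d -> 'rV[C]_d') z :
  vhol F z -> hol a (F z) -> hol (fun x => a (F x)) z.
Proof.
move=> /choice[E hE] [D hD]; exists (fun k => \sum_i D i * E i k).
exact: (@sd_comp R d' d a F).
Qed.

Lemma vhol_comp {d d' d'' : nat} (G : 'rV[C]_d' -> 'rV[C]_d'')
    (F : 'rV[C]_d -> 'rV[C]_d') z :
  vhol F z -> vhol G (F z) -> vhol (fun x => G (F x)) z.
Proof. by move=> hF hG i; apply: (hol_comp hF (hG i)). Qed.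

Lemma vhol_id {d : nat} z : vhol (@id 'rV[C]_d) z.
Proof. by move=> i; exact: hol_coord. Qed.

Lemma vhol_mulmx {d d' : nat} (A : 'M[C]_(d, d')) z : vhol (fun x => x *m A) z.
Proof.
move=> i; have -> : (fun x : 'rV[C]_d => (x *m A) 0 i) = lin (fun k => A k i).
  by apply/funext => x; rewrite mxE; apply: eq_bigr => k _; rewrite mulrC.
exact: hol_lin.
Qed.

Lemma eq_near_vhol {d d' : nat} (F G : 'rV[C]_d -> 'rV[C]_d') z r : 0 < r ->
  (forall v, nv v < r -> F (z + v) = G (z + v)) -> vhol G z -> vhol F z.
Proof.
by move=> r0 FG h i; apply: (eq_near_hol r0 _ (h i)) => v vr; rewrite FG.
Qed.

Lemma vhol_continuous {d d' : nat} (F : 'rV[C]_d -> 'rV[C]_d') z e : vhol F z ->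
  0 < e -> exists2 dl : R, 0 < dl & forall v, nv v < dl -> nv (F (z + v) - F z) < e.
Proof.
move=> hF e0.
have /choice[dl hdl] : forall i, exists dl : R, 0 < dl /\ forall v, nv v < dl ->
    nc (F (z + v) 0 i - F z 0 i) < e.
  move=> i; have [D hD] := hF i; have [dl dl0 h] := sd_bound hD.
  set K := _ + 1 in h.
  have K0 : 0 < K by rewrite ltr_wpDl // sumr_ge0 // => *; exact: nc_ge0.
  exists (Num.min dl (e / K)); rewrite lt_min dl0 divr_gt0 //; split=> // v.
  rewrite lt_min => /andP[/h{}h]; rewrite ltr_pdivlMr // => ve.
  by apply: le_lt_trans h _; rewrite mulrC.
exists (\big[Num.min/1]_i dl i).
  by elim/big_rec: _ => // i x _ x0; rewrite lt_min x0; have [->] := hdl i.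
move=> v hv; apply: nv_lt => // i.
rewrite !mxE; have [_] := hdl i; apply; apply: lt_le_trans hv _.
by rewrite (bigD1 i) //= ge_min lexx.
Qed.

End VHol.

Section CauchyEstimates.
Context {R : realType} {d : nat}.
Local Notation C := R[i].
Local Notation V := 'rV[C]_d.
Implicit Types (a b : V -> C) (z v w p : V).

Lemma lin0 (D : 'I_d -> C) : lin D 0 = 0.
Proof. by rewrite -[0 in LHS](scale0r (0 : V)) linZr mul0r. Qed.

(** Restriction to the complex line through p and p + v. *)
Lemma taylor2_mv a p D r M v : 0 < r ->
  (forall u, nv u < r -> hol a (p + u)) ->
  (forall u, nv u < r -> nc (a (p + u)) <= M) -> sd a p D -> nv v <= r / 24 ->
  nc (a (p + v) - a p - lin D v) <= 432 * M * (nv v / r) ^+ 2.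
Proof.
move=> r0 ah aM aD vr.
have M0 : 0 <= M by apply: le_trans (nc_ge0 _) (aM 0 _); rewrite nv0.
have [->|v0] := eqVneq v 0.
  rewrite addr0 lin0 subrr subr0 nc0.
  by rewrite nv0 mul0r expr2 !mulr0.
have t0 : 0 < nv v by rewrite nv_gt0.
pose u : V := (nv v)%:C^-1 *: v.
have u1 : nv u = 1 by rewrite nvZ ncV nc_real gtr0_norm // mulVf ?gt_eqF.
have tn0 : (nv v)%:C != 0 by rewrite -nc_gt0 nc_real normr_gt0 gt_eqF.
have vu : v = (nv v)%:C *: u by rewrite scalerA mulfV // scale1r.
have line (s : C) E : sd a (p + s *: u) E -> cdiff (fun w : C => a (p + w *: u)) s (lin E u).
  move=> h e e0; have [dl dl0 {}h] := h e e0; exists dl => // w ws.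
  have E1 : nv ((w - s) *: u) = nc (w - s) by rewrite nvZ u1 mulr1.
  have := h ((w - s) *: u); rewrite E1 => /(_ ws).
  by rewrite linZr -(addrA p) -scalerDl subrKC mulrC.
have := @taylor2 R (fun w : C => a (p + w *: u)) M r (lin D u) (nv v)%:C.
rewrite nc_real ger0_norm ?nv_ge0 // -vu scale0r addr0 [lin D u * _]mulrC -linZr -vu; apply => //.
- move=> z zr; have [|E hE] := ah (z *: u); first by rewrite nvZ u1 mulr1.
  by exists (lin E u); exact: line.
- by move=> z zr; apply: aM; rewrite nvZ u1 mulr1.
- by apply: line; rewrite scale0r addr0.
Qed.

(** The derivative is compared with the increment of a at distance r / 24, where
    the Taylor remainder is at most M. *)
Lemma cauchy_lin a p D r M v : 0 < r ->
  (forall u, nv u < r -> hol a (p + u)) ->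
  (forall u, nv u < r -> nc (a (p + u)) <= M) -> sd a p D ->
  nc (lin D v) <= 72 * M * nv v / r.
Proof.
move=> r0 ah aM aD.
have M0 : 0 <= M by apply: le_trans (nc_ge0 _) (aM 0 _); rewrite nv0.
have [->|v0] := eqVneq v 0.
  by rewrite lin0 nc0 nv0 mulr0 mul0r.
have t0 : 0 < nv v by rewrite nv_gt0.
pose s : R := r / 24 / nv v.
have s0 : 0 < s by rewrite !divr_gt0.
have nw : nv (s%:C *: v) = r / 24.
  by rewrite nvZ nc_real gtr0_norm // /s divfK // gt_eqF.
have := @taylor2_mv a p D r M (s%:C *: v) r0 ah aM aD.
rewrite nw lexx => /(_ isT).
have -> : r / 24 / r = 24^-1 by field; rewrite gt_eqF.
rewrite linZr => h.
have h1 : nc (a p) <= M by have := aM 0; rewrite nv0 addr0; apply.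
have h2 : nc (a (p + s%:C *: v)) <= M.
  by apply: aM; rewrite nw ltr_pdivrMr // ltr_pMr // ltr1n.
have h3 : nc (s%:C * lin D v) <= 3 * M.
  have -> : s%:C * lin D v = (a (p + s%:C *: v) - a p) -
     (a (p + s%:C *: v) - a p - s%:C * lin D v) by ring.
  apply: le_trans (ncB _ _) _.
  have := ncB (a (p + s%:C *: v)) (a p); lra.
rewrite ncM nc_real gtr0_norm // mulrC -ler_pdivlMr // in h3.
apply: le_trans h3 _; rewrite /s le_eqVlt; apply/orP; left; apply/eqP.
by field; rewrite !gt_eqF.
Qed.

(** For nearby points this is the Taylor estimate, for distant ones the bound
    M. *)
Lemma cauchy_lipschitz a r M z w : 0 < r ->
  (forall u, nv u < r -> hol a u) -> (forall u, nv u < r -> nc (a u) <= M) ->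
  nv z < r / 2 -> nv w < r / 2 -> nc (a z - a w) <= 180 * M * nv (z - w) / r.
Proof.
move=> r0 ah aM zr wr.
have M0 : 0 <= M by apply: le_trans (nc_ge0 _) (aM 0 _); rewrite nv0.
have r20 : 0 < r / 2 by rewrite divr_gt0.
have dom u : nv u < r / 2 -> nv (w + u) < r.
  by move=> ur; apply: le_lt_trans (nvD _ _) _; lra.
have [|far] := leP (nv (z - w)) (r / 48).
  move=> near; have [D hD] : hol a w by apply: ah; lra.
  have h1 := @cauchy_lin a w D (r / 2) M (z - w) r20 (fun u ur => ah _ (dom u ur))
    (fun u ur => aM _ (dom u ur)) hD.
  have := @taylor2_mv a w D (r / 2) M (z - w) r20 (fun u ur => ah _ (dom u ur))
    (fun u ur => aM _ (dom u ur)) hD.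
  rewrite subrKC; have -> : r / 2 / 24 = r / 48 by field.
  move=> /(_ near) h2.
  have := ncD (a z - a w - lin D (z - w)) (lin D (z - w)); rewrite subrK => h3.
  apply: le_trans h3 _; set t := nv (z - w) in near h1 h2 *.
  have t0 : 0 <= t := nv_ge0 _.
  have s1 : t / r <= 48^-1 by rewrite ler_pdivrMr //; lra.
  have s0 : 0 <= t / r by rewrite divr_ge0 // ltW.
  have e1 : 72 * M * t / (r / 2) = 144 * (M * (t / r)) by field; rewrite gt_eqF.
  have e2 : 432 * M * (t / (r / 2)) ^+ 2 = 1728 * (M * (t / r) * (t / r)).
    by field; rewrite gt_eqF.
  have e3 : 180 * M * t / r = 180 * (M * (t / r)) by ring.
  rewrite e1 in h1; rewrite e2 in h2; rewrite e3.
  have : M * (t / r) * (t / r) <= M * (t / r) * 48^-1.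
    by rewrite ler_wpM2l // mulr_ge0.
  lra.
apply: le_trans (ncB _ _) _.
have := aM z; have := aM w.
have -> : nv z < r by lra.
have -> : nv w < r by lra.
move=> /(_ isT) h1 /(_ isT) h2.
have e3 : 180 * M * nv (z - w) / r = 180 * (M * (nv (z - w) / r)) by ring.
have s1 : 48^-1 <= nv (z - w) / r by rewrite ler_pdivlMr //; lra.
have : M * 48^-1 <= M * (nv (z - w) / r) by rewrite ler_wpM2l.
rewrite e3; lra.
Qed.

(** [cauchy_lipschitz] for the nonlinear part of a on a ball of radius comparable
    with |z| + |w|, where it is of the order of the square of that radius. *)
Lemma cauchy_lipschitz2 a D r M z w : 0 < r ->
  (forall u, nv u < r -> hol a u) -> (forall u, nv u < r -> nc (a u) <= M) ->
  sd a 0 D -> nv z + nv w <= r / 96 ->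
  nc (a z - a w - lin D (z - w)) <=
    180 * 432 * 4 * (M * (nv z + nv w) * nv (z - w) / r ^+ 2).
Proof.
move=> r0 ah aM aD zw.
have M0 : 0 <= M by apply: le_trans (nc_ge0 _) (aM 0 _); rewrite nv0.
have z0 := nv_ge0 z; have w0 := nv_ge0 w.
have := addr_ge0 z0 w0; rewrite le_eqVlt => /orP[/eqP m0|m0].
  have /eqP : nv z = 0 by lra.
  have /eqP : nv w = 0 by lra.
  rewrite !nv_eq0 => /eqP -> /eqP ->; rewrite !subrr lin0.
  by rewrite subr0 nc0 nv0 !(mulr0, mul0r).
set m := nv z + nv w in m0 zw *; have mE : m = nv z + nv w by [].
pose b x := a x - a 0 - lin D x.
have h4 : 0 < 4 * m by lra.
have bh u : nv u < 4 * m -> hol b u.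
  move=> ur; apply: holB; last exact: hol_lin.
  by apply: holB; [apply: ah; lra|exact: hol_const].
have bM u : nv u < 4 * m -> nc (b u) <= 432 * M * (4 * m / r) ^+ 2.
  move=> ur; have := @taylor2_mv a 0 D r M u r0.
  rewrite !add0r => h; apply: le_trans (h _ _ _ _) _ => //; try lra.
  - by move=> x; rewrite add0r; exact: ah.
  - by move=> x; rewrite add0r; exact: aM.
  apply: ler_wpM2l; first by apply: mulr_ge0 (ler0n _ _) _.
  rewrite lerXn2r ?nnegrE ?divr_ge0 ?nv_ge0 //; try lra.
  by rewrite ler_pM2r ?invr_gt0 //; lra.
have := @cauchy_lipschitz b (4 * m) _ z w h4 bh bM.
have -> : b z - b w = a z - a w - lin D (z - w) by rewrite /b linBr; ring.
move=> h; apply: le_trans (h _ _) _; try lra.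
rewrite le_eqVlt; apply/orP; left; apply/eqP.
by field; rewrite !gt_eqF.
Qed.

End CauchyEstimates.

(** * Limits of holomorphic functions *)

Section Sequences.
Context {R : realType}.
Local Notation C := R[i].

Lemma real_limit (x eps : nat -> R) :
  (forall m n, (m <= n)%N -> `|x n - x m| <= eps m) ->
  exists l, forall m, `|l - x m| <= eps m.
Proof.
move=> h; exists (sup (range (fun m => x m - eps m))) => m.
have cross k n : x k - eps k <= x n + eps n.
  have := h k (k + n)%N (leq_addr _ _); have := h n (k + n)%N (leq_addl _ _).
  by rewrite !ler_norml => /andP[? ?] /andP[? ?]; lra.
have e0 n : 0 <= eps n by have := h n n (leqnn n); rewrite subrr normr0.
rewrite ler_norml; apply/andP; split.
  rewrite lerBrDl; apply: ub_le_sup; last by exists m.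
  by exists (x 0%N + eps 0%N) => _ [k _ <-].
by rewrite lerBlDl; apply: ge_sup => [|_ [k _ <-] //]; exists (x 0%N - eps 0%N), 0%N.
Qed.

Definition vanishing (eps : nat -> R) :=
  forall e, 0 < e -> exists N, forall n, (N <= n)%N -> eps n <= e.

Lemma vanishing_geo (K q : R) : 0 <= q -> q < 1 -> vanishing (fun n => K * q ^+ n).
Proof.
move=> q0 q1 e e0; have K1 : 0 < `|K| + 1 by rewrite ltr_wpDl.
have [N h] := exp_small q0 q1 (divr_gt0 e0 K1); exists N => n /h /ltW.
rewrite ler_pdivlMr // mulrC; apply: le_trans.
by rewrite ler_wpM2r ?exprn_ge0 //; have := ler_norm K; lra.
Qed.

Lemma complex_limit (c : nat -> C) (eps : nat -> R) : vanishing eps ->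
  (forall m n, (m <= n)%N -> nc (c n - c m) <= eps m) ->
  exists l, forall m, nc (l - c m) <= eps m.
Proof.
move=> e0 h.
have ReB (x y : C) : complex.Re (x - y) = complex.Re x - complex.Re y by case: x y => ? ? [].
have ImB (x y : C) : complex.Im (x - y) = complex.Im x - complex.Im y by case: x y => ? ? [].
have [|l1 h1] := @real_limit (fun n => complex.Re (c n)) eps.
  by move=> m n mn; rewrite -ReB; apply: le_trans (Re_le_nc _) (h _ _ mn).
have [|l2 h2] := @real_limit (fun n => complex.Im (c n)) eps.
  by move=> m n mn; rewrite -ImB; apply: le_trans (Im_le_nc _) (h _ _ mn).
exists (l1 +i* l2) => m; apply: le_of_eps => e e1.
have [N hN] := e0 (e / 2) (divr_gt0 e1 (ltr0n _ 2)).
have k1 := hN (m + N)%N (leq_addl _ _).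
apply: le_trans (ncBD _ (c (m + N)%N) _) _.
have := h m (m + N)%N (leq_addr _ _).
have := nc_le_ReIm (l1 +i* l2 - c (m + N)%N); rewrite ReB ImB /=.
have := h1 (m + N)%N; have := h2 (m + N)%N; lra.
Qed.

Lemma geo_cauchy (c : nat -> C) (K q : R) : 0 <= q -> q < 1 ->
  (forall m, nc (c m.+1 - c m) <= K * q ^+ m) ->
  forall m n, (m <= n)%N -> nc (c n - c m) <= K / (1 - q) * q ^+ m.
Proof.
move=> q0 q1 h m n mn; have q2 : 0 < 1 - q by lra.
have K0 : 0 <= K by apply: le_trans (nc_ge0 _) _; have := h 0%N; rewrite expr0 mulr1; exact.
suff H : nc (c n - c m) <= K / (1 - q) * (q ^+ m - q ^+ n).
  apply: le_trans H _; rewrite ler_wpM2l ?divr_ge0 //; first exact: ltW.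
  by rewrite lerBlDr lerDl exprn_ge0.
rewrite -(subnKC mn); elim: (n - m)%N => [|k IH].
  by rewrite addn0 !subrr nc0 mulr0.
rewrite addnS; apply: le_trans (ncBD _ (c (m + k)%N) _) _.
apply: le_trans (lerD (h _) IH) _; rewrite exprS le_eqVlt; apply/orP; left; apply/eqP.
by field; rewrite gt_eqF.
Qed.

Lemma fun_limit (T : Type) (u : nat -> T -> C) (S : set T) (eps : nat -> R) :
  vanishing eps ->
  (forall z, S z -> forall m n, (m <= n)%N -> nc (u n z - u m z) <= eps m) ->
  exists l : T -> C, forall z, S z -> forall m, nc (l z - u m z) <= eps m.
Proof.
move=> e0 h.
have /choice[l hl] : forall z, exists l, S z -> forall m, nc (l - u m z) <= eps m.
  move=> z; have [Sz|nSz] := pselect (S z); last by exists 0.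
  by have [l hl] := complex_limit e0 (h z Sz); exists l.
by exists l.
Qed.

End Sequences.

Section Limits.
Context {R : realType} {d : nat}.
Local Notation C := R[i].
Local Notation V := 'rV[C]_d.
Implicit Types (a b u : V -> C) (p v w : V).

Lemma hol_bounded a p : hol a p ->
  exists M dl : R, 0 < dl /\ forall v, nv v < dl -> nc (a (p + v)) <= M.
Proof.
move=> [D /sd_bound[dl dl0 h]]; set K := _ + 1 in h.
exists (nc (a p) + K * dl), dl; split => // v vd.
rewrite -[a _](subrK (a p)); apply: le_trans (ncD _ _) _; rewrite addrC lerD2l.
apply: le_trans (h v vd) _; apply: ler_wpM2l; last exact: ltW.
by rewrite /K addr_ge0 // sumr_ge0 // => *; exact: nc_ge0.
Qed.

(** Weierstrass: the Taylor estimate passes to uniform limits, because the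
    derivatives of the approximations converge by the Cauchy estimates. *)
Lemma hol_limit u p r : 0 < r ->
  (forall e : R, 0 < e -> exists b, (forall v, nv v < r -> hol b (p + v)) /\
     (forall v, nv v < r -> nc (b (p + v) - u (p + v)) <= e)) ->
  hol u p.
Proof.
move=> r0 h.
have [b0 [b0h b0u]] := h 1 ltr01.
have [|M [dl [dl0 b0M]]] := @hol_bounded b0 p.
  by have := b0h 0; rewrite nv0 addr0; exact.
pose s := Num.min r dl.
have s0 : 0 < s by rewrite lt_min r0.
have sr v : nv v < s -> nv v < r by rewrite lt_min => /andP[].
have uM v : nv v < s -> nc (u (p + v)) <= M + 1.
  move=> vs; have := ncBD (u (p + v)) (b0 (p + v)) 0; rewrite !subr0.
  have := b0u v (sr v vs); rewrite ncBC.
  by have := b0M v; move: vs; rewrite lt_min => /andP[_ vs] /(_ vs); lra.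
have q0 : 0 <= 2^-1 :> R by lra.
have q1 : 2^-1 < 1 :> R by lra.
pose eps m : R := 2^-1 ^+ m.
have eps0 m : 0 < eps m by rewrite exprn_gt0.
have eps1 m : eps m <= 1 by apply: exprn_ile1 => //; lra.
have epsM m n : (m <= n)%N -> eps n <= eps m by move=> mn; apply: ler_wiXn2l => //; exact: ltW.
have /choice[b hb] : forall m, exists b, (forall v, nv v < r -> hol b (p + v)) /\
     (forall v, nv v < r -> nc (b (p + v) - u (p + v)) <= eps m) by move=> m; exact: h.
have /choice[D hD] : forall m, exists D, sd (b m) p D.
  by move=> m; have [+ _] := hb m => /(_ 0); rewrite nv0 addr0; exact.
have bM m v : nv v < s -> nc (b m (p + v)) <= M + 2.
  move=> vs; have := ncBD (b m (p + v)) (u (p + v)) 0; rewrite !subr0.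
  by have [_ /(_ v (sr v vs))] := hb m; have := uM v vs; have := eps1 m; lra.
have DC i m n : (m <= n)%N -> nc (D n i - D m i) <= 144 / s * eps m.
  move=> mn; have hs : sd (fun x => b n x + (-1) * b m x) p
      (fun i => D n i + (0 * b m p + (-1) * D m i)).
    apply: sdD => //; apply: (sdM (D := fun=> 0)) => //; exact: sd_const.
  have := @cauchy_lin _ _ (fun x => b n x + (-1) * b m x) p _ s (2 * eps m)
    (delta_mx 0 i) s0 _ _ hs.
  rewrite lin_delta mul0r add0r mulN1r.
  have -> : nv (delta_mx 0 i : V) = 1.
    by rewrite -[delta_mx _ _]scale1r nv_delta nc1.
  move=> H; apply: le_trans (H _ _) _; last by rewrite mulr1 le_eqVlt; apply/orP; left; apply/eqP; ring.
    by move=> v /sr vr; apply: holD; [apply (hb n).1|apply: holZ; apply (hb m).1].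
  move=> v /sr vr; rewrite mulN1r; apply: le_trans (ncBD _ (u (p + v)) _) _.
  rewrite (ncBC (u _)); have := (hb n).2 v vr; have := (hb m).2 v vr.
  by have := epsM m n mn; lra.
have /choice[DL hDL] : forall i, exists l, forall m, nc (l - D m i) <= 144 / s * eps m.
  move=> i; by apply: complex_limit (DC i); apply: vanishing_geo.
exists DL.
have main v : nv v <= s / 24 -> nc (u (p + v) - u p - lin DL v) <=
    432 * (M + 2) * (nv v / s) ^+ 2.
  move=> v1; apply: le_of_eps => e e0.
  pose K := 2 + d%:R * (144 / s) * nv v.
  have [N /(_ N (leqnn N)) hN] := vanishing_geo K q0 q1 e0.
  have vr : nv v < r by apply: sr; apply: le_lt_trans v1 _; lra.
  have := @taylor2_mv _ _ (b N) p (D N) s (M + 2) v s0 (fun v vs => (hb N).1 v (sr v vs))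
     (bM N) (hD N) v1.
  set X := b N (p + v) - b N p - lin (D N) v => h1.
  have -> : u (p + v) - u p - lin DL v = X - (b N (p + v) - u (p + v)) +
      (b N p - u p) - (lin DL v - lin (D N) v) by rewrite /X; ring.
  have h2 := (hb N).2 v vr.
  have := (hb N).2 0; rewrite nv0 addr0 => /(_ r0) h3.
  have h4 : nc (lin DL v - lin (D N) v) <= d%:R * (144 / s) * nv v * eps N.
    have -> : lin DL v - lin (D N) v = lin (fun i => DL i - D N i) v.
      by rewrite /lin -sumrB; apply: eq_bigr => i _; rewrite mulrBl.
    apply: le_trans (lin_le _ _) _.
    have -> : d%:R * (144 / s) * nv v * eps N = (d%:R * (144 / s * eps N)) * nv v by ring.
    rewrite ler_wpM2r ?nv_ge0 //; apply: (@le_trans _ _ (\sum_(i < d) (144 / s * eps N))).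
      by apply: ler_sum => i _; exact: hDL.
    by rewrite sumr_const card_ord -[leLHS]mulr_natl.
  have KE : K * 2^-1 ^+ N = eps N + eps N + d%:R * (144 / s) * nv v * eps N.
    by rewrite /K -/(eps N) mulrDl -mulr2n mulr_natl.
  apply: (@le_trans _ _ (432 * (M + 2) * (nv v / s) ^+ 2 + K * 2^-1 ^+ N)).
    rewrite KE; set Y := 432 * _ * _; rewrite (addrA Y) (addrA Y).
    apply: le_trans (ncB _ _) _; apply: lerD => //.
    apply: le_trans (ncD _ _) _; apply: lerD => //.
    by apply: le_trans (ncB _ _) _; apply: lerD.
  by rewrite lerD2l.
pose K := 432 * (M + 2) / s ^+ 2.
have M2 : 0 <= M + 2 by apply: le_trans (nc_ge0 _) (bM 0%N 0 _); rewrite nv0.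
have K0 : 0 <= K.
  apply: divr_ge0; last exact/exprn_ge0/ltW.
  by apply: mulr_ge0; first exact: ler0n.
move=> e e0; exists (Num.min (s / 24) (e / (K + 1))).
  by rewrite lt_min !divr_gt0 //; lra.
move=> v; rewrite lt_min => /andP[/ltW v1 v2]; apply: le_trans (main v v1) _.
have -> : 432 * (M + 2) * (nv v / s) ^+ 2 = K * nv v * nv v.
  by rewrite /K; field; rewrite gt_eqF.
rewrite ler_wpM2r ?nv_ge0 //.
rewrite ltr_pdivlMr in v2; last by lra.
by have := nv_ge0 v; lra.
Qed.

Definition dd a (z : V) : 'I_d -> C := xget (fun=> 0) [set D | sd a z D].

Lemma ddP a z : hol a z -> sd a z (dd a z).
Proof. by move=> h; exact: (@xgetPex _ (fun=> 0) [set D | sd a z D]). Qed.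

Lemma nv_delta1 i : nv (delta_mx 0 i : V) = 1.
Proof. by rewrite -[delta_mx _ _]scale1r nv_delta nc1. Qed.

(** Difference quotients with a fixed small step approximate the partial
    derivative uniformly, by the Taylor estimate. *)
Lemma hol_dd a p r i : 0 < r -> (forall v, nv v < r -> hol a (p + v)) ->
  hol (fun z => dd a z i) p.
Proof.
move=> r0 ah.
have [|M [dl [dl0 aM]]] := @hol_bounded a p.
  by have := ah 0; rewrite nv0 addr0; exact.
pose s := Num.min r dl / 2.
have s0 : 0 < s by rewrite divr_gt0 // lt_min r0.
have ss : s + s = Num.min r dl by rewrite /s; field.
have sr v : nv v < s + s -> nv v < r.
  by rewrite ss lt_min => /andP[].
have sM v : nv v < s + s -> nc (a (p + v)) <= M.
  by rewrite ss lt_min => /andP[_ /aM].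
have M0 : 0 <= M by apply: le_trans (nc_ge0 _) (sM 0 _); rewrite nv0; lra.
apply: (@hol_limit _ _ s) => // e e0.
pose K := 432 * M / s ^+ 2.
have K0 : 0 <= K.
  apply: divr_ge0; last exact/exprn_ge0/ltW.
  by apply: mulr_ge0; first exact: ler0n.
pose h : R := Num.min (s / 24) (e / (K + 1)).
have h0 : 0 < h by rewrite lt_min !divr_gt0 //; lra.
have h1 : h <= s / 24 by rewrite ge_min lexx.
have h2 : h * (K + 1) <= e by rewrite -ler_pdivlMr ?ge_min ?lexx ?orbT //; lra.
have hn0 : h%:C != 0 by rewrite -nc_gt0 nc_real normr_gt0 gt_eqF.
have nh : nv (h%:C *: delta_mx 0 i : V) = h by rewrite nv_delta nc_real gtr0_norm.
exists (fun z => h%:C^-1 * (a (h%:C *: delta_mx 0 i + z) - a z)); split=> v vs.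
  apply: holZ; apply: holB; last by apply: ah; apply: sr; lra.
  have := @hol_comp R d d a (fun z => h%:C *: delta_mx 0 i + z) (p + v); apply.
    by move=> j; have -> : (fun x : V => (h%:C *: delta_mx 0 i + x) 0 j) =
      (fun x => (h%:C *: delta_mx 0 i : V) 0 j + x 0 j);
      [apply/funext => x; rewrite mxE|apply: holD; [exact: hol_const|exact: hol_coord]].
  rewrite addrCA; apply: ah; apply: sr; apply: le_lt_trans (nvD _ _) _; rewrite nh; lra.
have hv : sd a (p + v) (dd a (p + v)) by apply/ddP/ah/sr; lra.
have := @taylor2_mv _ _ a (p + v) (dd a (p + v)) s M (h%:C *: delta_mx 0 i) s0 _ _ hv.
rewrite nh linZr lin_delta => H.
have {H} := H _ _ h1; set X := nc _ => H.
have : h * nc (h%:C^-1 * (a (h%:C *: delta_mx 0 i + (p + v)) - a (p + v)) - dd a (p + v) i) <=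
   h * e.
  rewrite -[X in X * nc _](gtr0_norm h0) -(nc_real h) -ncM mulrBr mulrA mulfV // mul1r.
  rewrite [_ + (p + v)]addrC; apply: le_trans (H _ _) _.
  - by move=> u us; rewrite -addrA; apply/ah/sr; apply: le_lt_trans (nvD _ _) _; lra.
  - by move=> u us; rewrite -addrA; apply/sM; apply: le_lt_trans (nvD _ _) _; lra.
  have -> : 432 * M * (h / s) ^+ 2 = h * (h * K) by rewrite /K; field; rewrite gt_eqF.
  by rewrite ler_pM2l //; lra.
by rewrite ler_pM2l.
Qed.

End Limits.

(** * Hadamard's lemma *)

Section Hadamard.
Context {R : realType} {d : nat}.
Local Notation C := R[i].
Local Notation V := 'rV[C]_d.
Implicit Types (a : V -> C) (p v w z : V).

Lemma sum_pairs (F : nat -> C) N :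
  \sum_(j < N + N) F j = \sum_(k < N) (F (k + k)%N + F (k + k).+1).
Proof.
elim: N => [|N IH]; first by rewrite !big_ord0.
by rewrite addnS addSn !big_ord_recr /= IH addrA.
Qed.

Lemma nv_nat_scale (k N : nat) z : nv ((k%:R / N%:R : C) *: z) = k%:R / N%:R * nv z.
Proof. by rewrite nvZ ncM ncV !nc_nat. Qed.

(** The coefficients q i are the integrals of the i-th partial derivative along
    the segment from 0 to z, obtained as limits of dyadic Riemann sums. *)
Lemma hadamard a r M : 0 < r ->
  (forall z, nv z < r -> hol a z) -> (forall z, nv z < r -> nc (a z) <= M) ->
  exists q : 'I_d -> V -> C,
   [/\ forall i z, nv z < r / 4 -> hol (q i) z,
       forall i z, nv z < r / 4 -> nc (q i z) <= 144 * M / r &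
       forall z, nv z < r / 4 -> a z = a 0 + \sum_i z 0 i * q i z].
Proof.
move=> r0 ah aM.
have M0 : 0 <= M by apply: le_trans (nc_ge0 _) (aM 0 _); rewrite nv0.
have r2 : 0 < r / 2 by lra.
have r4 : 0 < r / 4 by lra.
pose D i z := dd a z i.
have Dsd z : nv z < r -> sd a z (dd a z) by move=> /ah/ddP.
have in_r z u : nv z < r / 2 -> nv u < r / 2 -> nv (z + u) < r.
  by move=> zr ur; apply: le_lt_trans (nvD _ _) _; lra.
pose M1 := 144 * M / r.
have M10 : 0 <= M1.
  by apply: divr_ge0; [apply: mulr_ge0 (ler0n _ _) M0|exact: ltW].
have D_le i z : nv z < r / 2 -> nc (D i z) <= M1.
  move=> zr; have := @cauchy_lin R d a z (dd a z) (r / 2) M (delta_mx 0 i) r2.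
  rewrite lin_delta nv_delta1 mulr1 => h; apply: le_trans (h _ _ _) _.
  - by move=> u /(in_r z u zr)/ah.
  - by move=> u /(in_r z u zr)/aM.
  - by apply: Dsd; lra.
  by rewrite /M1 le_eqVlt; apply/orP; left; apply/eqP; field; rewrite gt_eqF.
have D_hol i z : nv z < r -> hol (D i) z.
  move=> zr; apply: (@hol_dd _ _ _ _ (r - nv z)); first by lra.
  by move=> v vr; apply: ah; apply: le_lt_trans (nvD _ _) _; lra.
have D_lip i z w : nv z < r / 4 -> nv w < r / 4 ->
    nc (D i z - D i w) <= 180 * M1 * nv (z - w) / (r / 2).
  move=> zr wr; apply: (@cauchy_lipschitz _ _ (D i) (r / 2) M1) => //; try lra.
    by move=> u ur; apply: D_hol; lra.
  exact: D_le.
pose S m i z := (2 ^ m)%:R^-1 * \sum_(k < 2 ^ m) D i ((k%:R / (2 ^ m)%:R : C) *: z).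
have pos m : 0 < (2 ^ m)%:R :> R by rewrite ltr0n expn_gt0.
have posC m : (2 ^ m)%:R != 0 :> C by rewrite pnatr_eq0 -lt0n expn_gt0.
have q0 : 0 <= 2^-1 :> R by lra.
have q1 : 2^-1 < 1 :> R by lra.
have powE m : 2^-1 ^+ m = (2 ^ m)%:R^-1 :> R by rewrite exprVn natrX.
have fr (k N : nat) z : (k <= N)%N -> (0 < N)%N -> nv ((k%:R / N%:R : C) *: z) <= nv z.
  move=> kN N0; rewrite nv_nat_scale ler_piMl ?nv_ge0 //.
  by have /andP[] := frac01 (R := R) kN N0.
have step i z m : nv z < r / 4 ->
    nc (S m.+1 i z - S m i z) <= 180 * M1 * 2^-1 ^+ m.
  move=> zr; pose N := (2 ^ m)%N; have N0 : (0 < N)%N by rewrite expn_gt0.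
  have Nn : N%:R != 0 :> C := posC m.
  have N2 : (2 ^ m.+1 = N + N)%N by rewrite expnS mul2n addnn.
  have -> : S m.+1 i z - S m i z = (N + N)%:R^-1 * \sum_(k < N)
      (D i (((k + k).+1%:R / (N + N)%:R : C) *: z) - D i ((k%:R / N%:R : C) *: z)).
    rewrite /S N2 (sum_pairs (fun j => D i ((j%:R / (N + N)%:R : C) *: z))) -/N.
    have E (k : 'I_N) : D i (((k + k)%:R / (N + N)%:R : C) *: z) = D i ((k%:R / N%:R : C) *: z).
      congr (D i (_ *: z)); rewrite !natrD; field.
      by rewrite Nn -natrD pnatr_eq0 -lt0n addn_gt0 N0.
    under eq_bigr do rewrite E.
    rewrite big_split sumrB /=; set A := \sum_(_ < N) _; set B := \sum_(_ < N) _.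
    rewrite natrD; field.
    by rewrite Nn -natrD pnatr_eq0 -lt0n addn_gt0 N0.
  rewrite ncM ncV nc_nat mulrC ler_pdivrMr; last by rewrite ltr0n addn_gt0 N0.
  apply: le_trans (nc_sum _ _ _) _.
  apply: (@le_trans _ _ (\sum_(k < N) (180 * M1 * 2^-1 ^+ m))); last first.
    rewrite sumr_const card_ord -[leLHS]mulr_natr; apply: ler_wpM2l.
      by apply: mulr_ge0; [apply: mulr_ge0 => //; exact: ler0n|exact: exprn_ge0].
    by rewrite ler_nat leq_addr.
  apply: ler_sum => k _.
  have k1 : (k <= N)%N by apply/ltnW.
  have k2 : ((k + k).+1 <= N + N)%N by have := ltn_ord k; lia.
  have NN : (0 < N + N)%N by rewrite addn_gt0 N0.
  apply: le_trans (D_lip i _ _ _ _) _.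
  - by apply: le_lt_trans zr; exact: fr.
  - by apply: le_lt_trans zr; exact: fr.
  rewrite -scalerBl.
  have -> : (k + k).+1%:R / (N + N)%:R - k%:R / N%:R = (1%:R / (N + N)%:R : C).
    rewrite -addn1 !natrD; field.
    by rewrite Nn -natrD pnatr_eq0 -lt0n NN.
  rewrite nv_nat_scale powE -/N.
  have NR : 0 < N%:R :> R by rewrite ltr0n.
  have -> : 180 * M1 * (1%:R / (N + N)%:R * nv z) / (r / 2) =
    180 * M1 * (N%:R^-1 * (nv z / r)).
    rewrite natrD; field; rewrite !gt_eqF //=; lra.
  apply: ler_wpM2l; first by apply: mulr_ge0 => //; exact: ler0n.
  rewrite -[leRHS]mulr1 ler_wpM2l ?invr_ge0 ?ler0n // ler_pdivrMr //; lra.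
have /choice[q hq] : forall i, exists q : V -> C, forall z, nv z < r / 4 -> forall m,
    nc (q z - S m i z) <= 180 * M1 / (1 - 2^-1) * 2^-1 ^+ m.
  move=> i; apply: (@fun_limit R V (fun m => S m i) (fun z => nv z < r / 4)).
    exact: vanishing_geo.
  by move=> z zr; apply: geo_cauchy => // m; exact: step.
have S_hol m i z : nv z < r / 4 -> hol (S m i) z.
  move=> zr; apply: holZ; apply: hol_sum => k _.
  have zk : nv ((k%:R / (2 ^ m)%:R : C) *: z) <= nv z by apply: fr; rewrite ?expn_gt0 ?(ltnW (ltn_ord k)).
  apply: (hol_comp (F := fun x : V => (k%:R / (2 ^ m)%:R : C) *: x)); last by apply: D_hol; lra.
  move=> j; have -> : (fun x : V => ((k%:R / (2 ^ m)%:R : C) *: x) 0 j) =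
     (fun x => (k%:R / (2 ^ m)%:R : C) * x 0 j) by apply/funext => x; rewrite mxE.
  by apply: holZ; exact: hol_coord.
exists q; split.
- move=> i z zr; apply: (@hol_limit _ _ _ _ (r / 4 - nv z)); first by lra.
  have dom v : nv v < r / 4 - nv z -> nv (z + v) < r / 4.
    by move=> vr; apply: le_lt_trans (nvD _ _) _; lra.
  move=> e e0; have [m /(_ m (leqnn m)) hm] := vanishing_geo (180 * M1 / (1 - 2^-1)) q0 q1 e0.
  exists (S m i); split => v /dom vr; first exact: S_hol.
  by rewrite ncBC; apply: le_trans (hq i _ vr m) _.
- move=> i z zr; apply: le_of_eps => e e0.
  have [m /(_ m (leqnn m)) hm] := vanishing_geo (180 * M1 / (1 - 2^-1)) q0 q1 e0.
  have Sm : nc (S m i z) <= M1.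
    rewrite ncM ncV nc_nat mulrC ler_pdivrMr //.
    have -> : M1 * (2 ^ m)%:R = \sum_(k < 2 ^ m) M1.
      by rewrite sumr_const card_ord mulr_natr.
    apply: le_trans (nc_sum _ _ _) _.
    apply: ler_sum => k _; apply: D_le.
    have := fr k (2 ^ m)%N z (ltnW (ltn_ord k)) (expn_gt0 _ _); lra.
  rewrite -[q i z](subrK (S m i z)); apply: le_trans (ncD _ _) _; rewrite addrC lerD //.
  by apply: le_trans (hq i _ zr m) _.
move=> z zr; apply/eqP; rewrite -subr_eq0 -nc_eq0 eq_le nc_ge0 andbT.
apply: le_of_eps => e e0; rewrite add0r.
pose K := 108 * M + d%:R * (r / 4 * (180 * M1 / (1 - 2^-1))).
have [n hn] := vanishing_geo K q0 q1 e0.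
pose m := (n + 4)%N; have {}hn := hn m (leq_addr _ _).
pose N := (2 ^ m)%N; have N0 : (0 < N)%N by rewrite expn_gt0.
have NR : 0 < N%:R :> R by rewrite ltr0n.
have N16 : 16 <= N%:R :> R.
  by rewrite (ler_nat R 16 N) /N /m expnD -[X in (X <= _)%N]mul1n leq_mul // expn_gt0.
have Nn : N%:R != 0 :> C by rewrite pnatr_eq0 -lt0n.
pose pt k : V := (k%:R / N%:R : C) *: z.
pose w : V := (1%:R / N%:R : C) *: z.
have ptS k : pt k.+1 = pt k + w by rewrite /pt /w -scalerDl -mulrDl -natrD addn1.
have pt0 : pt 0%N = 0 by rewrite /pt mul0r scale0r.
have ptN : pt N = z by rewrite /pt mulfV // scale1r.
(* With the subdivision used for the Riemann sums, the error is a sum of N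
   Taylor remainders of order N ^ -2. *)
have main : nc (a z - a 0 - \sum_i z 0 i * S m i z) <= 108 * M / N%:R.
  have -> : a z - a 0 - \sum_i z 0 i * S m i z =
     \sum_(k < N) (a (pt k + w) - a (pt k) - lin (dd a (pt k)) w).
    rewrite sumrB; congr (_ - _).
      under eq_bigr do rewrite -ptS.
      by rewrite -(big_mkord predT (fun k => a (pt k.+1) - a (pt k))) telescope_sumr // pt0 ptN.
    rewrite /lin exchange_big; apply: eq_bigr => i _.
    rewrite /S -/N mulrA mulr_sumr; apply: eq_bigr => k _.
    by rewrite /D -/(pt k) /w mxE mul1r [z 0 i * _]mulrC [LHS]mulrC.
  apply: le_trans (nc_sum _ _ _) _.
  have -> : 108 * M / N%:R = \sum_(k < N) (108 * M / N%:R ^+ 2).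
    by rewrite sumr_const card_ord -[RHS]mulr_natr; field; rewrite gt_eqF.
  apply: ler_sum => k _.
  have kz : nv (pt k) < r / 4 by apply: le_lt_trans zr; apply: fr => //; exact/ltnW/ltn_ord.
  have wz : nv w / (r / 2) <= (2 * N%:R)^-1.
    rewrite /w nv_nat_scale ler_pdivrMr // mulrC mulrA ler_pdivrMr //.
    by rewrite [leRHS](_ : _ = r / 4) ?mulr1 ?ltW //; field; rewrite gt_eqF.
  have ptr : nv (pt k) < r / 2 by lra.
  apply: le_trans (@taylor2_mv _ _ a (pt k) _ (r / 2) M _ r2 _ _ _ _) _.
  - by move=> u /(in_r _ u ptr)/ah.
  - by move=> u /(in_r _ u ptr)/aM.
  - by apply: Dsd; lra.
  - move: wz; rewrite ler_pdivrMr // => /le_trans; apply.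
    rewrite [leRHS]mulrC ler_pM2r // lef_pV2 ?posrE ?mulr_gt0 //; lra.
  have -> : 108 * M / N%:R ^+ 2 = 432 * M * ((2 * N%:R)^-1) ^+ 2.
    by field; rewrite gt_eqF.
  apply: ler_wpM2l; first exact: mulr_ge0 (ler0n _ _) M0.
  rewrite lerXn2r // nnegrE; last by rewrite invr_ge0 mulr_ge0 // ltW.
  by apply: divr_ge0; [exact: nv_ge0|exact: ltW].
have -> : a z - (a 0 + \sum_i z 0 i * q i z) =
  (a z - a 0 - \sum_i z 0 i * S m i z) - \sum_i z 0 i * (q i z - S m i z).
  under [X in _ = _ - X]eq_bigr do rewrite mulrBr.
  by rewrite sumrB; ring.
apply: le_trans (ncB _ _) _; apply: le_trans hn.
rewrite mulrDl; apply: lerD; first by rewrite powE.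
apply: le_trans (nc_sum _ _ _) _.
have -> : d%:R * (r / 4 * (180 * M1 / (1 - 2^-1))) * 2^-1 ^+ m =
  \sum_(i < d) (r / 4 * (180 * M1 / (1 - 2^-1) * 2^-1 ^+ m)).
  by rewrite sumr_const card_ord -[RHS]mulr_natl !mulrA.
apply: ler_sum => i _; rewrite ncM; apply: ler_pM; rewrite ?nc_ge0 ?hq //.
by apply: le_trans (nc_le_nv _ _) (ltW zr).
Qed.

End Hadamard.

(** * Approximation by entire functions *)

Section EntireTaylor.
Context {R : realType} {d : nat}.
Local Notation C := R[i].
Local Notation V := 'rV[C]_d.
Implicit Types (a : V -> C) (p v w z : V).

(** Iterating [hadamard] produces the Taylor polynomial.  The constant K comes
    before a and M because the lemma is applied to sequences of functions, and
    the growth of T is controlled on the whole space. *)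
Lemma taylor_entire (N : nat) (r : R) : 0 < r ->
  exists2 K : R, 0 <= K & forall a M,
    (forall z, nv z < r -> hol a z) -> (forall z, nv z < r -> nc (a z) <= M) ->
    exists T : V -> C, [/\ forall z, hol T z,
      forall z, nc (T z) <= K * M * (1 + nv z) ^+ N &
      forall z, nv z < r / 4 ^+ N -> nc (a z - T z) <= K * M * nv z ^+ N].
Proof.
elim: N r => [|N IH] r r0.
  exists 1 => // a M ah aM.
  have M0 : 0 <= M by apply: le_trans (nc_ge0 _) (aM 0 _); rewrite nv0.
  exists (fun=> 0); split => [z|z|z]; first exact: hol_const.
    by rewrite nc0 mul1r expr0 mulr1.
  by rewrite expr0 divr1 subr0 mul1r expr0 mulr1; exact: aM.
have r4 : 0 < r / 4 by lra.
have [K K0 IHK] := IH _ r4.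
pose c := 144 / r.
have c0 : 0 <= c by apply: divr_ge0; [exact: ler0n|exact: ltW].
exists (1 + d%:R * (K * c)).
  by apply: addr_ge0 => //; apply: mulr_ge0 (ler0n _ _) (mulr_ge0 K0 c0).
move=> a M ah aM.
have M0 : 0 <= M by apply: le_trans (nc_ge0 _) (aM 0 _); rewrite nv0.
have [q [qh qM aq]] := hadamard r0 ah aM.
have /choice[T hT] : forall i, exists T : V -> C, [/\ forall z, hol T z,
      forall z, nc (T z) <= K * (144 * M / r) * (1 + nv z) ^+ N &
      forall z, nv z < r / 4 / 4 ^+ N -> nc (q i z - T z) <= K * (144 * M / r) * nv z ^+ N].
  by move=> i; apply: IHK; [exact: qh|exact: qM].
have cM : K * (144 * M / r) = K * c * M by rewrite /c; ring.
have nvN z k : 0 <= nv z ^+ k by rewrite exprn_ge0 // nv_ge0.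
exists (fun z => a 0 + \sum_i z 0 i * T i z); split=> [z|z|z].
- apply: holD; first exact: hol_const.
  by apply: hol_sum => i _; apply: holM; [exact: hol_coord|have [] := hT i].
- apply: le_trans (ncD _ _) _.
  have z0 := nv_ge0 z; have z1 : 1 <= 1 + nv z by lra.
  have h0 : nc (a 0) <= M by apply: aM; rewrite nv0.
  rewrite !mulrDl mul1r; apply: lerD.
    by apply: le_trans h0 _; rewrite ler_peMr // exprn_ege1.
  apply: le_trans (nc_sum _ _ _) _.
  have -> : d%:R * (K * c) * M * (1 + nv z) ^+ N.+1 =
    \sum_(i < d) (1 + nv z) * (K * c * M * (1 + nv z) ^+ N).
    by rewrite sumr_const card_ord -[RHS]mulr_natl exprS; ring.
  apply: ler_sum => i _; rewrite ncM; apply: ler_pM; rewrite ?nc_ge0 //.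
    by have := nc_le_nv z i; lra.
  by have [_ h _] := hT i; rewrite -cM.
have E : r / 4 ^+ N.+1 = r / 4 / 4 ^+ N.
  by rewrite exprS; field; rewrite expf_neq0.
rewrite E => zr.
have zr4 : nv z < r / 4.
  apply: lt_le_trans zr _; rewrite ler_pdivrMr ?exprn_gt0 // ler_peMr ?(ltW r4) //.
  by rewrite exprn_ege1 //; lra.
rewrite aq // opprD addrACA subrr add0r -sumrB.
apply: le_trans (nc_sum _ _ _) _.
apply: (@le_trans _ _ (\sum_(i < d) nv z * (K * c * M * nv z ^+ N))).
  apply: ler_sum => i _; rewrite -mulrBr ncM; apply: ler_pM; rewrite ?nc_ge0 ?nc_le_nv //.
  by have [_ _ h] := hT i; rewrite -cM; exact: h.
rewrite sumr_const card_ord -[leLHS]mulr_natl exprS.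
have -> : d%:R * (nv z * (K * c * M * nv z ^+ N)) =
  d%:R * (K * c) * M * (nv z * nv z ^+ N) by ring.
rewrite ler_wpM2r // -?exprS // mulrDl mul1r lerDr //.
Qed.

End EntireTaylor.

(** * A cohomological equation *)

Section Cohomological.
Context {R : realType}.
Local Notation C := R[i].
Variables (T : Type) (D : set T) (G : nat -> T -> T) (beta : nat -> T -> C)
  (mu : nat -> C) (W : nat -> T -> R) (q : R).
Hypothesis DG : forall n t, D t -> D (G n t).
Hypothesis mu0 : forall n, mu n != 0.
Hypothesis q0 : 0 <= q.
Hypothesis q1 : q < 1.
Hypothesis WG : forall n t, D t -> W n.+1 (G n t) <= q * nc (mu n) * W n t.
Hypothesis betaW : forall n t, D t -> nc (beta n t) <= nc (mu n) * W n t.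

(** Partial sums of the series of the beta (n + l) / (mu n * ... * mu (n + l)),
    evaluated along the orbit of t. *)
Fixpoint cohom_sum (L n : nat) (t : T) : C :=
  if L is L'.+1 then (beta n t + cohom_sum L' n.+1 (G n t)) / mu n else 0.

Lemma cohom_step L n t : D t ->
  nc (cohom_sum L.+1 n t - cohom_sum L n t) <= W n t * q ^+ L.
Proof.
elim: L n t => [|L IH] n t Dt.
  rewrite /= subr0 addr0 ncM ncV expr0 mulr1 ler_pdivrMr ?nc_gt0 //.
  by rewrite mulrC betaW.
have -> : cohom_sum L.+2 n t - cohom_sum L.+1 n t =
   (cohom_sum L.+1 n.+1 (G n t) - cohom_sum L n.+1 (G n t)) / mu n.
  by rewrite /=; field; rewrite !mu0.
rewrite ncM ncV ler_pdivrMr ?nc_gt0 //; apply: le_trans (IH _ _ (DG n Dt)) _.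
have -> : W n t * q ^+ L.+1 * nc (mu n) = q * nc (mu n) * W n t * q ^+ L.
  by rewrite exprS; ring.
by rewrite ler_wpM2r ?exprn_ge0 // WG.
Qed.

(** The weight W bounds the first term of the series, and the terms decrease
    like q ^ l because one step of G multiplies W by less than q |mu n|. *)
Lemma cohomological : exists Phi : nat -> T -> C,
  [/\ forall n t, D t -> mu n * Phi n t = beta n t + Phi n.+1 (G n t),
      forall n t, D t -> nc (Phi n t) <= W n t / (1 - q) &
      forall n t, D t -> forall L,
        nc (Phi n t - cohom_sum L n t) <= W n t / (1 - q) * q ^+ L].
Proof.
have /choice[Phi hPhi] : forall n, exists phi : T -> C, forall t, D t -> forall L,
    nc (phi t - cohom_sum L n t) <= W n t / (1 - q) * q ^+ L.
  move=> n.
  have /choice[l hl] : forall t, exists l, D t -> forall L,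
      nc (l - cohom_sum L n t) <= W n t / (1 - q) * q ^+ L.
    move=> t; have [Dt|nDt] := pselect (D t); last by exists 0.
    have [l hl] := @complex_limit R (fun L => cohom_sum L n t) _
      (vanishing_geo (W n t / (1 - q)) q0 q1)
      (geo_cauchy q0 q1 (fun L => @cohom_step L n t Dt)).
    by exists l => _.
  by exists l => t /hl.
exists Phi; split => // n t Dt; last first.
  by have := hPhi n t Dt 0%N; rewrite /= subr0 expr0 mulr1.
apply/eqP; rewrite -subr_eq0 -nc_eq0 eq_le nc_ge0 andbT.
apply: le_of_eps => e e0; rewrite add0r.
pose K := nc (mu n) * (W n t / (1 - q)) + W n.+1 (G n t) / (1 - q).
have [L /(_ L (leqnn L)) hL] := vanishing_geo K q0 q1 e0.
have -> : mu n * Phi n t - (beta n t + Phi n.+1 (G n t)) =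
  mu n * (Phi n t - cohom_sum L.+1 n t) -
    (Phi n.+1 (G n t) - cohom_sum L n.+1 (G n t)).
  by rewrite /=; field; rewrite mu0.
apply: le_trans (ncB _ _) _; apply: le_trans hL; rewrite mulrDl; apply: lerD; last first.
  exact/hPhi/DG.
rewrite ncM -mulrA; apply: ler_wpM2l; first exact: nc_ge0.
apply: le_trans (hPhi n t Dt L.+1) _.
have W0 : 0 <= W n t / (1 - q).
  by have := hPhi n t Dt 0%N; rewrite expr0 mulr1; apply: le_trans; exact: nc_ge0.
apply: ler_wpM2l => //; rewrite exprS ler_piMl ?exprn_ge0 //; exact: ltW.
Qed.

End Cohomological.

(** * Local biholomorphisms *)

Section LocalBiholomorphism.
Context {R : realType} {d : nat}.
Local Notation C := R[i].
Local Notation V := 'rV[C]_d.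
Implicit Types (U : set V) (h k : V -> V).

(** For open U: h maps U biholomorphically onto an open set, and k is the
    inverse. *)
Definition lbih U h k := forall z, U z -> [/\ vhol h z, k (h z) = z &
  exists2 dl : R, 0 < dl & forall w, nv (w - h z) < dl ->
    [/\ U (k w), h (k w) = w & vhol k w]].

(** The open sets of the norm [nv]; see [open_nvP]. *)
Definition nopen U := forall z, U z -> exists2 e : R, 0 < e &
  forall w, nv (w - z) < e -> U w.

Lemma nopen_ball r : nopen [set z : V | nv z < r].
Proof.
move=> z /= zr; exists (r - nv z) => [|w wz]; first by lra.
by have := nvBD z w 0; rewrite !subr0; lra.
Qed.

Lemma vhol_near (k : V -> V) w e : vhol k w -> 0 < e ->
  exists2 dl : R, 0 < dl & forall x, nv (x - w) < dl -> nv (k x - k w) < e.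
Proof.
move=> kw e0; have [dl dl0 h] := vhol_continuous kw e0.
by exists dl => // x /h; rewrite subrKC.
Qed.

Lemma lbih_comp U U' h k h' k' : lbih U h k -> lbih U' h' k' ->
  (forall z, U z -> U' (h z)) -> lbih U (fun z => h' (h z)) (fun z => k (k' z)).
Proof.
move=> H H' UU' z Uz.
have [hz khz [e e0 he]] := H z Uz.
have [hz' khz' [e' e0' he']] := H' _ (UU' z Uz).
split; [exact: (vhol_comp hz hz')|by rewrite khz'|].
have [|_ _ k'h] := he' (h' (h z)); first by rewrite subrr nv0.
have [e2 e20 h2] := vhol_near k'h e0; rewrite khz' in h2.
exists (Num.min e' e2); first by rewrite lt_min e0'.
move=> w; rewrite lt_min => /andP[/he'[U'w hw' kw'] /h2/he[Uw hw kw]].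
by split; [|rewrite hw|exact: (vhol_comp kw' kw)].
Qed.

Lemma lbih_sub U U' h k : nopen U' -> (forall z, U' z -> U z) -> lbih U h k -> lbih U' h k.
Proof.
move=> oU' U'U H z U'z; have [hz khz [e e0 he]] := H z (U'U z U'z).
split => //; have [r r0 hr] := oU' z U'z.
have [|_ _ kh] := he (h z); first by rewrite subrr nv0.
have [e2 e20 h2] := vhol_near kh r0; rewrite khz in h2.
exists (Num.min e e2); first by rewrite lt_min e0.
by move=> w; rewrite lt_min => /andP[/he[_ ? ?] /h2/hr].
Qed.

Lemma lbih_linear (A : 'M[C]_d) U : nopen U -> A \in unitmx ->
  lbih U (fun z => z *m A) (fun z => z *m invmx A).
Proof.
move=> oU Au; apply: (lbih_sub oU (U := setT)) => // z _.
split; [exact: vhol_mulmx|by rewrite mulmxK|].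
by exists 1 => // w _; split => //; [rewrite mulmxKV|exact: vhol_mulmx].
Qed.

End LocalBiholomorphism.

Ltac vring := by apply/rowP => ?; rewrite !mxE; ring.

(** * Perturbations of the identity *)

Section InverseFunction.
Context {R : realType} {d : nat}.
Local Notation C := R[i].
Local Notation V := 'rV[C]_d.
Variables (X : V -> V) (rho : R).
Hypothesis rho0 : 0 < rho.
Hypothesis Xhol : forall z, nv z < rho -> vhol X z.
Hypothesis Xlip : forall z w, nv z < rho -> nv w < rho -> nv (X z - X w) <= nv (z - w) / 2.
Let F z := z + X z.

Lemma expand z w : nv z < rho -> nv w < rho -> nv (z - w) <= 2 * nv (F z - F w).
Proof.
move=> zr wr; have h := Xlip zr wr.
have := nvB (F z - F w) (X z - X w).
have -> : (F z - F w) - (X z - X w) = z - w by rewrite /F; vring.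
lra.
Qed.

(** Fixed point iteration of x |-> w - X x, starting at z0. *)
Lemma contraction_solve z0 w : nv z0 < rho -> 2 * nv (w - F z0) < rho - nv z0 ->
  exists z, [/\ nv z < rho, nv (z - z0) <= 2 * nv (w - F z0) & F z = w].
Proof.
move=> z0r; set e := nv (w - F z0) => er.
have e0 : 0 <= e := nv_ge0 _.
pose fix s m : V := if m is m'.+1 then w - X (s m') else z0.
have p0 m : 0 < 2^-1 ^+ m :> R by rewrite exprn_gt0.
have inball z : nv (z - z0) <= 2 * e -> nv z < rho.
  by move=> h; have := nvB_ge z z0; lra.
have Hs m : nv (s m - z0) <= 2 * e * (1 - 2^-1 ^+ m) /\ nv (s m.+1 - s m) <= e * 2^-1 ^+ m.
  elim: m => [|m [IH1 IH2]].
    rewrite expr0 !subrr mulr0 mulr1 nv0; split=> //=.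
    by rewrite [X in nv X <= _](_ : _ = w - F z0) // /F; vring.
  have b1 : nv (s m.+1 - z0) <= 2 * e * (1 - 2^-1 ^+ m.+1).
    apply: le_trans (nvBD (s m) _ _) _; apply: le_trans (lerD IH2 IH1) _.
    by rewrite exprS le_eqVlt; apply/orP; left; apply/eqP; field.
  split=> //.
  have -> : s m.+2 - s m.+1 = X (s m) - X (s m.+1).
    by rewrite /=; vring.
  have := p0 m; have := p0 m.+1 => pm1 pm.
  apply: le_trans (Xlip _ _) _; [apply: inball; apply: le_trans IH1 _; nra|
    apply: inball; apply: le_trans b1 _; nra|].
  by rewrite nvBC exprS; lra.
have /choice[l hl] : forall i, exists l, forall m, nc (l - s m 0 i) <= e / (1 - 2^-1) * 2^-1 ^+ m.
  move=> i; apply: complex_limit; first by apply: vanishing_geo; lra.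
  apply: geo_cauchy; [lra|lra|] => m; have := nc_le_nv (s m.+1 - s m) i.
  by rewrite !mxE; have [_] := Hs m; lra.
pose z : V := \row_i l i.
have zs m : nv (z - s m) <= 2 * e * 2^-1 ^+ m.
  apply: nv_le => [|i]; first by rewrite !mulr_ge0 // ltW.
  rewrite !mxE; apply: le_trans (hl i m) _.
  by rewrite le_eqVlt; apply/orP; left; apply/eqP; field.
have zz0 : nv (z - z0) <= 2 * e by have := zs 0%N; rewrite expr0 mulr1.
exists z; split => //; first exact: inball.
apply/eqP; rewrite -subr_eq0 -nv_eq0 eq_le nv_ge0 andbT.
apply: le_of_eps => t t0; rewrite add0r.
have [||m /(_ m (leqnn m)) hm] := @vanishing_geo R (4 * e) 2^-1 _ _ t t0; [lra|lra|].
apply: le_trans hm.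
have -> : F z - w = (z - s m.+1) + (X z - X (s m)).
  by rewrite /F /=; vring.
have h1 := zs m.+1; have h2 := zs m; rewrite exprS in h1.
apply: le_trans (nvD _ _) _.
have := Xlip (inball _ zz0) (inball (s m) _); have [s1 _] := Hs m; have := p0 m => pm.
by move=> /(_ ltac:(nra)); nra.
Qed.

Definition linverse w : V := xget 0 [set z | nv z < rho /\ F z = w].

Lemma linverseK z : nv z < rho -> linverse (F z) = z.
Proof.
move=> zr; have [] := @xgetPex _ 0 [set x | nv x < rho /\ F x = F z]; first by exists z.
rewrite -/(linverse (F z)) => lr lF; apply/eqP; rewrite -subr_eq0 -nv_eq0.
by have := expand lr zr; rewrite lF subrr nv0 mulr0 eq_le => ->; exact: nv_ge0.
Qed.

(** The derivative of F at a point of the ball is 1 + DX with |DX| <= 1/2, hence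
    it is invertible. *)
Lemma linverse_hol z : nv z < rho -> vhol linverse (F z).
Proof.
move=> zr.
have /choice[D hD] := Xhol zr.
have DX v : nv (\row_i lin (D i) v) <= nv v / 2.
  apply: nv_le => [|i]; first by rewrite divr_ge0 ?nv_ge0.
  rewrite mxE; apply: le_of_eps => e e0.
  have [->|v0] := eqVneq v 0.
    by rewrite lin0 nc0 nv0 mul0r add0r ltW.
  have vp : 0 < nv v by rewrite nv_gt0.
  have [dl dl0 h] := hD i (e / nv v) (divr_gt0 e0 vp).
  pose t := Num.min (dl / 2) ((rho - nv z) / 2) / nv v.
  have t0 : 0 < t by rewrite divr_gt0 // lt_min !divr_gt0 // subr_gt0.
  have tv : nv (t%:C *: v) = Num.min (dl / 2) ((rho - nv z) / 2).
    by rewrite nvZ nc_real gtr0_norm // /t divfK // gt_eqF.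
  have tv1 : nv (t%:C *: v) < dl by rewrite tv gt_min; apply/orP; left; lra.
  have tv2 : nv (t%:C *: v) < rho - nv z by rewrite tv gt_min; apply/orP; right; lra.
  have zt : nv (z + t%:C *: v) < rho by apply: le_lt_trans (nvD _ _) _; lra.
  have h1 := h _ tv1.
  have h2 := Xlip zt zr; rewrite [z + _ - z]addrC addKr in h2.
  have h3 := nc_le_nv (X (z + t%:C *: v) - X z) i; rewrite !mxE in h3.
  rewrite linZr nvZ nc_real gtr0_norm // in h1 h2.
  have : nc (t%:C * lin (D i) v) <= t * (nv v / 2 + e).
    rewrite -[X in nc X](subKr (X (z + t%:C *: v) 0 i - X z 0 i)).
    apply: le_trans (ncB _ _) _.
    have : e / nv v * (t * nv v) = t * e by field; rewrite gt_eqF.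
    lra.
  by rewrite ncM nc_real gtr0_norm // ler_pM2l.
pose A : 'M[C]_d := \matrix_(k, i) ((i == k)%:R + D i k).
have vA v : v *m A = v + \row_i lin (D i) v.
  apply/rowP => i; rewrite !mxE /lin.
  under eq_bigr do rewrite mxE mulrDr.
  rewrite big_split /=; congr (_ + _).
    by rewrite (bigD1 i) //= eqxx mulr1 big1 ?addr0 // => k ki; rewrite eq_sym (negbTE ki) mulr0.
  by apply: eq_bigr => k _; rewrite mulrC.
have Au : A \in unitmx.
  rewrite -row_free_unit; apply/row_freeP.
  have /row_freeP[B hB] : row_free A.
    rewrite -kermx_eq0; apply/eqP/row_matrixP => i.
    rewrite row0; apply/eqP; rewrite -nv_eq0.
    have := congr1 (row i) (mulmx_ker A); rewrite row_mul row0 vA => E.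
    have := DX (row i (kermx A)).
    have -> : \row_k lin (D k) (row i (kermx A)) = - row i (kermx A).
      by apply/eqP; rewrite -addr_eq0 addrC E.
    by rewrite nvN eq_le nv_ge0 andbT; lra.
  by exists B.
pose B := invmx A.
pose KB : R := \sum_i \sum_k nc (B k i).
have KB0 : 0 <= KB by rewrite sumr_ge0 // => i _; rewrite sumr_ge0 // => k _; exact: nc_ge0.
have vB v : nv (v *m B) <= KB * nv v.
  apply: nv_le => [|i]; first by rewrite mulr_ge0 ?nv_ge0.
  rewrite mxE; apply: le_trans (nc_sum _ _ _) _.
  apply: (@le_trans _ _ ((\sum_k nc (B k i)) * nv v)).
    by rewrite mulr_suml; apply: ler_sum => k _; rewrite ncM mulrC ler_wpM2l ?nc_ge0 ?nc_le_nv.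
  rewrite ler_wpM2r ?nv_ge0 // /KB [leRHS](bigD1 i) //= lerDl sumr_ge0 // => j _.
  by rewrite sumr_ge0 // => k _; exact: nc_ge0.
have near e : 0 < e -> exists2 dl : R, 0 < dl & forall u, nv u < dl ->
    nv (linverse (F z + u) - linverse (F z) - u *m B) <= e * nv u.
  move=> e0.
  pose e1 := e / (2 * (KB + 1)).
  have e10 : 0 < e1 by rewrite divr_gt0 // mulr_gt0 //; lra.
  have /choice[dl hdl] : forall i, exists dl : R, 0 < dl /\ forall v, nv v < dl ->
      nc (X (z + v) 0 i - X z 0 i - lin (D i) v) <= e1 * nv v.
    by move=> i; have [dl dl0 h] := hD i e1 e10; exists dl.
  have [dl1 dl10 h1] : exists2 dl1 : R, 0 < dl1 & forall v, nv v < dl1 ->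
      nv (X (z + v) - X z - \row_i lin (D i) v) <= e1 * nv v.
    exists (\big[Num.min/1]_i dl i).
      by elim/big_rec: _ => // i x _ x0; rewrite lt_min x0; have [->] := hdl i.
    move=> v hv; apply: nv_le => [|i]; first by rewrite mulr_ge0 ?nv_ge0 // ltW.
    rewrite !mxE; have [_] := hdl i; apply; apply: lt_le_trans hv _.
    by rewrite (bigD1 i) //= ge_min lexx.
  exists (Num.min (dl1 / 2) ((rho - nv z) / 2)).
    by rewrite lt_min !divr_gt0 // subr_gt0.
  move=> u; rewrite lt_min => /andP[u1 u2].
  have E : F z + u - F z = u by rewrite addrC addKr.
  have [|x [xr xz Fx]] := @contraction_solve z (F z + u) zr; first by rewrite E; lra.
  rewrite E in xz; rewrite -Fx linverseK // linverseK //.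
  pose v := x - z; have xE : x = z + v by rewrite /v subrKC.
  have v1 : nv v < dl1 by apply: le_lt_trans xz _; lra.
  have := h1 v v1; set err := X (z + v) - X z - _ => herr.
  have uE : u = v *m A + err.
    by rewrite vA -[LHS]E -Fx /F xE /err; vring.
  have -> : x - z - u *m B = - (err *m B).
    by rewrite uE mulmxDl mulmxK // -/v opprD addrA subrr sub0r.
  rewrite nvN; apply: le_trans (vB _) _.
  apply: (@le_trans _ _ (KB * (e1 * (2 * nv u)))).
    apply: ler_wpM2l => //; apply: le_trans herr _; apply: ler_wpM2l xz; exact: ltW.
  have -> : e * nv u = (KB + 1) * (e1 * (2 * nv u)).
    by rewrite /e1; field; rewrite gt_eqF //; lra.
  apply: ler_wpM2r; last by rewrite lerDl.
  by apply: mulr_ge0 (ltW e10) _; rewrite mulr_ge0 ?nv_ge0.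
move=> i; exists (fun k => B k i) => e e0.
have [dl dl0 h] := near e e0; exists dl => // u /h; apply: le_trans.
have := nc_le_nv (linverse (F z + u) - linverse (F z) - u *m B) i; rewrite !mxE.
by rewrite [X in nc (_ - X)](_ : _ = lin (fun k => B k i) u) // /lin; apply: eq_bigr => k _; rewrite mulrC.
Qed.

Lemma lbih_perturb : lbih [set z : V | nv z < rho] F linverse.
Proof.
move=> z /= zr; split; [|exact: linverseK|].
  move=> i; have -> : (fun x => F x 0 i) = (fun x : V => x 0 i + X x 0 i).
    by apply/funext => x; rewrite mxE.
  by apply: holD; [exact: hol_coord|exact: Xhol].
exists ((rho - nv z) / 2); first by rewrite divr_gt0 // subr_gt0.
move=> w wz; have [|x [xr _ Fx]] := @contraction_solve z w zr; first by lra.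
by rewrite -Fx linverseK //; split => //; exact: linverse_hol.
Qed.

Lemma linverse_ball w : X 0 = 0 -> nv w < rho / 2 ->
  [/\ nv (linverse w) < rho, nv (linverse w) <= 2 * nv w, F (linverse w) = w &
      vhol linverse w].
Proof.
move=> X0 wr; have F0 : F 0 = 0 by rewrite /F X0 addr0.
have [||x [xr xw Fx]] := @contraction_solve 0 w; rewrite ?nv0 ?F0 ?subr0 //; first by lra.
rewrite F0 !subr0 in xw.
by rewrite -Fx linverseK // Fx; split => //; rewrite -Fx; exact: linverse_hol.
Qed.

End InverseFunction.

(** * Linearization along the fibres of a projection *)

Section Truncation.
Context {R : realType} {d : nat}.
Local Notation C := R[i].
Local Notation V := 'rV[C]_d.
Implicit Types (z w : V).

Definition agree (j : nat) z w := forall k : 'I_d, (k < j)%N -> z 0 k = w 0 k.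

Definition trunc (j : nat) z : V := \row_k (if (k < j)%N then z 0 k else 0).

Lemma agree_trunc j z : agree j z (trunc j z).
Proof. by move=> k kj; rewrite mxE kj. Qed.

Lemma nv_trunc j z : nv (trunc j z) <= nv z.
Proof.
apply: nv_le => [|k]; first exact: nv_ge0.
by rewrite mxE; case: ifP => _; rewrite ?nc0 ?nv_ge0 ?nc_le_nv.
Qed.

Lemma nvB_trunc j z : nv (z - trunc j z) <= nv z.
Proof.
apply: nv_le => [|k]; first exact: nv_ge0.
by rewrite !mxE; case: ifP => _; rewrite ?subrr ?subr0 ?nc0 ?nv_ge0 ?nc_le_nv.
Qed.

Lemma eq_trunc j z w : agree j z w -> trunc j z = trunc j w.
Proof. by move=> zw; apply/rowP => k; rewrite !mxE; case: ifP => // /zw. Qed.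

Lemma vhol_trunc j z : vhol (trunc j) z.
Proof.
move=> k; have [kj|kj] := boolP (k < j)%N.
  have -> : (fun x => trunc j x 0 k) = (fun x => x 0 k).
    by apply/funext => x; rewrite mxE kj.
  exact: hol_coord.
have -> : (fun x => trunc j x 0 k) = (fun=> 0).
  by apply/funext => x; rewrite mxE (negbTE kj).
exact: hol_const.
Qed.

End Truncation.

Section Phi.
Context {R : realType} {d : nat}.
Local Notation C := R[i].
Local Notation V := 'rV[C]_d.
Variables (f : nat -> V -> V) (lam : nat -> 'I_d -> C) (j : 'I_d).
Variables (rho K sg nu theta Kv : R) (v : nat -> 'I_d -> 'I_d -> R).
Hypothesis rho0 : 0 < rho.
Hypothesis sg0 : 0 < sg.
Hypothesis th1 : 1 < theta.
Hypothesis q1 : sg * theta < 1.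
Hypothesis K0 : 0 <= K.
Hypothesis nu0 : 0 < nu.
Hypothesis lam_nu : forall n, nu <= nc (lam n j).
Hypothesis lam1 : forall n i, nc (lam n i) <= 1.
Hypothesis fhol : forall n z, nv z < rho -> vhol (f n) z.
Hypothesis fnear : forall n z i, nv z < rho ->
  nc (f n z 0 i - lam n i * z 0 i) <= K * sg ^+ n * nv z.
Hypothesis flow : forall n, exists D, [/\ sd (fun z => f n z 0 j) 0 D,
  D j = lam n j & forall k : 'I_d, (j < k)%N -> D k = 0].
Hypothesis fcontr : forall n z, nv z < rho -> nv (f n z) <= nv z.
Hypothesis fagree : forall n z w, nv z < rho -> nv w < rho ->
  agree j z w -> agree j (f n z) (f n w).
Hypothesis v_ge1 : forall n h (k : 'I_d), (j <= k)%N -> 1 <= v n h k.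
Hypothesis v_le : forall n h (k : 'I_d), (j <= k)%N -> v n h k <= Kv * theta ^+ n.
Hypothesis v_step : forall n h (k : 'I_d), (j <= k)%N ->
  v n.+1 h k * (nc (lam n h) * nc (lam n k)) <= nc (lam n j) * v n h k.
Hypothesis small : forall n, 180 * (K * sg ^+ n) <= 1.
Hypothesis small_gap : forall n,
  d%:R * d%:R * (Kv * theta ^+ n.+1) * (3 * (180 * (K * sg ^+ n))) <= nu * (theta - 1).

(** A quadratic function on pairs of points, adapted to the dynamics: v n h k
    absorbs the nonuniform growth of the products of |lam h| |lam k| / |lam j|
    along the orbit, so that one step multiplies Q by about |lam j|. *)
Definition Q n (z w : V) : R := \sum_(k < d | (j <= k)%N) \sum_(h < d)
  v n h k * (nc (z 0 k - w 0 k) * (nc (z 0 h) + nc (w 0 h))).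

Let term_ge0 (z w : V) k h : 0 <= nc (z 0 k - w 0 k) * (nc (z 0 h) + nc (w 0 h)).
Proof. by rewrite mulr_ge0 ?addr_ge0 ?nc_ge0. Qed.

Let v_ge0 n h (k : 'I_d) : (j <= k)%N -> 0 <= v n h k.
Proof. by move=> /(v_ge1 n h); lra. Qed.

Let Kvth n : 0 <= Kv * theta ^+ n.
Proof. by apply: le_trans (v_le n j (leqnn j)); exact: v_ge0. Qed.

Lemma Q_lower n z w : agree j z w -> nv (z - w) * (nv z + nv w) <= Q n z w.
Proof.
move=> zw.
have h1 : nv (z - w) <= \sum_(k < d | (j <= k)%N) nc (z 0 k - w 0 k).
  have s0 : 0 <= \sum_(k < d | (j <= k)%N) nc (z 0 k - w 0 k).
    by rewrite sumr_ge0 // => *; exact: nc_ge0.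
  apply: nv_le => // k; rewrite !mxE; have [jk|kj] := leqP j k.
    by rewrite (bigD1 k) //= lerDl sumr_ge0 // => *; exact: nc_ge0.
  by rewrite zw // subrr nc0.
have h2 : nv z + nv w <= \sum_(h < d) (nc (z 0 h) + nc (w 0 h)).
  rewrite big_split /=; apply: lerD; apply: nv_le => [|k];
    rewrite ?sumr_ge0 // => *; rewrite ?nc_ge0 //;
    by rewrite (bigD1 k) //= lerDl sumr_ge0 // => *; exact: nc_ge0.
apply: le_trans (ler_pM _ _ h1 h2) _; rewrite ?addr_ge0 ?nv_ge0 //.
rewrite mulr_suml; apply: ler_sum => k jk; rewrite mulr_sumr; apply: ler_sum => h _.
by rewrite ler_peMl // v_ge1.
Qed.

Lemma sum_kh_le (c : R) : 0 <= c ->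
  \sum_(k < d | (j <= k)%N) \sum_(h < d) c <= d%:R * d%:R * c.
Proof.
move=> c0; apply: (@le_trans _ _ (\sum_(k < d) \sum_(h < d) c)).
  rewrite [leRHS](bigID (fun k : 'I_d => (j <= k)%N)) /= lerDl sumr_ge0 // => k _.
  by rewrite sumr_ge0.
by rewrite !sumr_const !card_ord -[c *+ d]mulr_natl -[leLHS]mulr_natl mulrA.
Qed.

Lemma Q_upper n z w :
  Q n z w <= d%:R * d%:R * (Kv * theta ^+ n * (nv (z - w) * (nv z + nv w))).
Proof.
have p0 := Kvth n.
apply: le_trans (sum_kh_le _); last first.
  by rewrite mulr_ge0 // mulr_ge0 ?addr_ge0 ?nv_ge0.
apply: ler_sum => k jk; apply: ler_sum => h _.
apply: ler_pM; [exact: v_ge0|exact: term_ge0|exact: v_le|].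
apply: ler_pM; rewrite ?nc_ge0 ?addr_ge0 ?nc_ge0 //; last by rewrite lerD ?nc_le_nv.
by have := nc_le_nv (z - w) k; rewrite !mxE.
Qed.

Lemma fdiff_le n z w k : nv z < rho / 2 -> nv w < rho / 2 ->
  nc (f n z 0 k - f n w 0 k) <=
    nc (lam n k) * nc (z 0 k - w 0 k) + 180 * (K * sg ^+ n) * nv (z - w).
Proof.
move=> zr wr; pose e x := f n x 0 k - lam n k * x 0 k.
have := @cauchy_lipschitz R d e rho (K * sg ^+ n * rho) z w rho0 _ _ zr wr.
have -> : 180 * (K * sg ^+ n * rho) * nv (z - w) / rho = 180 * (K * sg ^+ n) * nv (z - w).
  by field; rewrite gt_eqF.
move=> h; have {}h : nc (e z - e w) <= 180 * (K * sg ^+ n) * nv (z - w).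
  apply: h => u ur.
    by apply: holB; [exact: fhol|apply: holZ; exact: hol_coord].
  apply: le_trans (fnear n k ur) _; apply: ler_wpM2l; last exact: ltW.
  by rewrite mulr_ge0 ?exprn_ge0 // ltW.
have -> : f n z 0 k - f n w 0 k = lam n k * (z 0 k - w 0 k) + (e z - e w).
  by rewrite /e; ring.
by apply: le_trans (ncD _ _) _; rewrite ncM lerD.
Qed.

(** The diagonal part of f n multiplies the term of index (k, h) by
    |lam k| |lam h|, which is at most |lam j| by the choice of v; the factor theta
    leaves room for the rest, by [small_gap] and [Q_lower]. *)
Lemma Q_step n z w : nv z < rho / 2 -> nv w < rho / 2 -> agree j z w ->
  Q n.+1 (f n z) (f n w) <= theta * nc (lam n j) * Q n z w.
Proof.
move=> zr wr zw; set ep := 180 * (K * sg ^+ n).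
have zr' : nv z < rho by have := rho0; lra.
have wr' : nv w < rho by have := rho0; lra.
have sgn : 0 <= K * sg ^+ n by rewrite mulr_ge0 // exprn_ge0 // ltW.
have ep0 : 0 <= ep by apply: mulr_ge0 (ler0n _ _) sgn.
have ep1 : ep <= 1 := small n.
have Kep : K * sg ^+ n <= ep by rewrite /ep; apply: ler_peMl => //; lra.
set Dm := nv (z - w); set X := nv z + nv w.
have Dm0 : 0 <= Dm := nv_ge0 _.
have X0 : 0 <= X by rewrite addr_ge0 ?nv_ge0.
have pt h x : nv x < rho -> nc (f n x 0 h) <= nc (lam n h) * nc (x 0 h) + ep * nv x.
  move=> xr; rewrite -[f n x 0 h](subrK (lam n h * x 0 h)).
  apply: le_trans (ncD _ _) _; rewrite ncM addrC lerD2l.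
  by apply: le_trans (fnear n h xr) _; rewrite ler_wpM2r ?nv_ge0.
have term (k h : 'I_d) : (j <= k)%N ->
  v n.+1 h k * (nc (f n z 0 k - f n w 0 k) * (nc (f n z 0 h) + nc (f n w 0 h))) <=
  nc (lam n j) * (v n h k * (nc (z 0 k - w 0 k) * (nc (z 0 h) + nc (w 0 h)))) +
  Kv * theta ^+ n.+1 * (3 * ep) * (Dm * X).
  move=> jk.
  have a1 := fdiff_le n k zr wr; rewrite -/ep -/Dm in a1.
  have a2 : nc (f n z 0 h) + nc (f n w 0 h) <=
      nc (lam n h) * (nc (z 0 h) + nc (w 0 h)) + ep * X.
    by have := pt h z zr'; have := pt h w wr'; rewrite /X; lra.
  have dk : nc (z 0 k - w 0 k) <= Dm by have := nc_le_nv (z - w) k; rewrite !mxE.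
  have xh : nc (z 0 h) + nc (w 0 h) <= X by rewrite lerD ?nc_le_nv.
  have dk0 : 0 <= nc (z 0 k - w 0 k) := nc_ge0 _.
  have xh0 : 0 <= nc (z 0 h) + nc (w 0 h) by rewrite addr_ge0 ?nc_ge0.
  have lk := lam1 n k; have lh := lam1 n h.
  have lk0 := nc_ge0 (lam n k); have lh0 := nc_ge0 (lam n h).
  have vs := v_step n h jk; have vl := v_le n.+1 h jk; have vp := v_ge0 n.+1 h jk.
  set dk_ := nc (z 0 k - w 0 k) in a1 dk dk0 *.
  set xh_ := nc (z 0 h) + nc (w 0 h) in a2 xh xh0 *.
  set Lk := nc (lam n k) in a1 lk lk0 vs *. set Lh := nc (lam n h) in a2 lh lh0 vs *.
  have p1 : nc (f n z 0 k - f n w 0 k) * (nc (f n z 0 h) + nc (f n w 0 h)) <=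
     (Lk * dk_ + ep * Dm) * (Lh * xh_ + ep * X).
    by apply: ler_pM; rewrite ?addr_ge0 ?nc_ge0.
  have p2 : (Lk * dk_ + ep * Dm) * (Lh * xh_ + ep * X) <=
     Lh * Lk * (dk_ * xh_) + 3 * ep * (Dm * X).
    have e1 : Lk * dk_ * X <= Dm * X.
      by apply: ler_wpM2r => //; rewrite -[leRHS]mul1r; apply: ler_pM.
    have e2 : Dm * (Lh * xh_) <= Dm * X.
      by apply: ler_wpM2l => //; rewrite -[leRHS]mul1r; apply: ler_pM.
    have e3 : ep * (Dm * X) <= 1 * (Dm * X) by apply: ler_wpM2r => //; exact: mulr_ge0.
    have e1' := ler_wpM2l ep0 e1; have e2' := ler_wpM2l ep0 e2; have e3' := ler_wpM2l ep0 e3.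
    have -> : (Lk * dk_ + ep * Dm) * (Lh * xh_ + ep * X) =
      Lh * Lk * (dk_ * xh_) + ep * (Lk * dk_ * X) + ep * (Dm * (Lh * xh_)) +
      ep * (ep * (Dm * X)) by ring.
    move: e1' e2' e3'; rewrite mul1r; lra.
  apply: (@le_trans _ _ (v n.+1 h k * (Lh * Lk * (dk_ * xh_) + 3 * ep * (Dm * X)))).
    by apply: ler_wpM2l => //; exact: le_trans p1 p2.
  rewrite mulrDr; apply: lerD.
    rewrite mulrA [leRHS]mulrA; apply: ler_wpM2r => //; exact: mulr_ge0.
  rewrite mulrA; apply: ler_wpM2r; first exact: mulr_ge0.
  by apply: ler_wpM2r => //; exact: mulr_ge0.
have c0 : 0 <= Kv * theta ^+ n.+1 * (3 * ep) * (Dm * X).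
  by apply: mulr_ge0; [apply: mulr_ge0 (Kvth _) _; exact: mulr_ge0|exact: mulr_ge0].
apply: (@le_trans _ _ (nc (lam n j) * Q n z w +
   d%:R * d%:R * (Kv * theta ^+ n.+1 * (3 * ep) * (Dm * X)))).
  apply: (@le_trans _ _ (\sum_(k < d | (j <= k)%N) \sum_(h < d)
     (nc (lam n j) * (v n h k * (nc (z 0 k - w 0 k) * (nc (z 0 h) + nc (w 0 h)))) +
     Kv * theta ^+ n.+1 * (3 * ep) * (Dm * X)))).
    by apply: ler_sum => k jk; apply: ler_sum => h _; exact: term.
  under eq_bigr do rewrite big_split.
  rewrite big_split /=; apply: lerD; last exact: sum_kh_le.
  by rewrite /Q mulr_sumr; apply: ler_sum => k _; rewrite mulr_sumr.
have := Q_lower n zw; rewrite -/Dm -/X => QL.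
have th0 : 0 <= theta - 1 by have := th1; lra.
have DX0 : 0 <= Dm * X by exact: mulr_ge0.
have : d%:R * d%:R * (Kv * theta ^+ n.+1 * (3 * ep) * (Dm * X)) <=
   nc (lam n j) * (theta - 1) * Q n z w.
  have -> : d%:R * d%:R * (Kv * theta ^+ n.+1 * (3 * ep) * (Dm * X)) =
    d%:R * d%:R * (Kv * theta ^+ n.+1) * (3 * ep) * (Dm * X) by ring.
  apply: ler_pM => //.
    apply: mulr_ge0; last exact: mulr_ge0.
    by apply: mulr_ge0 (Kvth _); rewrite mulr_ge0.
  by apply: le_trans (small_gap n) _; rewrite ler_wpM2r.
move: (Q n z w) (nc (lam n j)) => *; lra.
Qed.

Let rho1 := rho / 192.
Let kap : R := 180 * 432 * 4.
Let kap0 : 0 <= kap.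
Proof. exact: mulr_ge0 (mulr_ge0 (ler0n _ _) (ler0n _ _)) (ler0n _ _). Qed.
Let b n (z : V) : C := f n z 0 j - lam n j * z 0 j.
Let beta n (p : V * V) : C := b n p.1 - b n p.2.
Let G n (p : V * V) : V * V := (f n p.1, f n p.2).
Let dom : set (V * V) := [set p | [/\ nv p.1 < rho1, nv p.2 < rho1 & agree j p.1 p.2]].
Let KW : R := kap * K / (rho * nu).
Let KW0 : 0 <= KW.
Proof. by apply: divr_ge0; [exact: mulr_ge0|apply: mulr_ge0; exact: ltW]. Qed.
Let W n (p : V * V) : R := KW * sg ^+ n * Q n p.1 p.2.

Let in_rho (x : V) : nv x < rho1 -> nv x < rho.
Proof. by move=> xr; have := rho0; rewrite /rho1 in xr; lra. Qed.

Let in_rho2 (x : V) : nv x < rho1 -> nv x < rho / 2.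
Proof. by move=> xr; have := rho0; rewrite /rho1 in xr; lra. Qed.

Let fdom n (x : V) : nv x < rho1 -> nv (f n x) < rho1.
Proof. by move=> xr; apply: le_lt_trans (fcontr n (in_rho xr)) xr. Qed.

Let dom_G n (p : V * V) : dom p -> dom (G n p).
Proof.
by move=> [p1 p2 pa]; split; [exact: fdom|exact: fdom|apply: fagree => //; exact: in_rho].
Qed.

Let W_G n p : dom p -> W n.+1 (G n p) <= sg * theta * nc (lam n j) * W n p.
Proof.
move=> [p1 p2 pa]; rewrite /W exprS.
have -> : sg * theta * nc (lam n j) * (KW * sg ^+ n * Q n p.1 p.2) =
  KW * (sg * sg ^+ n) * (theta * nc (lam n j) * Q n p.1 p.2) by ring.
apply: ler_wpM2l; last by apply: Q_step => //; exact: in_rho2.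
by apply: mulr_ge0 KW0 _; apply: mulr_ge0; [|apply: exprn_ge0]; exact: ltW.
Qed.

(** The linear part of b n involves only the coordinates before the j-th one,
    in which the two points agree. *)
Let beta_W n p : dom p -> nc (beta n p) <= nc (lam n j) * W n p.
Proof.
move=> [p1 p2 pa]; have [D [hD Dj Dk]] := flow n.
pose D' k := D k + (0 * (0 : V) 0 j + - lam n j * (j == k)%:R).
have hD' : sd (b n) 0 D'.
  have -> : b n = (fun z => f n z 0 j + - lam n j * z 0 j).
    by apply/funext => z; rewrite /b mulNr.
  apply: sdD hD _; apply: (sdM (D := fun=> 0) (E := fun k => (j == k)%:R)).
    exact: sd_const.
  exact: sd_coord.
have D'0 : lin D' (p.1 - p.2) = 0.
  rewrite /lin big1 // => k _; rewrite !mxE /D' mul0r add0r.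
  have [kj|jk|/val_inj ->] := ltngtP k j.
  - by rewrite pa // subrr mulr0.
  - by rewrite Dk // (_ : (j == k) = false) ?mulr0 ?addr0 ?mul0r //; apply/negbTE; rewrite -val_eqE neq_ltn jk.
  - by rewrite Dj eqxx mulr1 subrr mul0r.
have bh u : nv u < rho -> hol (b n) u.
  by move=> ur; apply: holB; [exact: fhol|apply: holZ; exact: hol_coord].
have bM u : nv u < rho -> nc (b n u) <= K * sg ^+ n * rho.
  move=> ur; apply: le_trans (fnear n j ur) _; apply: ler_wpM2l; last exact: ltW.
  by apply: mulr_ge0 => //; apply: exprn_ge0; exact: ltW.
have := cauchy_lipschitz2 (z := p.1) (w := p.2) rho0 bh bM hD' _.
rewrite D'0 subr0 => h; apply: le_trans (h _) _.
  by move: p1 p2; rewrite /rho1; move: (nv p.1) (nv p.2) => x y; have := rho0; lra.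
have Ql := Q_lower n pa.
apply: (@le_trans _ _ (nu * W n p)); last first.
  apply: ler_wpM2r (lam_nu n); rewrite /W; apply: mulr_ge0.
    by apply: mulr_ge0 KW0 _; apply: exprn_ge0; exact: ltW.
  by apply: le_trans Ql; rewrite mulr_ge0 ?addr_ge0 ?nv_ge0.
have -> : nu * W n p = kap * (K * sg ^+ n / rho * Q n p.1 p.2).
  by rewrite /W /KW; field; rewrite !gt_eqF.
apply: ler_wpM2l => //.
have -> : K * sg ^+ n * rho * (nv p.1 + nv p.2) * nv (p.1 - p.2) / rho ^+ 2 =
  K * sg ^+ n / rho * (nv (p.1 - p.2) * (nv p.1 + nv p.2)).
  by field; rewrite gt_eqF.
apply: ler_wpM2l Ql; apply: divr_ge0; last exact: ltW.
by apply: mulr_ge0 => //; apply: exprn_ge0; exact: ltW.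
Qed.

Let lam0 n : lam n j != 0.
Proof. by rewrite -nc_gt0; apply: lt_le_trans (lam_nu n). Qed.

Let q0 : 0 <= sg * theta.
Proof. by apply: mulr_ge0; [exact: ltW|have := th1; lra]. Qed.

Let sum_add L n z w x : cohom_sum G beta (fun n => lam n j) L n (z, x) =
  cohom_sum G beta (fun n => lam n j) L n (z, w) +
  cohom_sum G beta (fun n => lam n j) L n (w, x).
Proof.
elim: L n z w x => [|L IH] n z w x; first by rewrite addr0.
rewrite /= /G /= (IH _ _ (f n w)) /beta /=; field; exact: lam0.
Qed.

Let sum_hol L n (A B : V -> V) (p : V) : vhol A p -> vhol B p ->
  nv (A p) < rho1 -> nv (B p) < rho1 ->
  hol (fun z => cohom_sum G beta (fun n => lam n j) L n (A z, B z)) p.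
Proof.
elim: L n A B => [|L IH] n A B hA hB Ar Br; first exact: hol_const.
have hb (F : V -> V) : vhol F p -> nv (F p) < rho1 -> hol (fun z => b n (F z)) p.
  move=> hF Fr; apply: (hol_comp hF); apply: holB; first exact/fhol/in_rho.
  by apply: holZ; exact: hol_coord.
rewrite /=; apply: holM; last exact: hol_const.
apply: holD; first by apply: holB; exact: hb.
by apply: (IH n.+1 (fun z => f n (A z)) (fun z => f n (B z)));
  [apply: vhol_comp hA _; exact/fhol/in_rho|apply: vhol_comp hB _; exact/fhol/in_rho|exact: fdom|exact: fdom].
Qed.

(** The cohomological equation is solved for pairs of points with the same first
    coordinates: on such pairs [beta_W] makes the first term of the series
    quadratic, and [Q_step] makes the series converge.  The solution is additive
    over triples of points, so that its values at the pairs (z, trunc j z) form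
    a coordinate change. *)
Lemma fibre_linearization : exists phi : nat -> V -> C, exists2 Kp : R, 0 <= Kp & [/\
  forall n z, nv z < rho / 192 -> hol (phi n) z,
  forall n z, nv z < rho / 192 -> nc (phi n z) <= Kp * (sg * theta) ^+ n * nv z ^+ 2 &
  forall n z, nv z < rho / 192 -> f n z 0 j + phi n.+1 (f n z) =
    lam n j * (z 0 j + phi n z) +
    (f n (trunc j z) 0 j + phi n.+1 (f n (trunc j z)))].
Proof.
rewrite -/rho1.
have [Phi [PhiE PhiW PhiS]] := cohomological dom_G lam0 q0 q1 W_G beta_W.
have q2 : 0 < 1 - sg * theta by have := q1; lra.
pose Kp := KW * (d%:R * d%:R * (Kv * 2)) / (1 - sg * theta).
have Kv0 : 0 <= Kv by have := Kvth 0; rewrite expr0 mulr1.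
have Kp0 : 0 <= Kp.
  apply: divr_ge0; last exact: ltW.
  by apply: mulr_ge0 KW0 _; rewrite !mulr_ge0.
have tr (z : V) : nv z < rho1 -> nv (trunc j z) < rho1.
  by apply: le_lt_trans; exact: nv_trunc.
have dtr z : nv z < rho1 -> dom (z, trunc j z).
  by move=> zr; split => //=; [exact: tr|exact: agree_trunc].
have Wle n z : W n (z, trunc j z) / (1 - sg * theta) <= Kp * (sg * theta) ^+ n * nv z ^+ 2.
  have -> : Kp * (sg * theta) ^+ n * nv z ^+ 2 = KW * sg ^+ n *
    (d%:R * d%:R * (Kv * theta ^+ n * (nv z * (2 * nv z)))) / (1 - sg * theta).
    by rewrite /Kp exprMn; ring.
  apply: ler_wpM2r; first by rewrite invr_ge0 ltW.
  apply: ler_wpM2l; first by apply: mulr_ge0 KW0 _; apply: exprn_ge0; exact: ltW.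
  apply: le_trans (Q_upper n z _) _; apply: ler_wpM2l; first by rewrite mulr_ge0.
  apply: ler_wpM2l; first exact: Kvth.
  apply: ler_pM; rewrite ?addr_ge0 ?nv_ge0 ?nvB_trunc //=.
  by have := nv_trunc j z; lra.
have add n z w x : dom (z, w) -> dom (w, x) -> Phi n (z, x) = Phi n (z, w) + Phi n (w, x).
  move=> d1 d2; have d3 : dom (z, x).
    have [a1 a2 a3] := d1; have [b1 b2 b3] := d2; split => //= k kj.
    by rewrite a3 // b3.
  apply/eqP; rewrite -subr_eq0 -nc_eq0 eq_le nc_ge0 andbT.
  apply: le_of_eps => e e0; rewrite add0r.
  pose c p := W n p / (1 - sg * theta).
  have [L /(_ L (leqnn L)) hL] := vanishing_geo (c (z, x) + c (z, w) + c (w, x)) q0 q1 e0.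
  have h1 := PhiS n _ d1 L; have h2 := PhiS n _ d2 L; have h3 := PhiS n _ d3 L.
  apply: le_trans hL; rewrite !mulrDl.
  pose S := cohom_sum G beta (fun n => lam n j) L n.
  have -> : Phi n (z, x) - (Phi n (z, w) + Phi n (w, x)) = (Phi n (z, x) - S (z, x)) -
     (Phi n (z, w) - S (z, w)) - (Phi n (w, x) - S (w, x)).
    by rewrite /S (sum_add L n z w x); ring.
  by apply: le_trans (ncB _ _) _; apply: lerD => //; apply: le_trans (ncB _ _) _; apply: lerD.
exists (fun n z => Phi n (z, trunc j z)), Kp => //; split => n z zr.
- apply: (@hol_limit _ _ _ _ (rho1 - nv z)); first by lra.
  have dz u : nv u < rho1 - nv z -> nv (z + u) < rho1.
    by move=> ur; apply: le_lt_trans (nvD _ _) _; lra.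
  move=> e e0; have [L /(_ L (leqnn L)) hL] :=
    vanishing_geo (Kp * (sg * theta) ^+ n * rho1 ^+ 2) q0 q1 e0.
  exists (fun x => cohom_sum G beta (fun n => lam n j) L n (x, trunc j x)); split=> u /dz ur.
    by apply: sum_hol => //; [exact: vhol_id|exact: vhol_trunc|exact: tr].
  rewrite ncBC; apply: le_trans (PhiS n _ (dtr _ ur) L) _; apply: le_trans hL.
  apply: ler_wpM2r; first exact: exprn_ge0.
  apply: le_trans (Wle n _) _; apply: ler_wpM2l.
    by apply: mulr_ge0 Kp0 _; exact: exprn_ge0.
  by rewrite lerXn2r ?nnegrE ?nv_ge0 // ltW //; apply: le_lt_trans ur; exact: nv_ge0.
- exact: le_trans (PhiW n _ (dtr _ zr)) (Wle n z).
have E := PhiE n _ (dtr _ zr); rewrite /beta /G /b /= in E.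
have tj : trunc j z 0 j = 0 by rewrite mxE ltnn.
rewrite tj mulr0 subr0 in E.
have ft := fdom n (tr _ zr).
have tt : trunc j (f n z) = trunc j (f n (trunc j z)).
  apply: eq_trunc; apply: fagree; [exact: in_rho|exact/in_rho/tr|exact: agree_trunc].
rewrite mulrDr E (add n.+1 (f n z) (f n (trunc j z)) (trunc j (f n z))).
- by rewrite tt; ring.
- exact: dom_G (dtr _ zr).
- by rewrite tt; exact: dtr.
Qed.

End Phi.

(** * Triangular form of one component *)

Lemma leq_sum3 a b c n :
  [/\ a <= a + b + c + n, b <= a + b + c + n & c <= a + b + c + n]%N.
Proof. by split; lia. Qed.

Section TriangularForm.
Context {R : realType} {d : nat}.
Local Notation C := R[i].
Local Notation V := 'rV[C]_d.
Implicit Types (lam : nat -> 'I_d -> C) (f : nat -> V -> V).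

Definition tailseq {T : Type} n0 (u : nat -> T) n := u (n0 + n)%N.

(** The last condition is the bunching condition as it survives the rescaling of
    coordinates: the decay in l has been spent, the slow growth in n remains. *)
Record tame lam (nu Lam : R) : Prop := Tame {
  tame_nu : 0 < nu;
  tame_Lam : Lam < 1;
  tame_ge : forall n i, nu <= nc (lam n i);
  tame_le : forall n i, nc (lam n i) <= Lam;
  tame_bunch : forall theta, 1 < theta -> exists K, forall n l (j h k : 'I_d),
    (j <= k)%N -> \prod_(t < l)
      (nc (lam (n + t)%N h) * nc (lam (n + t)%N k) / nc (lam (n + t)%N j)) <=
      K * theta ^+ n }.

(** The terms T of a triangular normal form.  The last condition is uniform in
    n; orbits of the normal form tend to 0 because of it. *)
Definition entire_below (i : nat) (T : nat -> V -> C) :=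
  [/\ forall n z, hol (T n) z, forall n z w, agree i z w -> T n z = T n w &
      forall r : R, exists KT, forall n z, nv z <= r -> nc (T n z) <= KT * nv z].

(** The situation after j steps of the reduction.  The deviation from the
    diagonal maps diag (lam n) decreases like sg ^ n on a fixed ball. *)
Record triform (j : nat) lam f (rho K sg : R) : Prop := Triform {
  tri_rho0 : 0 < rho;
  tri_rho1 : rho <= 1;
  tri_K : 0 <= K;
  tri_sg0 : 0 < sg;
  tri_sg1 : sg < 1;
  tri_hol : forall n z, nv z < rho -> vhol (f n) z;
  tri_near : forall n z i, nv z < rho ->
    nc (f n z 0 i - lam n i * z 0 i) <= K * sg ^+ n * nv z;
  tri_low : forall n (i : 'I_d), exists D, [/\ sd (fun z => f n z 0 i) 0 D,
    D i = lam n i & forall k : 'I_d, (i < k)%N -> D k = 0];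
  tri_comp : forall i : 'I_d, (i < j)%N -> exists2 T, entire_below i T &
    forall n z, nv z < rho -> f n z 0 i = lam n i * z 0 i + T n z }.

Lemma tame_shift lam nu Lam n0 : tame lam nu Lam -> tame (tailseq n0 lam) nu Lam.
Proof.
case=> h1 h2 h3 h4 h5; split => // [n i|n i|theta /h5[K hK]]; rewrite /tailseq //.
exists (K * theta ^+ n0) => n l j h k jk; rewrite -mulrA -exprD.
by apply: le_trans (hK (n0 + n)%N l j h k jk); under eq_bigr do rewrite addnA.
Qed.

Lemma entire_below_shift i T n0 : entire_below i T -> entire_below i (tailseq n0 T).
Proof.
move=> [h1 h2 h3]; split=> [n z|n z w|r]; [exact: h1|exact: h2|].
by have [KT h] := h3 r; exists KT => n; exact: h.
Qed.

Lemma triform_shift j lam f rho K sg n0 : triform j lam f rho K sg ->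
  triform j (tailseq n0 lam) (tailseq n0 f) rho (K * sg ^+ n0) sg.
Proof.
case=> h1 h2 h3 h4 h5 h6 h7 h8 h9.
split=> [//|//||//|//|n|n z i zr|n|i /h9[T hT fT]]; [|exact: h6| |exact: h8|].
- by apply: mulr_ge0 => //; apply: exprn_ge0; exact: ltW.
- by rewrite -[K * _ * _]mulrA -exprD; exact: h7.
- exists (tailseq n0 T); first exact: entire_below_shift.
  by move=> n; exact: fT.
Qed.

Lemma triform_norm j lam nu Lam f rho K sg n z : tame lam nu Lam ->
  triform j lam f rho K sg -> nv z < rho -> nv (f n z) <= (Lam + K * sg ^+ n) * nv z.
Proof.
move=> [_ _ _ lam_le _] [_ _ K0 sg0 _ _ fnear _ _] zr.
have h0 : 0 <= K * sg ^+ n by apply: mulr_ge0 => //; apply: exprn_ge0; exact: ltW.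
have [z0|z0] := eqVneq z 0.
  have b i : nc (f n z 0 i) <= 0.
    by have := fnear n z i zr; rewrite z0 mxE mulr0 subr0 nv0 mulr0.
  by rewrite [X in _ * nv X]z0 nv0 mulr0; apply: nv_le.
have zp : 0 < nv z by rewrite nv_gt0.
have [i0 _] : exists i : 'I_d, True.
  apply: contrapT => no; move: zp; apply/negP; rewrite -leNgt; apply: nv_le => // i.
  by case: no; exists i.
have Lam0 : 0 <= Lam by apply: le_trans (lam_le 0%N i0); exact: nc_ge0.
apply: nv_le => [|i]; first by rewrite mulr_ge0 ?nv_ge0 ?addr_ge0.
rewrite -[f n z 0 i](subrK (lam n i * z 0 i)); apply: le_trans (ncD _ _) _.
rewrite addrC mulrDl; apply: lerD; last exact: fnear.
by rewrite ncM; apply: ler_pM; rewrite ?nc_ge0 ?nc_le_nv.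
Qed.

(** The supremum of the forward products is a Lyapunov function for the scalar
    cocycle |lam h| |lam k| / |lam j|. *)
Lemma bunching_weights lam nu Lam (j : 'I_d) theta : tame lam nu Lam -> 1 < theta ->
  exists (v : nat -> 'I_d -> 'I_d -> R) (Kv : R), forall n h (k : 'I_d), (j <= k)%N ->
    [/\ 1 <= v n h k, v n h k <= Kv * theta ^+ n &
      v n.+1 h k * (nc (lam n h) * nc (lam n k)) <= nc (lam n j) * v n h k].
Proof.
case=> nu0 _ lge _ hb th1; have [K hK] := hb theta th1.
pose p n l h k : R := \prod_(t < l)
  (nc (lam (n + t)%N h) * nc (lam (n + t)%N k) / nc (lam (n + t)%N j)).
pose S n h k := range (fun l => p n l h k).
exists (fun n h k => sup (S n h k)), K => n h k jk.
have ub m : has_ubound (S m h k).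
  by exists (K * theta ^+ m) => _ [l _ <-]; exact: hK.
have lj : 0 < nc (lam n j) by apply: lt_le_trans (lge n j).
split.
- by apply: ub_le_sup => //; exists 0%N => //; rewrite /p big_ord0.
- by apply: ge_sup; [exists (p n 0%N h k), 0%N|move=> _ [l _ <-]; exact: hK].
have [l0|lp] := eqVneq (nc (lam n h) * nc (lam n k)) 0.
  rewrite l0 mulr0 mulr_ge0 ?nc_ge0 //.
  by apply: (@le_trans _ _ (p n 0%N h k));
    [rewrite /p big_ord0|apply: ub_le_sup => //; exists 0%N].
have {}lp : 0 < nc (lam n h) * nc (lam n k) by rewrite lt_def lp mulr_ge0 ?nc_ge0.
rewrite -ler_pdivlMr //; apply: ge_sup; first by exists (p n.+1 0%N h k), 0%N.
move=> _ [l _ <-]; rewrite ler_pdivlMr // [leRHS]mulrC -ler_pdivrMr // -mulrA.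
have -> : p n.+1 l h k * (nc (lam n h) * nc (lam n k) / nc (lam n j)) = p n l.+1 h k.
  rewrite /p big_ord_recl addn0 mulrC; congr (_ * _).
  by apply: eq_bigr => t _; rewrite /bump /= addSnnS.
by apply: ub_le_sup => //; exists l.+1.
Qed.

(** The equation to be solved by the change of coordinate z_j + chi_n (z): it
    removes everything from the j-th component but the multiplier and an entire
    function of the previous coordinates.  Here chi = phi + psi, where phi comes
    from [fibre_linearization] and psi removes the difference between the
    remaining function of the first coordinates and its Taylor polynomial, of
    an order N so large that the factor Lam1 ^ N, by which f multiplies functions
    of order |z| ^ N, is at most nu <= |lam j|. *)
Lemma solve_component (j : 'I_d) lam nu Lam f rho K sg :
  tame lam nu Lam -> triform j lam f rho K sg ->
  exists (n0 : nat) (chi T : nat -> V -> C) (r Kc q : R),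
    [/\ 0 < r <= rho, 0 <= Kc, sg <= q < 1,
      [/\ forall n z, hol (T n) z, forall n z w, agree j z w -> T n z = T n w &
        forall r0 : R, exists2 KT, 0 <= KT & forall n z, nv z <= r0 ->
          nc (T n z) <= KT * q ^+ n * nv z] &
      [/\ forall n z, nv z < r -> nv (f (n0 + n)%N z) <= nv z,
        forall n z, nv z < r -> hol (chi n) z,
        forall n z, nv z < r -> nc (chi n z) <= Kc * q ^+ n * nv z ^+ 2 &
        forall n z, nv z < r -> f (n0 + n)%N z 0 j + chi n.+1 (f (n0 + n)%N z) =
          lam (n0 + n)%N j * (z 0 j + chi n z) + T n z]].
Proof.
move=> htame htri.
have [nu0 Lam1' lam_ge lam_le _] := htame.
have [rho0 rho1 K0 sg0 sg1 _ _ _ _] := htri.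
(* Then sg * theta lies halfway between sg and 1. *)
pose theta : R := (1 + sg^-1) / 2; pose q := sg * theta.
have sgi : 1 < sg^-1 by rewrite invf_gt1.
have th1 : 1 < theta by rewrite /theta; lra.
have qE : q = (sg + 1) / 2 by rewrite /q /theta; field; rewrite gt_eqF.
have q1 : q < 1 by lra.
have sgq : sg <= q by lra.
have q0 : 0 < q by lra.
have [v [Kv hv]] := bunching_weights j htame th1.
pose Lam1 := (1 + Lam) / 2.
have Lam11 : Lam1 < 1 by rewrite /Lam1; lra.
have Lam0 : 0 < Lam by have := lam_ge 0%N j; have := lam_le 0%N j; lra.
have Lam10 : 0 < Lam1 by rewrite /Lam1; lra.
have [n1 hn1] := vanishing_geo (180 * K) (ltW sg0) sg1 ltr01.
have [|n2 hn2] := vanishing_geo K (ltW sg0) sg1 (e := (1 - Lam) / 2); first by lra.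
have [|n3 hn3] := vanishing_geo (d%:R * d%:R * (Kv * theta) * (3 * (180 * K)))
   (ltW q0) q1 (e := nu * (theta - 1)); first by rewrite mulr_gt0 // subr_gt0.
(* From time n0 on, K * sg ^ n is as small as [fibre_linearization] requires. *)
pose n0 := (n1 + n2 + n3)%N.
have n0P n := leq_sum3 n1 n2 n3 n; rewrite -/n0 in n0P.
pose F := tailseq n0 f; pose la := tailseq n0 lam; pose K1 := K * sg ^+ n0.
have [_ _ K10 _ _ Fhol Fnear Flow Fcomp] := triform_shift n0 htri.
rewrite -/F -/la -/K1 in K10 Fhol Fnear Flow Fcomp.
have [_ _ la_ge la_le _] := tame_shift n0 htame; rewrite -/la in la_ge la_le.
have sge n : (0 : R) <= sg ^+ n by apply: exprn_ge0; exact: ltW.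
have qe n : 0 <= q ^+ n by apply: exprn_ge0; exact: ltW.
have sgqn n : sg ^+ n <= q ^+ n by apply: lerXn2r => //; rewrite nnegrE ltW.
have FL n z : nv z < rho -> nv (F n z) <= Lam1 * nv z.
  move=> zr; have -> : Lam1 = Lam + (1 - Lam) / 2 by rewrite /Lam1; lra.
  apply: le_trans (triform_norm n (tame_shift n0 htame) (triform_shift n0 htri) zr) _.
  apply: ler_wpM2r; first exact: nv_ge0.
  by rewrite lerD2l -mulrA -exprD; apply: hn2; have [] := n0P n.
have Fc n z : nv z < rho -> nv (F n z) <= nv z.
  move=> /FL h; apply: le_trans (h n) _; rewrite ler_piMl ?nv_ge0 //; exact: ltW.
have Fagree n z w : nv z < rho -> nv w < rho -> agree j z w -> agree j (F n z) (F n w).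
  move=> zr wr zw k kj; have [T [_ Tag _] FT] := Fcomp k kj.
  rewrite !FT // zw //; congr (_ + _); apply: Tag => i ik; apply: zw.
  exact: ltn_trans ik kj.
have la1 n i : nc (la n i) <= 1 by apply: le_trans (la_le n i) _; exact: ltW.
have [phi [Kp Kp0 [phi_hol phi_le phi_eq]]] : exists phi : nat -> V -> C,
   exists2 Kp : R, 0 <= Kp & [/\
  forall n z, nv z < rho / 192 -> hol (phi n) z,
  forall n z, nv z < rho / 192 -> nc (phi n z) <= Kp * (sg * theta) ^+ n * nv z ^+ 2 &
  forall n z, nv z < rho / 192 -> F n z 0 j + phi n.+1 (F n z) =
    la n j * (z 0 j + phi n z) +
    (F n (trunc j z) 0 j + phi n.+1 (F n (trunc j z)))].
  apply: (@fibre_linearization R d F la j rho K1 sg nu theta (Kv * theta ^+ n0)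
    (tailseq n0 v)) => //.
  - by move=> n h k jk; have [] := hv (n0 + n)%N h k jk.
  - by move=> n h k jk; rewrite -mulrA -exprD; have [] := hv (n0 + n)%N h k jk.
  - by move=> n h k jk; have [_ _] := hv (n0 + n)%N h k jk; rewrite /tailseq addnS.
  - move=> n; rewrite /K1 -mulrA -exprD mulrA; apply: hn1; by have [] := n0P n.
  - move=> n; rewrite /K1.
    have -> : d%:R * d%:R * (Kv * theta ^+ n0 * theta ^+ n.+1) *
       (3 * (180 * (K * sg ^+ n0 * sg ^+ n))) =
       d%:R * d%:R * (Kv * theta) * (3 * (180 * K)) * q ^+ (n0 + n).
      have qM m : q ^+ m = sg ^+ m * theta ^+ m by rewrite -exprMn.
      by rewrite (exprD q n0 n) !qM (exprS theta n); ring.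
    by apply: hn3; have [] := n0P n.
rewrite -/q in phi_le.
pose r1 := rho / 192.
have r10 : 0 < r1 by rewrite divr_gt0.
have r1r : r1 < rho by rewrite /r1; lra.
have tr (z : V) s : nv z < s -> nv (trunc j z) < s by apply: le_lt_trans; exact: nv_trunc.
pose a n (z : V) := F n (trunc j z) 0 j + phi n.+1 (F n (trunc j z)).
have Fr1 n z : nv z < r1 -> nv (F n z) < r1.
  by move=> zr; apply: (le_lt_trans (Fc n z _) zr); exact: lt_trans zr r1r.
have a_hol n z : nv z < r1 -> hol (a n) z.
  move=> /tr zr; have h : vhol (fun x => F n (trunc j x)) z.
    by apply: (vhol_comp (G := F n) (vhol_trunc j z)); apply: Fhol; exact: lt_trans zr r1r.
  by apply: holD; [exact: h|apply: (hol_comp h); apply: phi_hol; exact: Fr1].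
pose Ka := K1 + Kp.
have Ka0 : 0 <= Ka by exact: addr_ge0.
have a_le n z : nv z < r1 -> nc (a n z) <= Ka * q ^+ n * nv z.
  move=> zr; have tz := tr _ _ zr; have tz' := lt_trans tz r1r.
  have z1 : nv z <= 1 by lra.
  rewrite /a /Ka mulrDl mulrDl; apply: le_trans (ncD _ _) _; apply: lerD.
    have := Fnear n (trunc j z) j tz'; rewrite [trunc j z 0 j]mxE ltnn mulr0 subr0.
    move=> h; apply: le_trans h _; apply: ler_pM; rewrite ?nv_ge0 ?nv_trunc //.
      exact: mulr_ge0.
    by apply: ler_wpM2l.
  apply: le_trans (phi_le _ _ (Fr1 n _ tz)) _.
  have h : nv (F n (trunc j z)) <= nv z by apply: le_trans (Fc n _ tz') (nv_trunc _ _).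
  apply: ler_pM; rewrite ?exprn_ge0 ?nv_ge0 //; first exact: mulr_ge0.
    by apply: ler_wpM2l => //; rewrite exprS ler_piMl // ltW.
  rewrite expr2 -[leRHS]mulr1; apply: ler_pM; rewrite ?nv_ge0 //.
  exact: le_trans h z1.
have [N0 hN0] := exp_small (ltW Lam10) Lam11 nu0.
(* The summand 2 makes psi vanish to second order, like phi. *)
pose N := (N0 + 2)%N.
have LamN : Lam1 ^+ N <= nu by apply/ltW/hN0; exact: leq_addr.
have [KT KT0 hKT] := @taylor_entire R d N r1 r10.
have aM n z : nv z < r1 -> nc (a n z) <= Ka * q ^+ n.
  move=> zr; apply: le_trans (a_le n z zr) _; rewrite ler_piMr ?mulr_ge0 //; lra.
have /choice[T0 hT0] : forall n, exists T0 : V -> C, [/\ forall z, hol T0 z,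
      forall z, nc (T0 z) <= KT * (Ka * q ^+ n) * (1 + nv z) ^+ N &
      forall z, nv z < r1 / 4 ^+ N -> nc (a n z - T0 z) <= KT * (Ka * q ^+ n) * nv z ^+ N].
  by move=> n; apply: hKT; [exact: a_hol|exact: aM].
pose T n (z : V) := T0 n (trunc j z).
pose r := r1 / 4 ^+ N.
have pN : (1 : R) <= 4 ^+ N by rewrite exprn_ege1 //; lra.
have r0 : 0 < r by rewrite divr_gt0 //; lra.
have rr1 : r <= r1 by rewrite ler_pdivrMr; [rewrite ler_peMr // ltW|lra].
have rrho : r <= rho by lra.
have ttr (z : V) : trunc j (trunc j z) = trunc j z.
  by apply/rowP => k; rewrite !mxE; case: ifP => // ->.
have aT n z : nv z < r -> nc (a n z - T n z) <= KT * (Ka * q ^+ n) * nv z ^+ N.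
  move=> zr; have [_ _ h] := hT0 n.
  have -> : a n z = a n (trunc j z) by rewrite /a ttr.
  apply: le_trans (h _ (tr _ _ zr)) _; apply: ler_wpM2l.
    by rewrite !mulr_ge0.
  by apply: lerXn2r; rewrite ?nnegrE ?nv_ge0 ?nv_trunc.
have a0 n : a n 0 = 0.
  apply/eqP; rewrite -nc_eq0 eq_le nc_ge0 andbT.
  by have := a_le n 0; rewrite nv0 mulr0; exact.
have t0 : trunc j (0 : V) = 0 by apply/rowP => k; rewrite !mxE; case: ifP.
have T00 n : T n 0 = 0.
  apply/eqP; rewrite -nc_eq0 eq_le nc_ge0 andbT.
  have := aT n 0; rewrite nv0 a0 sub0r ncN => /(_ r0) h; apply: le_trans h _.
  by rewrite /N addn2 exprS mul0r mulr0.
pose cW := KT * Ka / nu.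
have cW0 : 0 <= cW by apply: divr_ge0; [exact: mulr_ge0|exact: ltW].
pose W n (z : V) := cW * q ^+ n * nv z ^+ N.
pose dom : set V := [set z | nv z < r].
have dF n z : dom z -> dom (F n z).
  by move=> zr; apply: (le_lt_trans (Fc n z _) zr); apply: lt_le_trans zr rrho.
have W_F n z : dom z -> W n.+1 (F n z) <= q * nc (la n j) * W n z.
  move=> zr; rewrite /W exprS.
  have -> : q * nc (la n j) * (cW * q ^+ n * nv z ^+ N) =
    cW * (q * q ^+ n) * (nc (la n j) * nv z ^+ N) by ring.
  apply: ler_wpM2l; first by apply: mulr_ge0 => //; apply: mulr_ge0 => //; exact: ltW.
  apply: (@le_trans _ _ ((Lam1 * nv z) ^+ N)).
    apply: lerXn2r; rewrite ?nnegrE ?nv_ge0 //; last by apply: FL; apply: lt_le_trans zr rrho.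
    by rewrite mulr_ge0 ?nv_ge0 // ltW.
  rewrite exprMn; apply: ler_wpM2r; first by rewrite exprn_ge0 // nv_ge0.
  exact: le_trans LamN (la_ge n j).
have beta_W n z : dom z -> nc (a n z - T n z) <= nc (la n j) * W n z.
  move=> zr; apply: le_trans (aT n z zr) _.
  apply: (@le_trans _ _ (nu * W n z)).
    have -> : nu * W n z = KT * (Ka * q ^+ n) * nv z ^+ N.
      by rewrite /W /cW; field; rewrite gt_eqF.
    exact: lexx.
  apply: ler_wpM2r (la_ge n j); rewrite /W; apply: mulr_ge0; first exact: mulr_ge0.
  by rewrite exprn_ge0 // nv_ge0.
have la0 n : la n j != 0 by rewrite -nc_gt0; apply: lt_le_trans (la_ge n j).
have [psi [psi_eq psi_le psi_S]] := cohomological dF la0 (ltW q0) q1 W_F beta_W.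
have T_hol n z : hol (T n) z.
  by apply: (hol_comp (a := T0 n) (vhol_trunc j z)); have [] := hT0 n.
have S_hol L n (A : V -> V) p : vhol A p -> nv (A p) < r ->
    hol (fun z => cohom_sum F (fun n z => a n z - T n z) (fun n => la n j) L n (A z)) p.
  elim: L n A => [|L IH] n A hA Ar; first exact: hol_const.
  rewrite /=; apply: holM; last exact: hol_const.
  apply: holD; first by apply: (hol_comp (a := fun z => a n z - T n z) hA); apply: holB => //; apply: a_hol; lra.
  apply: (IH n.+1 (fun z => F n (A z))); last exact: dF.
  by apply: (vhol_comp (G := F n) hA); apply: Fhol; lra.
have q2 : 0 < 1 - q by lra.
have psi_hol n z : nv z < r -> hol (psi n) z.
  move=> zr; apply: (@hol_limit _ _ _ _ (r - nv z)); first by lra.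
  have dz u : nv u < r - nv z -> nv (z + u) < r.
    by move=> ur; apply: le_lt_trans (nvD _ _) _; lra.
  move=> e e0; have [L /(_ L (leqnn L)) hL] :=
    vanishing_geo (cW * q ^+ n * r ^+ N / (1 - q)) (ltW q0) q1 e0.
  exists (fun x => cohom_sum F (fun n z => a n z - T n z) (fun n => la n j) L n x).
  split=> u /dz ur; first by apply: S_hol => //; exact: vhol_id.
  rewrite ncBC; apply: le_trans (psi_S n _ ur L) _; apply: le_trans hL.
  apply: ler_wpM2r; first exact: qe.
  apply: ler_wpM2r; first by rewrite invr_ge0 ltW.
  apply: ler_wpM2l; first exact: mulr_ge0.
  by apply: lerXn2r; rewrite ?nnegrE ?nv_ge0 // ltW.
exists n0, (fun n z => phi n z + psi n z), T, r, (Kp + cW / (1 - q)), q.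
split.
- by rewrite r0.
- by rewrite addr_ge0 // divr_ge0 // ltW.
- by rewrite sgq.
- split=> [n z|n z w zw|s]; [exact: T_hol|by rewrite /T (eq_trunc zw)|].
  pose S : R := 2 * (`|s| + 1).
  have S0 : 0 < S by rewrite mulr_gt0 // ltr_wpDl.
  exists (180 * (KT * Ka * (1 + S) ^+ N) / S).
    apply: divr_ge0; last exact: ltW.
    apply: mulr_ge0; first exact: ler0n.
    by apply: mulr_ge0; [exact: mulr_ge0|apply: exprn_ge0; lra].
  move=> n z zs; have sS : nv z < S / 2.
    by rewrite /S; have := ler_norm s; lra.
  have := @cauchy_lipschitz R d (T n) S (KT * (Ka * q ^+ n) * (1 + S) ^+ N) z 0 S0.
  rewrite T00 !subr0 nv0 => h.
  have -> : 180 * (KT * Ka * (1 + S) ^+ N) / S * q ^+ n * nv z =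
    180 * (KT * (Ka * q ^+ n) * (1 + S) ^+ N) * nv z / S by ring.
  apply: h => //; last by rewrite divr_gt0.
  move=> u us; have [_ h _] := hT0 n; apply: le_trans (h _) _.
  apply: ler_wpM2l; first by rewrite !mulr_ge0.
  apply: lerXn2r; rewrite ?nnegrE; first by have := nv_ge0 (trunc j u); lra.
    lra.
  by have := nv_trunc j u; lra.
split=> n z zr.
- by apply: Fc; lra.
- by apply: holD; [apply: phi_hol; rewrite -/r1; lra|exact: psi_hol].
- apply: le_trans (ncD _ _) _; rewrite !mulrDl; apply: lerD.
    by apply: phi_le; rewrite -/r1; lra.
  apply: le_trans (psi_le n z zr) _; rewrite /W.
  have -> : cW * q ^+ n * nv z ^+ N / (1 - q) = cW / (1 - q) * q ^+ n * nv z ^+ N by ring.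
  apply: ler_wpM2l; first by apply: mulr_ge0 => //; apply: divr_ge0 => //; exact: ltW.
  rewrite /N exprD ler_piMl ?exprn_ge0 ?nv_ge0 //.
  by apply: exprn_ile1; [exact: nv_ge0|lra].
rewrite -/(tailseq n0 f n) -/F -/(F n) -/(tailseq n0 lam n) -/la.
have zr1 : nv z < rho / 192 by rewrite -/r1; lra.
have := phi_eq n z zr1; rewrite -/(a n z) => e1.
have := psi_eq n z zr => e2.
have -> : la n j * (z 0 j + (phi n z + psi n z)) + T n z =
  la n j * (z 0 j + phi n z) + la n j * psi n z + T n z by ring.
rewrite e2 addrA e1; ring.
Qed.

End TriangularForm.

(** * One step of the reduction *)

Section NormalForm.
Context {R : realType} {d : nat}.
Local Notation C := R[i].
Local Notation V := 'rV[C]_d.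
Implicit Types (lam : nat -> 'I_d -> C) (f h k : nat -> V -> V).

(** Changes of coordinates h n, with inverses k n.  The radius r and the bound A
    on the distortion do not depend on n, so that conjugations can be
    composed. *)
Record conjugates f f' h k (r r' A : R) : Prop := Conjugates {
  conj_r0 : 0 < r;
  conj_A1 : 1 <= A;
  conj_lbih : forall n, lbih [set z : V | nv z < r] (h n) (k n);
  conj_h : forall n z, nv z < r -> nv (h n z) < r' /\ nv (h n z) <= A * nv z;
  conj_f : forall n z, nv z < r -> h n.+1 (f n z) = f' n (h n z);
  conj_k : forall n w, nv w < r / A ->
    [/\ nv (k n w) < r, h n (k n w) = w & nv (k n w) <= A * nv w] }.

Lemma entire_below_sd (i : nat) (T : V -> C) (D : 'I_d -> C) : sd T 0 D ->
  (forall z w, agree i z w -> T z = T w) -> forall k : 'I_d, (i <= k)%N -> D k = 0.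
Proof.
move=> hD hT k ik; apply/eqP; rewrite -nc_eq0 eq_le nc_ge0 andbT.
apply: le_of_eps => e e0; rewrite add0r; have [dl dl0 h] := hD e e0.
pose t : R := dl / 2; have t0 : 0 < t by rewrite divr_gt0.
have nt : nv (t%:C *: delta_mx 0 k : V) = t by rewrite nv_delta nc_real gtr0_norm.
have := h (t%:C *: delta_mx 0 k); rewrite nt add0r => /(_ _)H.
have {H} := H ltac:(rewrite /t; lra).
rewrite (hT (t%:C *: delta_mx 0 k) 0); last first.
  move=> l li; rewrite !mxE eqxx /= (_ : (l == k) = false) ?mulr0 //.
  by apply/negbTE; rewrite -val_eqE neq_ltn (leq_trans li ik).
by rewrite subrr sub0r ncN linZr lin_delta ncM nc_real gtr0_norm // mulrC ler_pM2r.
Qed.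

(** The coordinate change z + chi_n (z) e_j given by [solve_component] brings the
    j-th component into triangular form; the previous components keep theirs,
    because it leaves the coordinates on which they depend unchanged. *)
Lemma triangular_step (j : 'I_d) lam nu Lam f rho K sg :
  tame lam nu Lam -> triform j lam f rho K sg ->
  exists n0 f' h k r rho' K' q, triform j.+1 (tailseq n0 lam) f' rho' K' q /\
    conjugates (tailseq n0 f) f' h k r rho' 2.
Proof.
move=> htame htri.
have [m0 [chi [T [r [Kc [q [/andP[r0 rrho] Kc0 /andP[sgq q1] [T_hol T_agree T_le] [fc chi_hol chi_le chi_eq]]]]]]]] :=
  solve_component htame htri.
have [rho0 rho1 K0 sg0 sg1 _ _ _ _] := htri.
have q0 : 0 < q by apply: lt_le_trans sgq.
have qe n : 0 <= q ^+ n by apply: exprn_ge0; exact: ltW.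
have qe1 n : q ^+ n <= 1 by apply: exprn_ile1; exact: ltW.
have r1 : r <= 1 by lra.
pose c := 180 * Kc / r.
have [|m1 hm1] := vanishing_geo c (ltW q0) q1 (e := 2^-1); first by lra.
pose n0 := (m0 + m1)%N; exists n0.
pose F := tailseq n0 f; pose la := tailseq n0 lam; pose K1 := K * sg ^+ n0.
have [_ _ K10 _ _ Fhol Fnear Flow Fcomp] := triform_shift n0 htri.
rewrite -/F -/la -/K1 in K10 Fhol Fnear Flow Fcomp.
pose ch n := chi (m1 + n)%N.
have Fc n z : nv z < r -> nv (F n z) <= nv z.
  by move=> zr; have := fc (m1 + n)%N z zr; rewrite addnA.
have ch_eq n z : nv z < r -> F n z 0 j + ch n.+1 (F n z) =
    la n j * (z 0 j + ch n z) + T (m1 + n)%N z.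
  by move=> zr; have := chi_eq (m1 + n)%N z zr; rewrite addnA /ch addnS.
have ch_sq n z : nv z < r -> nc (ch n z) <= Kc * nv z ^+ 2.
  move=> zr; apply: le_trans (chi_le _ z zr) _; rewrite -mulrA; apply: ler_wpM2l => //.
  by rewrite ler_piMl // exprn_ge0 // nv_ge0.
have ch0 n : ch n 0 = 0.
  apply/eqP; rewrite -nc_eq0 eq_le nc_ge0 andbT.
  by have := ch_sq n 0; rewrite nv0 expr2 !mulr0; exact.
have ch_lip n z w : nv z < r / 2 -> nv w < r / 2 -> nc (ch n z - ch n w) <= nv (z - w) / 2.
  move=> zr wr; have := @cauchy_lipschitz R d (ch n) r (Kc * q ^+ (m1 + n)) z w r0.
  move=> h; apply: le_trans (h _ _ zr wr) _.
  - by move=> u ur; exact: chi_hol.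
  - move=> u ur; apply: le_trans (chi_le _ u ur) _; rewrite ler_piMr ?mulr_ge0 //.
    by apply: exprn_ile1; [exact: nv_ge0|lra].
  have -> : 180 * (Kc * q ^+ (m1 + n)) * nv (z - w) / r = c * q ^+ (m1 + n) * nv (z - w).
    by rewrite /c; ring.
  rewrite [leRHS]mulrC; apply: ler_wpM2r; first exact: nv_ge0.
  by apply: hm1; exact: leq_addr.
pose X n (z : V) : V := ch n z *: delta_mx 0 j.
have Xi n z i : X n z 0 i = ch n z * (i == j)%:R by rewrite !mxE eqxx.
have X0 n : X n 0 = 0 by rewrite /X ch0 scale0r.
have X_hol n z : nv z < r / 2 -> vhol (X n) z.
  move=> zr i; have -> : (fun x => X n x 0 i) = (fun x => ch n x * (i == j)%:R).
    by apply/funext => x; rewrite Xi.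
  by apply: holM; [apply: chi_hol; lra|exact: hol_const].
have X_lip n z w : nv z < r / 2 -> nv w < r / 2 -> nv (X n z - X n w) <= nv (z - w) / 2.
  by move=> zr wr; rewrite -scalerBl nv_delta; exact: ch_lip.
have r2 : 0 < r / 2 by rewrite divr_gt0.
pose h n (z : V) := z + X n z; pose k n := linverse (X n) (r / 2).
have hk n : lbih [set z : V | nv z < r / 2] (h n) (k n).
  exact: (lbih_perturb (X_hol n) (X_lip n)).
have kball n w : nv w < r / 4 ->
   [/\ nv (k n w) < r / 2, nv (k n w) <= 2 * nv w, h n (k n w) = w & vhol (k n) w].
  move=> wr; apply: (linverse_ball r2 (X_hol n) (X_lip n) (X0 n)); lra.
have h_le n z : nv z < r / 2 -> nv (h n z) <= 2 * nv z.
  move=> zr; apply: le_trans (nvD _ _) _.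
  have := X_lip n z 0 zr; rewrite nv0 X0 !subr0 => /(_ r2); have := nv_ge0 z; lra.
have k_other n w i : nv w < r / 4 -> i != j -> k n w 0 i = w 0 i.
  move=> wr ij; have [_ _ E _] := kball n w wr.
  by rewrite -[in RHS]E mxE Xi (negbTE ij) mulr0 addr0.
pose f' n (z : V) := h n.+1 (F n (k n z)).
have f'_other n w i : i != j -> f' n w 0 i = F n (k n w) 0 i.
  by move=> ij; rewrite /f' mxE Xi (negbTE ij) mulr0 addr0.
have f'_j n w : nv w < r / 4 -> f' n w 0 j = la n j * w 0 j + T (m1 + n)%N w.
  move=> wr; have [kr _ E _] := kball n w wr.
  rewrite /f' mxE Xi eqxx mulr1 ch_eq; last by lra.
  rewrite -[in RHS]E [in X in _ = la n j * X + _]mxE Xi eqxx mulr1; congr (_ + _).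
  apply: T_agree => i ij; rewrite mxE Xi (_ : (i == j) = false) ?mulr0 ?addr0 //.
  by apply/negbTE; rewrite -val_eqE neq_ltn ij.
have [KT KT0 hKT] := T_le 1.
exists f', h, k, (r / 8), (r / 4), (KT + 2 * K), q; split; last first.
  split.
  - by rewrite divr_gt0.
  - by lra.
  - move=> n; apply: lbih_sub (hk n); first exact: nopen_ball.
    by move=> z /=; lra.
  - move=> n z zr; have h1 : nv (h n z) <= 2 * nv z by apply: h_le; lra.
    by split => //; lra.
  - move=> n z zr; rewrite /f'; have [_ -> _] := hk n z ltac:(rewrite /=; lra).
    by [].
  - move=> n w wr; have [|a1 a2 a3 a4] := kball n w; first by have := nv_ge0 w; lra.
    by split => //; lra.
have k0 n : k n 0 = 0.
  have [|_ h1 _ _] := kball n 0; first by rewrite nv0 divr_gt0.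
  by apply/eqP; rewrite -nv_eq0 eq_le nv_ge0 andbT; rewrite nv0 mulr0 in h1.
have k_sd n m : sd (fun z => k n z 0 m) 0 (fun l => (m == l)%:R).
  pose c4 := 4 * Kc + 1; have c40 : 0 < c4 by rewrite /c4; lra.
  move=> e e0; exists (Num.min (r / 4) (e / c4)).
    by rewrite lt_min !divr_gt0.
  move=> v; rewrite lt_min => /andP[v1 v2]; rewrite add0r k0 mxE subr0.
  have -> : lin (fun l => (m == l)%:R) v = v 0 m.
    rewrite /lin (bigD1 m) //= eqxx mul1r big1 ?addr0 // => l lm.
    by rewrite eq_sym (negbTE lm) mul0r.
  have [kr k2 E _] := kball n v v1.
  apply: (@le_trans _ _ (nc (ch n (k n v)))).
    rewrite -{2}E mxE opprD addrA subrr sub0r ncN Xi ncM.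
    by rewrite ler_piMr ?nc_ge0 //; case: eqP => _; rewrite ?nc1 ?nc0.
  apply: le_trans (ch_sq n _ _) _; first by lra.
  apply: (@le_trans _ _ (Kc * (2 * nv v) ^+ 2)).
    by apply: ler_wpM2l => //; apply: lerXn2r; rewrite ?nnegrE ?nv_ge0 // mulr_ge0 ?nv_ge0.
  rewrite ltr_pdivlMr // in v2.
  have -> : Kc * (2 * nv v) ^+ 2 = (4 * Kc * nv v) * nv v by ring.
  apply: ler_wpM2r; first exact: nv_ge0.
  by move: v2; rewrite /c4; have := nv_ge0 v; lra.
have sgn n : K1 * sg ^+ n <= K * q ^+ n.
  rewrite /K1 -mulrA; apply: ler_wpM2l => //.
  apply: (@le_trans _ _ (1 * sg ^+ n)).
    apply: ler_wpM2r; first by apply: exprn_ge0; exact: ltW.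
    by apply: exprn_ile1; exact: ltW.
  by rewrite mul1r; apply: lerXn2r => //; rewrite nnegrE ltW.
split => //.
- by rewrite divr_gt0.
- by lra.
- by rewrite addr_ge0 // mulr_ge0.
- move=> n z zr; have [kr k2 E kz] := kball n z zr.
  apply: (vhol_comp (G := h n.+1) (F := fun x => F n (k n x))).
    by apply: (vhol_comp (G := F n) kz); apply: Fhol; lra.
  have Fr : nv (F n (k n z)) < r / 2 by apply: (le_lt_trans (Fc n _ _)) => //; lra.
  by have [] := hk n.+1 _ Fr.
- move=> n z i zr; have [kr k2 E kz] := kball n z zr.
  rewrite (mulrDl KT) (mulrDl (KT * _)); have [->|ij] := eqVneq i j.
    rewrite f'_j // addrC addKr -[leLHS]addr0.
    apply: lerD; last by rewrite !mulr_ge0 ?nv_ge0.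
    apply: le_trans (hKT _ z _) _; first by lra.
    apply: ler_wpM2r; first exact: nv_ge0.
    by apply: ler_wpM2l => //; rewrite exprD ler_piMl.
  rewrite f'_other // -(k_other n z) // -[leLHS]add0r.
  apply: lerD; first by rewrite !mulr_ge0 ?nv_ge0.
  apply: le_trans (Fnear n _ i _) _; first by lra.
  have -> : 2 * K * q ^+ n * nv z = (K * q ^+ n) * (2 * nv z) by ring.
  apply: ler_pM => //; rewrite ?nv_ge0 //.
  by apply: mulr_ge0 => //; apply: exprn_ge0; exact: ltW.
- move=> n i; have [->|ij] := eqVneq i j.
    have [D hD] := T_hol (m1 + n)%N 0.
    have D0 := entire_below_sd hD (T_agree (m1 + n)%N).
    exists (fun l => (0 * (0 : V) 0 j + la n j * (j == l)%:R) + D l); split.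
    + have r4 : 0 < r / 4 by rewrite divr_gt0.
      apply: (eq_near_sd r4 (b := fun z => la n j * z 0 j + T (m1 + n)%N z)).
        by move=> v vr; rewrite add0r f'_j.
      apply: sdD hD; apply: (sdM (D := fun=> 0) (E := fun l => (j == l)%:R)).
        exact: sd_const.
      exact: sd_coord.
    + by rewrite D0 // addr0 mul0r add0r eqxx mulr1.
    + move=> l jl; rewrite D0 ?(ltnW jl) // mul0r add0r addr0 (_ : (j == l) = false) ?mulr0 //.
      by apply/negbTE; rewrite -val_eqE neq_ltn jl.
  have [D [hD Di Dl]] := Flow n i.
  exists (fun l => \sum_m D m * (m == l)%:R).
  have S l : \sum_m D m * (m == l)%:R = D l.
    by rewrite (bigD1 l) //= eqxx mulr1 big1 ?addr0 // => m ml; rewrite (negbTE ml) mulr0.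
  split; [|by rewrite S|by move=> l il; rewrite S Dl].
  have -> : (fun z => f' n z 0 i) = (fun x => F n x 0 i) \o k n.
    by apply/funext => x /=; rewrite f'_other.
  by apply: sd_comp; [rewrite k0|exact: k_sd].
move=> i; rewrite ltnS leq_eqVlt => /orP[/eqP/val_inj ->|ij].
  exists (tailseq m1 T); last by move=> n z zr; rewrite f'_j.
  apply: entire_below_shift; split=> [n z|n z w|s]; [exact: T_hol|exact: T_agree|].
  have [Ks Ks0 hs] := T_le s; exists Ks => n z zs; apply: le_trans (hs n z zs) _.
  by apply: ler_wpM2r; [exact: nv_ge0|rewrite ler_piMr].
have [Ti hTi fTi] := Fcomp i ij; exists Ti => // n z zr.
have ij' : i != j by rewrite -val_eqE neq_ltn ij.
have [kr k2 E kz] := kball n z zr.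
rewrite f'_other // fTi; last by lra.
rewrite k_other //; congr (_ + _); have [_ ag _] := hTi; apply: ag => l li.
by apply: k_other => //; rewrite -val_eqE neq_ltn (ltn_trans li ij).
Qed.

End NormalForm.

(** * Conjugation with triangular automorphisms *)

Section Reduction.
Context {R : realType} {d : nat}.
Local Notation C := R[i].
Local Notation V := 'rV[C]_d.
Implicit Types (lam : nat -> 'I_d -> C) (f h k : nat -> V -> V).

Lemma normal_form lam nu Lam f rho K sg : tame lam nu Lam ->
  triform 0 lam f rho K sg -> (forall n z, nv z < rho -> nv (f n z) <= nv z) ->
  forall j, (j <= d)%N -> exists n0 f' h k r rho' K' q A, [/\
    triform j (tailseq n0 lam) f' rho' K' q, r <= rho &
    conjugates (tailseq n0 f) f' h k r rho' A].
Proof.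
move=> htame htri fc; elim=> [_|j IH jd].
  have [rho0 _ _ _ _ fhol _ _ _] := htri.
  exists 0%N, f, (fun n z => z), (fun n z => z), rho, rho, K, sg, 1; split => //.
  split => //.
  - move=> n z zr; split; [exact: vhol_id|by []|].
    have [e e0 he] := nopen_ball zr; exists e => // w /he wr.
    by split => //; exact: vhol_id.
  - by move=> n z zr; rewrite mul1r.
  - by move=> n w; rewrite divr1 mul1r.
have [n0 [f' [h [k [r [rho' [K' [q [A [htri' r_rho [r0 A1 hk h_le hf k_le]]]]]]]]]]] := IH (ltnW jd).
have [n1 [f'' [h' [k' [s [s' [K'' [q' [htri'' [s0 _ hk' h_le' hf' k_le']]]]]]]]]] :=
  @triangular_step _ _ (Ordinal jd) _ _ _ _ _ _ _ (tame_shift n0 htame) htri'.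
have A0 : 0 < A by lra.
exists (n0 + n1)%N, f'', (fun n z => h' n (h (n1 + n)%N z)),
  (fun n z => k (n1 + n)%N (k' n z)), (Num.min r (s / A)), s', K'', q', (A * 2).
have la_eq : tailseq (n0 + n1) lam = tailseq n1 (tailseq n0 lam).
  by apply/funext => n; rewrite /tailseq addnA.
rewrite la_eq; split => //; first by rewrite ge_min r_rho.
have m1 (z : V) : nv z < Num.min r (s / A) -> nv z < r by rewrite lt_min => /andP[].
have m2 n (z : V) : nv z < Num.min r (s / A) -> nv (h n z) < s.
  rewrite lt_min ltr_pdivlMr // mulrC => /andP[zr zs].
  by have [_ /le_lt_trans] := h_le n z zr; exact.
split.
- by rewrite lt_min r0 divr_gt0.
- by lra.
- move=> n; apply: (lbih_comp (U' := [set z : V | nv z < s])); last by move=> z; exact: m2.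
    by apply: lbih_sub (hk (n1 + n)%N); [exact: nopen_ball|exact: m1].
  exact: hk'.
- move=> n z zr; have [a1 a2] := h_le (n1 + n)%N z (m1 z zr).
  have [b1 b2] := h_le' n _ (m2 (n1 + n)%N z zr); split=> //.
  apply: le_trans b2 _; rewrite [A * 2]mulrC -mulrA; exact: ler_wpM2l.
- move=> n z zr; rewrite /tailseq addnS -addnA.
  by rewrite (hf (n1 + n)%N) ?m1 // hf' // m2.
move=> n w; rewrite ltr_pdivlMr ?mulr_gt0 // => wr.
have w2 : nv w * 2 * A < Num.min r (s / A) by rewrite -mulrA [2 * A]mulrC.
have w3 : nv w * 2 * A < r by apply: lt_le_trans w2 _; rewrite ge_min lexx.
have w4 : nv w * 2 < s.
  have : nv w * 2 * A < s / A by apply: lt_le_trans w2 _; rewrite ge_min lexx orbT.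
  rewrite ltr_pdivlMr // => h1.
  have w0 : 0 <= nv w * 2 by rewrite mulr_ge0 ?nv_ge0.
  have AA : 1 <= A * A by rewrite -[1]mulr1; apply: ler_pM => //; lra.
  by have := ler_wpM2l w0 AA; rewrite mulr1 mulrA; lra.
have [|b1 b2 b3] := k_le' n w; first by rewrite ltr_pdivlMr.
have [|a1 a2 a3] := k_le (n1 + n)%N (k' n w).
  rewrite ltr_pdivlMr //; apply: le_lt_trans w3; rewrite ler_pM2r //; lra.
have le2 : nv (k (n1 + n)%N (k' n w)) <= A * 2 * nv w.
  by apply: le_trans a3 _; rewrite -mulrA ler_pM2l.
split; [|by rewrite a2|by []].
by apply: le_lt_trans le2 _; rewrite -mulrA mulrC [2 * _]mulrC.
Qed.

Section TriangularAutomorphism.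
Variables (l : 'I_d -> C) (T : 'I_d -> V -> C).
Hypothesis l0 : forall i, l i != 0.
Hypothesis T_hol : forall i z, hol (T i) z.
Hypothesis T_agree : forall (i : 'I_d) z w, agree i z w -> T i z = T i w.

Definition tri_map (z : V) : V := \row_i (l i * z 0 i + T i z).

(** Back substitution: after m steps the first m coordinates are correct. *)
Fixpoint tri_solve (m : nat) (w : V) : V :=
  if m is m'.+1 then \row_i ((w 0 i - T i (tri_solve m' w)) / l i) else 0.

Definition tri_inv := tri_solve d.

Lemma agree_all (z w : V) : agree d z w -> z = w.
Proof. by move=> h; apply/rowP => i; apply: h. Qed.

Lemma tri_solve_stable m w : agree m (tri_solve m.+1 w) (tri_solve m w).
Proof.
elim: m => [|m IH] // i im; rewrite [LHS]mxE [RHS]mxE.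
congr ((_ - _) / _); apply: T_agree => k ki; apply: IH.
exact: leq_trans ki im.
Qed.

Lemma tri_invK w : tri_map (tri_inv w) = w.
Proof.
have E : tri_solve d.+1 w = tri_solve d w by apply: agree_all; exact: tri_solve_stable.
apply/rowP => i; rewrite mxE.
have -> : tri_inv w 0 i = (w 0 i - T i (tri_inv w)) / l i by rewrite /tri_inv -{1}E /= mxE.
by rewrite mulrC divfK // subrK.
Qed.

Lemma tri_mapK z : tri_inv (tri_map z) = z.
Proof.
apply: agree_all; suff H m : agree m (tri_solve m (tri_map z)) z by exact: H.
elim: m => [|m IH] // i im.
rewrite /= !mxE (T_agree (w := z)); last by move=> k ki; apply: IH; exact: leq_trans ki im.
by rewrite addrK mulrC mulKf.
Qed.

Lemma tri_map_hol z : vhol tri_map z.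
Proof.
move=> i; have -> : (fun x => tri_map x 0 i) = (fun x => l i * x 0 i + T i x).
  by apply/funext => x; rewrite mxE.
by apply: holD => //; apply: holZ; exact: hol_coord.
Qed.

Lemma tri_inv_hol z : vhol tri_inv z.
Proof.
suff H m : vhol (tri_solve m) z by exact: H.
elim: m => [|m IH] i; first exact: hol_const.
have -> : (fun x => tri_solve m.+1 x 0 i) =
  (fun x => (x 0 i - T i (tri_solve m x)) * (l i)^-1).
  by apply/funext => x; rewrite /= mxE.
apply: holM; last exact: hol_const.
apply: holB; first exact: hol_coord.
exact: (hol_comp (a := T i) IH).
Qed.

End TriangularAutomorphism.

Lemma vanishing_recursion (s eps : nat -> R) (L : R) : 0 <= L -> L < 1 ->
  (forall n, 0 <= s n) -> vanishing eps -> (forall n, s n.+1 <= L * s n + eps n) ->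
  vanishing s.
Proof.
move=> L0 L1 s0 he hs e e0.
have L2 : 0 < 1 - L by lra.
have [|N1 h1] := he (e * (1 - L) / 2); first by rewrite divr_gt0 // mulr_gt0.
have [|M h2] := vanishing_geo (s N1) L0 L1 (e := e / 2); first by rewrite divr_gt0.
have h3 m : s (N1 + m)%N <= s N1 * L ^+ m + e / 2.
  elim: m => [|m IH]; first by rewrite addn0 expr0 mulr1 lerDl divr_ge0 // ltW.
  rewrite addnS; apply: le_trans (hs _) _.
  have := h1 (N1 + m)%N (leq_addr _ _); have := ler_wpM2l L0 IH.
  rewrite exprS mulrDr; have -> : L * (s N1 * L ^+ m) = s N1 * (L * L ^+ m) by ring.
  lra.
exists (N1 + M)%N => n nN; have -> : n = (N1 + (n - N1))%N by lia.
apply: le_trans (h3 _) _; have := h2 (n - N1)%N; have -> : (M <= n - N1)%N by lia.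
by move=> /(_ isT); lra.
Qed.

Fixpoint orb (g : nat -> V -> V) (n : nat) (w : V) : V :=
  if n is n'.+1 then g n' (orb g n' w) else w.

(** Orbits of triangular automorphisms tend to 0: one coordinate after the
    other, since the i-th one is contracted up to a term controlled by the
    previous ones. *)
Lemma tri_orbit lam nu Lam (T : 'I_d -> nat -> V -> C) w : tame lam nu Lam ->
  (forall i : 'I_d, entire_below i (T i)) ->
  vanishing (fun n => nv (orb (fun n => tri_map (lam n) (T^~ n)) n w)).
Proof.
move=> htame hT; have [nu0 L1 lam_ge lam_le _] := htame.
set g := fun n => tri_map _ _; pose z n := orb g n w.
suff H i : (i <= d)%N -> vanishing (fun n => nv (trunc i (z n))).
  move=> e e0; have [N h] := H d (leqnn d) e e0; exists N => n /h.
  by rewrite (_ : trunc d _ = z n) //; apply/rowP => k; rewrite mxE ltn_ord.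
elim: i => [|i IH] id.
  move=> e e0; exists 0%N => n _; apply: nv_le => [|k]; first exact: ltW.
  by rewrite mxE nc0 ltW.
have {}IH := IH (ltnW id).
pose io := Ordinal id; have [_ Tag Tle] := hT io; have [KT hKT] := Tle 1.
have Lam0 : 0 <= Lam by apply: le_trans (lam_le 0%N io); exact: nc_ge0.
have van : vanishing (fun n => nc (z n 0 io)).
  apply: (@vanishing_recursion _ (fun n => nc (T io n (z n))) Lam) => //.
  - by move=> n; exact: nc_ge0.
  - move=> e e0; have K1 : 0 < `|KT| + 1 by rewrite ltr_wpDl.
    have [N1 h1] := IH _ ltr01; have [N2 h2] := IH _ (divr_gt0 e0 K1).
    exists (N1 + N2)%N => n nN.
    have -> : T io n (z n) = T io n (trunc i (z n)) by apply: Tag; exact: agree_trunc.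
    apply: le_trans (hKT n _ (h1 n _)) _; first by lia.
    have := h2 n ltac:(lia); rewrite ler_pdivlMr // mulrC; apply: le_trans.
    by apply: ler_wpM2r; [exact: nv_ge0|have := ler_norm KT; lra].
  move=> n; rewrite /z /= /g mxE; apply: le_trans (ncD _ _) _.
  by rewrite ncM lerD2r ler_wpM2r ?nc_ge0.
move=> e e0; have [N1 h1] := IH e e0; have [N2 h2] := van e e0.
exists (N1 + N2)%N => n nN; apply: nv_le => [|k]; first exact: ltW.
rewrite mxE ltnS leq_eqVlt; have [/= /eqP ki|ki] := boolP (k == i :> nat).
  have -> : k = io by apply: val_inj.
  by apply: h2; lia.
rewrite /=; case: ifP => kli; last by rewrite nc0 ltW.
have := nc_le_nv (trunc i (z n)) k; rewrite mxE kli => h; apply: le_trans h _.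
by apply: h1; lia.
Qed.

(** After d steps only triangular maps with entire terms are left; these are
    automorphisms of the whole space. *)
Theorem global_normal_form lam nu Lam f rho K sg : tame lam nu Lam ->
  triform 0 lam f rho K sg -> (forall n z, nv z < rho -> nv (f n z) <= nv z) ->
  exists (n0 : nat) (g g' h k : nat -> V -> V) (r r' A : R), [/\ r <= rho,
    conjugates (tailseq n0 f) g h k r r' A,
    forall n z, [/\ g' n (g n z) = z, g n (g' n z) = z, vhol (g n) z & vhol (g' n) z] &
    forall w, vanishing (fun n => nv (orb g n w))].
Proof.
move=> htame htri fc.
have [n0 [f' [h [k [r [rho' [K' [q [A [htri' r_rho [r0 A1 hk h_le hf k_le]]]]]]]]]]] :=
  normal_form htame htri fc (leqnn d).
have [_ _ _ _ _ _ _ _ comp] := htri'.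
have /choice[T hT] : forall i : 'I_d, exists T, entire_below i T /\
    forall n z, nv z < rho' -> f' n z 0 i = tailseq n0 lam n i * z 0 i + T n z.
  by move=> i; have [T hT fT] := comp i (ltn_ord i); exists T.
have htame' := tame_shift n0 htame.
have la0 n i : tailseq n0 lam n i != 0.
  have [nu0 _ lam_ge _ _] := htame'; rewrite -nc_gt0.
  exact: lt_le_trans (lam_ge n i).
exists n0, (fun n => tri_map (tailseq n0 lam n) (T^~ n)),
  (fun n => tri_inv (tailseq n0 lam n) (T^~ n)), h, k, r, rho', A; split => //.
- split => // n z zr; rewrite hf //; apply/rowP => i; rewrite mxE.
  by have [_ ->] := hT i => //; have [] := h_le n z zr.
- have Thol n i z : hol (T i n) z by have [[]] := hT i.
  have Tag n (i : 'I_d) z w : agree i z w -> T i n z = T i n w.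
    by have [[_ H _] _] := hT i; exact: H.
  move=> n z; split.
  + exact: (tri_mapK (la0 n) (Tag n)).
  + exact: (tri_invK (la0 n) (Tag n)).
  + exact: tri_map_hol.
  + exact: tri_inv_hol.
by move=> w; apply: tri_orbit htame' _ => i; have [] := hT i.
Qed.

End Reduction.

(** * Attracting sequences of maps *)

Lemma root_gt1 {R : realType} (x : R) m : 1 < x -> exists2 tau : R, 1 < tau & tau ^+ m <= x.
Proof.
elim: m x => [|m IH] x x1; first by exists 2; [lra|rewrite expr0 ltW].
(* The square of the harmonic mean of 1 and x is at most x. *)
pose a := 2 * x / (1 + x); have x2 : 0 < 1 + x by lra.
have a1 : 1 < a by rewrite ltr_pdivlMr //; lra.
have aa : a * a <= x.
  have -> : a * a = x * (4 * x / (1 + x) ^+ 2) by rewrite /a; field; rewrite gt_eqF.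
  apply: ler_piMr; first by lra.
  by rewrite ler_pdivrMr ?exprn_gt0 // mul1r; have := sqr_ge0 (x - 1); lra.
have [t t1 tm] := IH a a1.
exists (Num.min t a); first by rewrite lt_min t1.
have m0 : 0 <= Num.min t a by rewrite le_min; apply/andP; split; lra.
rewrite exprS; apply: le_trans aa; apply: ler_pM => //; first exact: exprn_ge0.
  by rewrite ge_min lexx orbT.
by apply: le_trans tm; apply: lerXn2r; rewrite ?nnegrE ?ge_min ?lexx //; lra.
Qed.

Lemma weight_gap d (i k : 'I_d) : (k < i)%N -> (2 * d - k = (2 * d - i) + (i - k))%N.
Proof. by move=> ki; have := ltn_ord i; lia. Qed.

Section Attracting.
Context {R : realType} {d : nat}.
Local Notation C := R[i].
Local Notation V := 'rV[C]_d.
Variables (f : nat -> V -> V) (D : nat -> 'I_d -> 'I_d -> C) (nu Lam lam' : R).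
Hypothesis nu0 : 0 < nu.
Hypothesis Lam0 : 0 < Lam.
Hypothesis Lam1 : Lam < 1.
Hypothesis fhol : forall n z, nv z < 1 -> vhol (f n) z.
Hypothesis fge : forall n z, nv z < 1 -> nu * nv z <= nv (f n z).
Hypothesis fle : forall n z, nv z < 1 -> nv (f n z) <= Lam * nv z.
Hypothesis fD : forall n i, sd (fun z => f n z 0 i) 0 (D n i).
Hypothesis Dtrig : forall n (i k : 'I_d), (i < k)%N -> D n i k = 0.

Let dmx n : 'M[C]_d := \matrix_(k, i) D n i k.

Let dmxE n v i : (v *m dmx n) 0 i = lin (D n i) v.
Proof. by rewrite !mxE; apply: eq_bigr => k _; rewrite mxE mulrC. Qed.

Let subE (v w : V) i : (v - w) 0 i = v 0 i - w 0 i.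
Proof. by rewrite !mxE. Qed.

Let f0 n : f n 0 = 0.
Proof.
apply/eqP; rewrite -nv_eq0 eq_le nv_ge0 andbT.
by have := fle n (z := 0); rewrite nv0 mulr0; apply.
Qed.

Let f_lt1 n z : nv z < 1 -> nv (f n z) < 1.
Proof.
move=> z1; apply: le_lt_trans (fle n z1) _.
by have := nv_ge0 z; have := Lam0; have := Lam1; nra.
Qed.

Let remainder n v i : nv v <= 24^-1 -> nc (f n v 0 i - lin (D n i) v) <= 432 * nv v ^+ 2.
Proof.
move=> vr; have := @taylor2_mv R d (fun z => f n z 0 i) 0 (D n i) 1 1 v ltr01.
rewrite add0r f0 mxE subr0 mulr1 divr1 div1r; apply => // u ur; rewrite add0r.
  exact: fhol.
by apply: le_trans (nc_le_nv _ i) _; apply: ltW; exact: f_lt1.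
Qed.

(** The derivative at 0 inherits the two bounds by homogeneity. *)
Let dmx_bounds n v : nu * nv v <= nv (v *m dmx n) /\ nv (v *m dmx n) <= Lam * nv v.
Proof.
have [->|v0] := eqVneq v 0; first by rewrite mul0mx nv0 !mulr0.
have vp : 0 < nv v by rewrite nv_gt0.
have main t : 0 < t -> t * nv v <= 24^-1 ->
    nv (f n (t%:C *: v) - (t%:C *: v) *m dmx n) <= 432 * t * nv v * (t * nv v).
  move=> t0 tv; have nt : nv (t%:C *: v) = t * nv v by rewrite nvZ nc_real gtr0_norm.
  apply: nv_le => [|i].
    apply: mulr_ge0; last by rewrite mulr_ge0 ?nv_ge0 // ltW.
    by apply: mulr_ge0 _ (ltW vp); apply: mulr_ge0 (ler0n _ _) (ltW t0).
  rewrite subE dmxE; apply: le_trans (remainder n i _) _; first by rewrite nt.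
  by rewrite nt expr2 !mulrA.
have hom (t : R) : 0 < t -> nv ((t%:C *: v) *m dmx n) = t * nv (v *m dmx n).
  by move=> t0; rewrite -scalemxAl nvZ nc_real gtr0_norm.
suff H e : 0 < e -> nu * nv v <= nv (v *m dmx n) + e /\ nv (v *m dmx n) <= Lam * nv v + e.
  by split; apply: le_of_eps => e /H[].
move=> e0; pose c := 432 * nv v * nv v + 1.
have c0 : 0 < c.
  apply: ltr_wpDl ltr01; apply: mulr_ge0; last exact: ltW.
  by apply: mulr_ge0; [exact: ler0n|exact: ltW].
pose t := Num.min (24^-1 / nv v) (e / c).
have t0 : 0 < t by rewrite lt_min !divr_gt0.
have t1 : t * nv v <= 24^-1 by rewrite -ler_pdivlMr // ge_min lexx.
have t2 : t * c <= e by rewrite -ler_pdivlMr // ge_min lexx orbT.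
have nt : nv (t%:C *: v) = t * nv v by rewrite nvZ nc_real gtr0_norm.
have tv1 : nv (t%:C *: v) < 1 by rewrite nt; lra.
have h1 := main t t0 t1; have h2 := fge n tv1; have h3 := fle n tv1.
rewrite nt in h2 h3.
have h4 := nvB_ge (f n (t%:C *: v)) ((t%:C *: v) *m dmx n).
have h5 := nvB_ge ((t%:C *: v) *m dmx n) (f n (t%:C *: v)).
rewrite nvBC in h5; rewrite (hom t t0) in h4 h5.
have h6 : 432 * t * nv v * (t * nv v) <= t * e.
  have -> : 432 * t * nv v * (t * nv v) = t * (t * (432 * nv v * nv v)) by ring.
  rewrite ler_pM2l //; apply: le_trans t2; rewrite ler_pM2l // /c lerDl //.
by split; rewrite -(ler_pM2l t0) mulrDr; lra.
Qed.

Let dmx_unit n : dmx n \in unitmx.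
Proof.
rewrite -row_free_unit -kermx_eq0; apply/eqP/row_matrixP => i.
rewrite row0; apply/eqP; rewrite -nv_eq0.
have E : row i (kermx (dmx n)) *m dmx n = 0 by rewrite -row_mul mulmx_ker row0.
have [+ _] := dmx_bounds n (row i (kermx (dmx n))); rewrite E nv0 => h.
rewrite eq_le nv_ge0 andbT; move: h; rewrite -[X in _ <= X](mulr0 nu) ler_pM2l //.
Qed.

Let diag_neq0 n i : D n i i != 0.
Proof.
have trig : is_trig_mx (dmx n)^T by apply/is_trig_mxP => k l kl; rewrite !mxE Dtrig.
have := dmx_unit n; rewrite unitmxE -det_tr det_trig // unitfE.
by move=> /prodf_neq0/(_ i isT); rewrite !mxE.
Qed.

Let diag_le n i k : nc (D n i k) <= Lam.
Proof.
have [_] := dmx_bounds n (delta_mx 0 k); rewrite nv_delta1 mulr1; apply: le_trans.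
by rewrite -[D n i k]lin_delta -dmxE nc_le_nv.
Qed.

(** The i-th diagonal entry is bounded below: the inverse of the derivative maps
    e_i to a vector whose i-th coordinate is the inverse of that entry. *)
Let diag_ge n i : nu <= nc (D n i i).
Proof.
pose T (l : 'I_d) (z : V) := \sum_(m < d | (m < l)%N) D n l m * z 0 m.
have T_agree (l : 'I_d) z w : agree l z w -> T l z = T l w.
  by move=> zw; apply: eq_bigr => m ml; rewrite zw.
pose e : V := delta_mx 0 i.
pose z := tri_inv (fun l => D n l l) T e.
have ze : z *m dmx n = e.
  rewrite -[RHS](tri_invK (l := fun l => D n l l) (fun l => diag_neq0 n l) T_agree).
  apply/rowP => l; rewrite dmxE [RHS]mxE /lin (bigD1 l) //=; congr (_ + _).
  rewrite /T big_mkcond [RHS]big_mkcond; apply: eq_bigr => m _ /=.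
  have [ml|lm|/val_inj ->] := ltngtP m l.
  - by rewrite -val_eqE neq_ltn ml.
  - by rewrite Dtrig // mul0r; case: ifP.
  - by rewrite eqxx.
have zlow m : forall k : 'I_d, (k < i)%N -> tri_solve (fun l => D n l l) T m e 0 k = 0.
  elim: m => [|m IH] k ki; first by rewrite mxE.
  rewrite mxE /e mxE eqxx /= (_ : (k == i) = false); last first.
    by apply/negbTE; rewrite -val_eqE neq_ltn ki.
  rewrite /T big1 ?subr0 ?mul0r // => l lk.
  by rewrite IH ?mulr0 //; exact: ltn_trans lk ki.
have zi : D n i i * z 0 i = 1.
  have := congr1 (fun x : V => x 0 i) ze; rewrite /e [delta_mx _ _ _ _]mxE !eqxx dmxE.
  rewrite /lin (bigD1 i) //= big1 ?addr0 // => l li.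
  have [il|il|/val_inj ll] := ltngtP l i; [|by rewrite Dtrig ?mul0r|by rewrite ll eqxx in li].
  by rewrite zlow // mulr0.
have [+ _] := dmx_bounds n z; rewrite ze /e nv_delta1 => h.
have h1 : nc (D n i i) * nc (z 0 i) = 1 by rewrite -ncM zi nc1.
have h2 : nu * nc (z 0 i) <= 1 by apply: le_trans h; rewrite ler_pM2l // nc_le_nv.
have z0 : 0 < nc (z 0 i) by rewrite nc_gt0; apply/eqP => z0; move: zi; rewrite z0 mulr0 => /eqP; rewrite eq_sym oner_eq0.
by rewrite -(ler_pM2r z0) h1.
Qed.

(** All the maps f n are biholomorphic from one and the same ball onto an open
    set: f n is the composition of its derivative at 0 with a map that is
    uniformly close to the identity. *)
Lemma uniform_lbih : exists r0 : R, [/\ 0 < r0, r0 < 1 &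
  exists kf, forall n, lbih [set z : V | nv z < r0] (f n) (kf n)].
Proof.
pose kap : R := 180 * 432 * 4.
have kap0 : 0 < kap.
  exact: mulr_gt0 (mulr_gt0 (ltr0Sn R 179) (ltr0Sn R 431)) (ltr0Sn R 3).
pose r0 := Num.min (192^-1) (nu / (4 * kap)).
have r00 : 0 < r0 by rewrite lt_min invr_gt0 ltr0n divr_gt0 // mulr_gt0 // ltr0n.
have r01 : r0 <= 192^-1 by rewrite ge_min lexx.
have r02 : r0 * (4 * kap) <= nu by rewrite -ler_pdivlMr ?mulr_gt0 ?ltr0n // ge_min lexx orbT.
exists r0; split; [by []|by lra|].
pose X n z := f n z *m invmx (dmx n) - z.
exists (fun n w => linverse (X n) r0 (w *m invmx (dmx n))) => n.
have inv_le v : nv (v *m invmx (dmx n)) <= nv v / nu.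
  have [h _] := dmx_bounds n (v *m invmx (dmx n)).
  by rewrite mulmxKV // in h; rewrite ler_pdivlMr // mulrC.
have Xhol z : nv z < r0 -> vhol (X n) z.
  move=> zr i; have -> : (fun x => X n x 0 i) =
     (fun x => (f n x *m invmx (dmx n)) 0 i - x 0 i).
    by apply/funext => x; rewrite !mxE.
  apply: holB; last exact: hol_coord.
  have h : vhol (fun x => f n x *m invmx (dmx n)) z.
    apply: (vhol_comp (G := fun y : V => y *m invmx (dmx n)) (F := f n)).
      by apply: fhol; lra.
    exact: vhol_mulmx.
  exact: h.
have Xlip z w : nv z < r0 -> nv w < r0 -> nv (X n z - X n w) <= nv (z - w) / 2.
  move=> zr wr.
  have -> : X n z - X n w = (f n z - f n w - (z - w) *m dmx n) *m invmx (dmx n).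
    by rewrite /X !mulmxBl !mulmxK //; vring.
  apply: le_trans (inv_le _) _; rewrite ler_pdivrMr //.
  have zw : 0 <= nv z + nv w by rewrite addr_ge0 ?nv_ge0.
  apply: (@le_trans _ _ (kap * (1 * (nv z + nv w) * nv (z - w) / 1 ^+ 2))).
    apply: nv_le => [|i].
      by apply: mulr_ge0 (ltW kap0) _; rewrite expr1n divr1 mul1r mulr_ge0 ?nv_ge0.
    rewrite !subE dmxE.
    have h1 u : nv u < 1 -> hol (fun x => f n x 0 i) u by move=> /(fhol n).
    have h2 u : nv u < 1 -> nc (f n u 0 i) <= 1.
      by move=> /(f_lt1 n)/ltW; apply: le_trans; exact: nc_le_nv.
    have := cauchy_lipschitz2 (z := z) (w := w) ltr01 h1 h2 (fD n i) _.
    by apply; lra.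
  have -> : nv (z - w) / 2 * nu = nu / 2 * nv (z - w) by ring.
  rewrite mul1r expr1n divr1 mulrA; apply: ler_wpM2r; first exact: nv_ge0.
  have : kap * (nv z + nv w) <= kap * (r0 + r0) by rewrite ler_pM2l //; lra.
  move: r02; move: (kap) => k *; lra.
have := lbih_comp (lbih_perturb Xhol Xlip)
  (lbih_linear (U := setT) (fun _ _ => ex_intro2 _ _ 1 ltr01 (fun _ _ => I)) (dmx_unit n)) (fun _ _ => I).
have -> // : (fun z => (z + X n z) *m dmx n) = f n.
by apply/funext => z; rewrite /X addrC subrK mulmxKV.
Qed.

Hypothesis lam'0 : 0 < lam'.
Hypothesis lam'1 : lam' < 1.
Hypothesis bunch : forall theta, 1 < theta -> exists K, forall n l (j h k : 'I_d),
  (j <= k)%N -> \prod_(t < l) (nc (D (n + t)%N h h) * nc (D (n + t)%N k k) /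
    nc (D (n + t)%N j j)) <= K * theta ^+ n * lam' ^+ l.

Section Rescaling.
Variable tau : R.
Hypothesis tau1 : 1 < tau.
Hypothesis tauL : tau ^+ (2 * d) * Lam < 1.
Hypothesis taul : tau ^+ (4 * d) * lam' <= 1.

(** The i-th coordinate at time n is multiplied by tau ^ (n (2 d - i)).  These
    weights decrease with i, which makes the off-diagonal linear terms small; all
    of them are between tau ^ (n (d + 1)) and tau ^ (2 d n), which makes the
    quadratic terms small. *)
Definition wt n (i : 'I_d) : R := (tau ^+ n) ^+ (2 * d - i).
Definition scale_up n (z : V) : V := \row_i ((wt n i)%:C * z 0 i).
Definition scale_down n (z : V) : V := \row_i ((wt n i)^-1%:C * z 0 i).
Definition rescaled n (z : V) : V := scale_up n.+1 (f n (scale_down n z)).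

Let tau_ge1 : 1 <= tau. Proof. exact: ltW. Qed.
Let tau0 : 0 < tau. Proof. exact: lt_trans tau1. Qed.
Let s_ge1 n : 1 <= tau ^+ n. Proof. exact: exprn_ege1. Qed.
Let s_gt0 n : 0 < tau ^+ n. Proof. exact: exprn_gt0. Qed.
Lemma wt_gt0 n i : 0 < wt n i. Proof. exact: exprn_gt0. Qed.

Lemma wt_le n i : wt n i <= (tau ^+ n) ^+ (2 * d).
Proof. by apply: ler_weXn2l; [exact: s_ge1|exact: leq_subr]. Qed.

Lemma wtK n i : (wt n i)%:C * (wt n i)^-1%:C = 1.
Proof. by rewrite -rmorphM mulfV ?gt_eqF ?wt_gt0. Qed.

Lemma scale_upK n z : scale_down n (scale_up n z) = z.
Proof. by apply/rowP => i; rewrite !mxE mulrA [_^-1%:C * _]mulrC wtK mul1r. Qed.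

Lemma scale_downK n z : scale_up n (scale_down n z) = z.
Proof. by apply/rowP => i; rewrite !mxE mulrA wtK mul1r. Qed.

Lemma vhol_scale_up n z : vhol (scale_up n) z.
Proof.
move=> i; have -> : (fun x => scale_up n x 0 i) = (fun x => (wt n i)%:C * x 0 i).
  by apply/funext => x; rewrite mxE.
by apply: holZ; exact: hol_coord.
Qed.

Lemma vhol_scale_down n z : vhol (scale_down n) z.
Proof.
move=> i; have -> : (fun x => scale_down n x 0 i) = (fun x => (wt n i)^-1%:C * x 0 i).
  by apply/funext => x; rewrite mxE.
by apply: holZ; exact: hol_coord.
Qed.

Lemma nc_scale_down n z i : nc (scale_down n z 0 i) = nc (z 0 i) / wt n i.
Proof. by rewrite mxE ncM nc_real ger0_norm ?invr_ge0 ?ltW ?wt_gt0 // mulrC. Qed.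

Lemma nv_scale_down n z : nv (scale_down n z) <= nv z / (tau ^+ n) ^+ d.+1.
Proof.
have p0 : 0 < (tau ^+ n) ^+ d.+1 by rewrite exprn_gt0.
apply: nv_le => [|i]; first by rewrite divr_ge0 ?nv_ge0 // ltW.
rewrite nc_scale_down; apply: ler_pM; rewrite ?nc_ge0 ?nc_le_nv ?invr_ge0 ?(ltW (wt_gt0 _ _)) //.
rewrite lef_pV2 ?posrE ?wt_gt0 //; apply: ler_weXn2l; first exact: s_ge1.
by rewrite mul2n -addnn -addnBA ?(ltnW (ltn_ord i)) // -addn1 leq_add2l subn_gt0.
Qed.

Lemma nv_scale_down_le n z : nv (scale_down n z) <= nv z.
Proof.
apply: le_trans (nv_scale_down n z) _; rewrite ler_pdivrMr ?exprn_gt0 //.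
by rewrite ler_peMr ?nv_ge0 // exprn_ege1.
Qed.

Lemma nv_scale_up n z : nv (scale_up n z) <= (tau ^+ n) ^+ (2 * d) * nv z.
Proof.
apply: nv_le => [|i]; first by rewrite mulr_ge0 ?nv_ge0 // exprn_ge0 // ltW.
rewrite mxE ncM nc_real ger0_norm ?(ltW (wt_gt0 _ _)) //.
by apply: ler_pM; rewrite ?nc_ge0 ?nc_le_nv ?wt_le ?(ltW (wt_gt0 _ _)).
Qed.

Let mult n (i : 'I_d) : C := (tau ^+ (2 * d - i))%:C * D n i i.

Let nc_mult n (i : 'I_d) : nc (mult n i) = tau ^+ (2 * d - i) * nc (D n i i).
Proof. by rewrite ncM nc_real ger0_norm // exprn_ge0 // ltW. Qed.

(** The weights multiply each quotient |D h h| |D k k| / |D j j| by at most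
    tau ^ (4 d), which the factor lam' of the bunching condition compensates. *)
Lemma rescaled_tame : tame mult nu (tau ^+ (2 * d) * Lam).
Proof.
split => // [n i|n i|theta th1].
- rewrite nc_mult; apply: le_trans (diag_ge n i) _; by rewrite ler_peMl ?nc_ge0 ?exprn_ege1.
- rewrite nc_mult; apply: ler_pM; rewrite ?nc_ge0 ?exprn_ge0 ?diag_le //; first exact: ltW.
  by apply: ler_weXn2l => //; exact: leq_subr.
have [K hK] := bunch th1; exists K => n l j h k jk.
have K0 : 0 <= K.
  have := hK 0%N 0%N j h k jk; rewrite big_ord0 !expr0 !mulr1; lra.
pose P : R := \prod_(t < l) (nc (D (n + t)%N h h) * nc (D (n + t)%N k k) /
    nc (D (n + t)%N j j)).
have P0 : 0 <= P by rewrite prodr_ge0 // => t _; rewrite divr_ge0 ?mulr_ge0 ?nc_ge0.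
apply: (@le_trans _ _ ((tau ^+ (4 * d)) ^+ l * P)).
  have -> : (tau ^+ (4 * d)) ^+ l * P = \prod_(t < l) (tau ^+ (4 * d) *
     (nc (D (n + t)%N h h) * nc (D (n + t)%N k k) / nc (D (n + t)%N j j))).
    by rewrite big_split /= prodr_const card_ord.
  apply: ler_prod => t _; rewrite divr_ge0 ?mulr_ge0 ?nc_ge0 //= !nc_mult.
  set a := nc (D _ h h); set b := nc (D _ k k); set c := nc (D _ j j).
  have a0 : 0 <= a := nc_ge0 _. have b0 : 0 <= b := nc_ge0 _.
  have c0 : 0 <= c := nc_ge0 _.
  have th : tau ^+ (2 * d - h) <= tau ^+ (2 * d) by apply: ler_weXn2l => //; exact: leq_subr.
  have tk : tau ^+ (2 * d - k) <= tau ^+ (2 * d) by apply: ler_weXn2l => //; exact: leq_subr.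
  have tj : 1 <= tau ^+ (2 * d - j) by exact: exprn_ege1.
  have tp m : 0 < tau ^+ m by rewrite exprn_gt0.
  rewrite invfM.
  have -> : tau ^+ (2 * d - h) * a * (tau ^+ (2 * d - k) * b) * ((tau ^+ (2 * d - j))^-1 * c^-1) =
    (tau ^+ (2 * d - h) * tau ^+ (2 * d - k) / tau ^+ (2 * d - j)) * (a * b / c) by ring.
  apply: ler_wpM2r; first by rewrite divr_ge0 ?mulr_ge0.
  rewrite ler_pdivrMr //; apply: (@le_trans _ _ (tau ^+ (4 * d) * 1)); last by rewrite ler_pM2l.
  rewrite mulr1 (_ : 4 * d = 2 * d + 2 * d)%N; last by rewrite -mulnDl.
  by rewrite exprD; apply: ler_pM => //; exact: ltW.
apply: (@le_trans _ _ ((tau ^+ (4 * d)) ^+ l * (K * theta ^+ n * lam' ^+ l))).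
  by apply: ler_wpM2l; [rewrite exprn_ge0 // exprn_ge0 // ltW|exact: hK].
rewrite mulrCA -exprMn ler_piMr //.
  by rewrite mulr_ge0 // exprn_ge0 //; lra.
by apply: exprn_ile1 => //; rewrite mulr_ge0 // ?ltW // exprn_gt0.
Qed.

Lemma rescaled_triform :
  triform 0 mult rescaled 24^-1 ((432 + d%:R) * tau ^+ (2 * d)) tau^-1.
Proof.
have p24 : (0 : R) < 24^-1 by rewrite invr_gt0 ltr0n.
have l24 : (24^-1 : R) < 1 by lra.
have down_lt1 n z : nv z < 24^-1 -> nv (scale_down n z) < 1.
  by move=> zr; apply: le_lt_trans (nv_scale_down_le n z) _; lra.
split => //.
- by lra.
- apply: mulr_ge0; last by rewrite exprn_ge0 // ltW.
  by apply: addr_ge0; exact: ler0n.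
- by rewrite invr_gt0.
- by rewrite invf_lt1.
- move=> n z zr; apply: (vhol_comp (F := fun x => f n (scale_down n x))).
    apply: (vhol_comp (vhol_scale_down n z)); exact/fhol/down_lt1.
  exact: vhol_scale_up.
- move=> n z i zr; set w := scale_down n z; set s := tau ^+ n.
  have s1 : 1 <= s := s_ge1 n; have s0 : 0 < s := s_gt0 n.
  have sV : s^-1 <= 1 by rewrite invf_le1.
  have w24 : nv w <= 24^-1 by apply: le_trans (nv_scale_down_le n z) _; exact: ltW.
  have wS : wt n.+1 i = tau ^+ (2 * d - i) * wt n i by rewrite /wt exprS exprMn.
  have tp m : 0 < tau ^+ m by rewrite exprn_gt0.
  have ti : tau ^+ (2 * d - i) <= tau ^+ (2 * d) by apply: ler_weXn2l => //; exact: leq_subr.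
  have z0 := nv_ge0 z.
  have E : rescaled n z 0 i - mult n i * z 0 i = (wt n.+1 i)%:C *
     (f n w 0 i - lin (D n i) w) + \sum_(k < d | k != i) (wt n.+1 i)%:C * (D n i k * w 0 k).
    have -> : mult n i * z 0 i = (wt n.+1 i)%:C * (D n i i * w 0 i).
      rewrite /mult wS rmorphM /w [scale_down n z 0 i]mxE.
      by rewrite -[LHS]mul1r -(wtK n i); ring.
    rewrite -mulr_sumr -mulrDr [rescaled n z 0 i]mxE -/w -mulrBr; congr (_ * _).
    rewrite /lin [\sum_k _](bigD1 i) //=; ring.
  rewrite E exprVn -/s.
  have -> : (432 + d%:R) * tau ^+ (2 * d) * s^-1 * nv z =
    432 * (tau ^+ (2 * d) * s^-1 * nv z) + \sum_(k < d) (tau ^+ (2 * d) * s^-1 * nv z).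
    by rewrite sumr_const card_ord -[_ *+ d]mulr_natl; ring.
  apply: le_trans (ncD _ _) _; apply: lerD.
    rewrite ncM nc_real ger0_norm ?(ltW (wt_gt0 _ _)) //.
    apply: (@le_trans _ _ (wt n.+1 i * (432 * nv w ^+ 2))).
      by apply: ler_wpM2l; [exact: ltW (wt_gt0 _ _)|exact: remainder].
    rewrite mulrCA; apply: ler_wpM2l; first exact: ler0n.
    apply: (@le_trans _ _ ((tau * s) ^+ (2 * d) * (nv z / s ^+ d.+1) ^+ 2)).
      apply: ler_pM; rewrite ?(ltW (wt_gt0 _ _)) ?exprn_ge0 ?nv_ge0 //.
        by rewrite /s -(exprS tau n); exact: wt_le.
      by apply: lerXn2r (nv_scale_down n z); rewrite nnegrE ?nv_ge0 // divr_ge0 // exprn_ge0 // ltW.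
    have -> : (tau * s) ^+ (2 * d) * (nv z / s ^+ d.+1) ^+ 2 =
      tau ^+ (2 * d) * s^-1 * nv z * (s^-1 * nv z).
      rewrite exprMn expr_div_n -(exprM s d.+1) (_ : d.+1 * 2 = 2 * d + 2)%N; last by rewrite mulnC mulnS addnC.
      by rewrite (exprD s (2 * d)); field; rewrite !gt_eqF ?exprn_gt0.
    apply: ler_piMr; first by rewrite mulr_ge0 // mulr_ge0 ?invr_ge0 // ltW.
    by rewrite -[leRHS]mulr1; apply: ler_pM; rewrite ?invr_ge0 ?(ltW s0) //; lra.
  apply: le_trans (nc_sum _ _ _) _; rewrite big_mkcond; apply: ler_sum => k _ /=.
  have t0 : 0 <= tau ^+ (2 * d) * s^-1 * nv z.
    by rewrite mulr_ge0 // mulr_ge0 ?invr_ge0 ?(ltW s0) // ltW.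
  case: eqP => //= /eqP ki; have [ik|ki'|/val_inj kk] := ltngtP i k; last by rewrite kk eqxx in ki.
    by rewrite Dtrig // mul0r mulr0 nc0.
  rewrite !ncM nc_real ger0_norm ?(ltW (wt_gt0 _ _)) // nc_scale_down mulrCA.
  apply: (@le_trans _ _ (1 * (wt n.+1 i * (nc (z 0 k) / wt n k)))).
    apply: ler_wpM2r; last by apply: le_trans (diag_le n i k) (ltW Lam1).
    by rewrite mulr_ge0 ?divr_ge0 ?nc_ge0 ?(ltW (wt_gt0 _ _)).
  rewrite mul1r wS.
  have wk : wt n k = wt n i * s ^+ (i - k).
    rewrite /wt -exprD; congr (_ ^+ _); exact: weight_gap.
  have -> : tau ^+ (2 * d - i) * wt n i * (nc (z 0 k) / wt n k) =
    tau ^+ (2 * d - i) * (s ^+ (i - k))^-1 * nc (z 0 k).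
    by rewrite wk; field; rewrite !gt_eqF ?exprn_gt0 ?wt_gt0.
  apply: ler_pM; rewrite ?nc_ge0 ?nc_le_nv //.
    by rewrite mulr_ge0 ?invr_ge0 ?(ltW (tp _)) // exprn_ge0 // ltW.
  apply: ler_pM => //; [exact: ltW|by rewrite invr_ge0 exprn_ge0 // ltW|].
  rewrite lef_pV2 ?posrE ?exprn_gt0 // -[leLHS]expr1; apply: ler_weXn2l => //.
  by rewrite subn_gt0.
- move=> n i; exists (fun k => \sum_m ((wt n.+1 i)%:C * D n i m) *
     ((wt n m)^-1%:C * (m == k)%:R)).
  have S k : \sum_m ((wt n.+1 i)%:C * D n i m) * ((wt n m)^-1%:C * (m == k)%:R) =
     (wt n.+1 i)%:C * D n i k * (wt n k)^-1%:C.
    rewrite (bigD1 k) //= eqxx mulr1 big1 ?addr0 // => m mk.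
    by rewrite (negbTE mk) !mulr0.
  split.
  + have -> : (fun z => rescaled n z 0 i) =
       (fun x => (wt n.+1 i)%:C * f n x 0 i) \o scale_down n.
      by apply/funext => x; rewrite /= mxE.
    have d0 : scale_down n 0 = 0 by apply/rowP => k; rewrite !mxE mulr0.
    apply: sd_comp => [|m].
      rewrite d0; have := sdM (sd_const (wt n.+1 i)%:C 0) (fD n i).
      by congr sd; apply/funext => k; rewrite mul0r add0r.
    have := sdM (sd_const (wt n m)^-1%:C 0) (sd_coord m (0 : V)).
    have -> : (fun x => scale_down n x 0 m) = (fun x => (wt n m)^-1%:C * x 0 m).
      by apply/funext => x; rewrite mxE.
    by congr sd; apply/funext => k; rewrite mul0r add0r.
  + rewrite S /mult /wt exprS exprMn -/(wt n i) rmorphM.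
    by rewrite -[RHS]mulr1 -(wtK n i); ring.
  + by move=> k ik; rewrite S Dtrig // mulr0 mul0r.
Qed.

End Rescaling.

(** The rescaled maps are conjugate, on a fixed ball and for large times, to
    triangular automorphisms whose orbits tend to 0.  In the original
    coordinates the domains U n shrink, but slower than the orbits of f. *)
Theorem attracting_normal_form : exists (N0 : nat) (U : nat -> set V)
    (H K g g' : nat -> V -> V), [/\
  forall n z, U n z -> nv z < 1,
  forall n, lbih (U n) (H n) (K n) /\
    forall z, U n z -> U n.+1 (f (N0 + n)%N z) /\ H n.+1 (f (N0 + n)%N z) = g n (H n z),
  forall n z, [/\ g' n (g n z) = z, g n (g' n z) = z, vhol (g n) z & vhol (g' n) z],
  forall c, exists N, forall n, (N <= n)%N -> forall z, nv z <= c * Lam ^+ n -> U n z &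
  forall w, exists N, forall n, (N <= n)%N -> exists2 z, U n z & H n z = orb g n w].
Proof.
pose x := Num.min ((1 + Lam) / (2 * Lam)) lam'^-1.
have x1 : 1 < x.
  rewrite lt_min invf_gt1 // lam'1 andbT ltr_pdivlMr ?mulr_gt0 //.
  by have := Lam1; lra.
have [tau tau1 tx] := root_gt1 (4 * d) x1.
have tau0 : 0 < tau by apply: lt_trans tau1.
have tp m : 0 < tau ^+ m by rewrite exprn_gt0.
have taul : tau ^+ (4 * d) * lam' <= 1.
  by rewrite -ler_pdivlMr // div1r; apply: le_trans tx _; rewrite ge_min lexx orbT.
have tauL : tau ^+ (2 * d) * Lam < 1.
  have h1 : tau ^+ (2 * d) <= tau ^+ (4 * d).
    by apply: ler_weXn2l; [exact: ltW|rewrite leq_mul2r orbT].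
  have : tau ^+ (4 * d) <= (1 + Lam) / (2 * Lam).
    by apply: le_trans tx _; rewrite ge_min lexx.
  rewrite ler_pdivlMr ?mulr_gt0 // => h2.
  have := ler_wpM2r (ltW Lam0) h1; have := Lam1; lra.
have htame := rescaled_tame tau1 tauL taul.
have htri := rescaled_triform tau1.
set K1 := _ * tau ^+ (2 * d) in htri.
have s1 : tau^-1 < 1 by rewrite invf_lt1.
have sV0 : 0 <= tau^-1 by rewrite invr_ge0 ltW.
have gap : 0 < 1 - tau ^+ (2 * d) * Lam by rewrite subr_gt0.
have [n1 hn1] := vanishing_geo K1 sV0 s1 gap.
have htame1 := tame_shift n1 htame; have htri1 := triform_shift n1 htri.
have Fc n z : nv z < 24^-1 -> nv (tailseq n1 (rescaled tau) n z) <= nv z.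
  move=> zr; apply: le_trans (triform_norm n htame1 htri1 zr) _.
  rewrite ler_piMl ?nv_ge0 // -mulrA -exprD.
  by have := hn1 (n1 + n)%N (leq_addr _ _); lra.
have [n0 [g [g' [h [k [r [r' [A [r_le [r0 A1 hk h_le hf k_le] gg orb0]]]]]]]]] :=
  global_normal_form htame1 htri1 Fc.
have r1 : r < 1 by apply: le_lt_trans r_le _; lra.
pose N0 := (n1 + n0)%N; pose up n := scale_up tau (N0 + n)%N.
pose down n := scale_down tau (N0 + n)%N.
exists N0, (fun n => [set z | nv (up n z) < r]), (fun n z => h n (up n z)),
  (fun n w => down n (k n w)), g, g'; split => [n z /= zU|n| |c|w].
- apply: le_lt_trans r1; apply: le_trans (ltW zU).
  by rewrite -{1}[z](scale_upK tau1 (N0 + n)%N); exact: nv_scale_down_le.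
- split.
    apply: (lbih_comp (U' := [set z : V | nv z < r]) (h := up n) (k := down n) _ (hk n)) => //.
    move=> z /= zU; split; [exact: vhol_scale_up|exact: scale_upK|].
    have [e e0 he] := nopen_ball zU; exists e => // w /he wr.
    by split; [rewrite /= /up /down scale_downK|exact: scale_downK|exact: vhol_scale_down].
  move=> z /= zU.
  have E : up n.+1 (f (N0 + n)%N z) = tailseq n0 (tailseq n1 (rescaled tau)) n (up n z).
    by rewrite /tailseq /rescaled /up /N0 addnA addnS scale_upK.
  rewrite E; split; last by rewrite hf.
  by apply: (le_lt_trans (Fc (n0 + n)%N _ (lt_le_trans zU r_le)) zU).
- exact: gg.
- pose c' := `|c| * (tau ^+ N0) ^+ (2 * d).
  have L0 : 0 <= tau ^+ (2 * d) * Lam by rewrite mulr_ge0 // ltW.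
  have [N hN] := vanishing_geo c' L0 tauL (divr_gt0 r0 (ltr0n R 2)).
  exists N => n /hN {}hN z zc /=; apply: (@le_lt_trans _ _ (r / 2)); last by lra.
  apply: le_trans hN; apply: le_trans (nv_scale_up tau1 _ _) _.
  have -> : c' * (tau ^+ (2 * d) * Lam) ^+ n =
    (tau ^+ (N0 + n)) ^+ (2 * d) * (`|c| * Lam ^+ n).
    by rewrite /c' (exprD tau) !exprMn -!exprM (mulnC n); ring.
  apply: ler_wpM2l; first by rewrite exprn_ge0 // exprn_ge0 // ltW.
  apply: le_trans zc _; apply: ler_wpM2r; last exact: ler_norm.
  by rewrite exprn_ge0 // ltW.
have A0 : 0 < A by lra.
have [N hN] := orb0 w _ (divr_gt0 r0 (mulr_gt0 (ltr0n R 2) A0)).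
exists N => n /hN {}hN.
have [|k1 k2 k3] := k_le n (orb g n w).
  apply: le_lt_trans hN _; rewrite ltr_pM2l // ltf_pV2 ?posrE ?mulr_gt0 //; lra.
by exists (down n (k n (orb g n w))); rewrite /= /up /down scale_downK.
Qed.

End Attracting.

(** * Norm, topology and differential of row vectors *)

Section Bridge.
Context {R : realType} {d : nat}.
Local Notation C := R[i].
Local Notation V := 'rV[C]_d.

Lemma ge0_realC (x : C) : 0 <= x -> exists2 r : R, 0 <= r & x = r%:C.
Proof. by case: x => a b; rewrite lecE /= => /andP[/eqP-> a0]; exists a. Qed.

Lemma gt0_realC (x : C) : 0 < x -> exists2 r : R, 0 < r & x = r%:C.
Proof. by case: x => a b; rewrite ltcE /= => /andP[/eqP-> a0]; exists a. Qed.

Lemma nvE (z : V) : `|z| = (nv z)%:C.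
Proof.
have entry i : `|z 0 i| <= `|z|.
  rewrite [leRHS]/Num.norm /= mx_normE -[leLHS]nngE num_le.
  exact: (le_bigmax _ _ (0 : 'I_1, i)).
apply/eqP; rewrite eq_le; apply/andP; split.
  have H : 0 <= (nv z)%:C :> C by rewrite lecR nv_ge0.
  rewrite [leLHS]/Num.norm /= mx_normE -[leRHS]/((NngNum H)%:num) num_le.
  apply/bigmax_leP; split => [|[i j] _]; first by rewrite -num_le /=.
  by rewrite -num_le /= ncE lecR (ord1 i) nc_le_nv.
have [r r0 zr] := ge0_realC (normr_ge0 z); rewrite zr lecR.
by apply: nv_le => // i; have := entry i; rewrite zr ncE lecR.
Qed.

Lemma polydiscE (r : R) (z : V) : polydisc r z <-> nv z < r.
Proof. by rewrite /polydisc /= nvE ltcR. Qed.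

Lemma nbhs_nvP (z : V) (A : set V) :
  nbhs z A <-> exists2 e : R, 0 < e & forall w, nv (w - z) < e -> A w.
Proof.
split=> [/nbhs_ballP[e /= /gt0_realC[r r0 ->] h]|[e e0 h]].
  exists r => // w wz; apply: h; rewrite -ball_normE /ball_ /=.
  by rewrite -normrN opprB nvE ltcR.
apply/nbhs_ballP; exists e%:C; first by rewrite /= ltcR.
by move=> w; rewrite -ball_normE /ball_ /= -normrN opprB nvE ltcR => /h.
Qed.

Lemma open_nvP (A : set V) : open A <-> nopen A.
Proof.
rewrite openE; split=> [h z /h/nbhs_nvP //|h z /h/nbhs_nvP //].
Qed.

Lemma vhol_cvg (G : V -> V) z : vhol G z -> {for z, continuous G}.
Proof.
move=> hG A /nbhs_nvP[e e0 hA]; apply/nbhs_nvP.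
by have [dl dl0 h] := vhol_near hG e0; exists dl => // w /h/hA.
Qed.

Lemma differentiable_sd (g : V -> V) z : differentiable g z ->
  forall i, sd (fun x => g x 0 i) z (fun k => Dmx g z i k).
Proof.
move=> dg i e e0; have [_] := (diff_locallyP z g).1 dg.
move=> /eqaddoP /(_ e%:C); rewrite ltcR => /(_ e0) /nbhs_nvP[dl dl0 h].
exists dl => // v vd; have := h v; rewrite subr0 => /(_ vd) /=.
rewrite -[(_ - _) v]/(g (v + z) - (g z + 'd g z v)) !nvE -rmorphM lecR.
apply: le_trans; apply: le_trans (nc_le_nv _ i).
rewrite !mxE [z + v]addrC opprD addrA.
have -> : lin (fun k => Dmx g z i k) v = ('d g z v) 0 i; last by [].
have -> : 'd g z v = v *m jacobian g z by rewrite /jacobian mul_rV_lin1.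
by rewrite mxE; apply: eq_bigr => k _; rewrite [Dmx _ _ _ _]mxE mulrC.
Qed.

Lemma differentiable_vhol (g : V -> V) z : differentiable g z <-> vhol g z.
Proof.
split=> [dg i|]; first by eexists; apply: differentiable_sd.
move=> /choice[D hD].
pose A : 'M[C]_d := \matrix_(k, i) D i k.
pose df := mulmxr A : {linear V -> V}.
have dfc : continuous df by move=> x; apply: vhol_cvg; exact: vhol_mulmx.
have dfE v i : df v 0 i = lin (D i) v.
  by rewrite !mxE; apply: eq_bigr => k _; rewrite mxE mulrC.
have E : g \o shift z = cst (g z) + df +o_ 0 id.
  apply/eqaddoP => e /gt0_realC[r r0 ->]; apply/nbhs_nvP.
  have /choice[dl hdl] : forall i, exists dl : R, 0 < dl /\ forall v, nv v < dl ->
      nc (g (z + v) 0 i - g z 0 i - lin (D i) v) <= r * nv v.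
    by move=> i; have [dl dl0 h] := hD i r r0; exists dl.
  exists (\big[Num.min/1]_i dl i).
    by elim/big_rec: _ => // i x _ x0; rewrite lt_min x0; have [->] := hdl i.
  move=> v; rewrite subr0 => hv.
  rewrite /= -[(_ - _) v]/(g (v + z) - (g z + df v)) !nvE -rmorphM lecR.
  apply: nv_le => [|i]; first by rewrite mulr_ge0 ?nv_ge0 // ltW.
  have -> : (g (v + z) - (g z + df v)) 0 i = g (z + v) 0 i - g z 0 i - lin (D i) v.
    by rewrite -dfE 3![in LHS]mxE opprD addrA [v + z]addrC.
  have [_] := hdl i; apply; apply: lt_le_trans hv _.
  by rewrite (bigD1 i) //= ge_min lexx.
apply/diff_locallyP; rewrite (diff_unique dfc E); split => //.
Qed.

End Bridge.

(** * The coordinate of a point of the basin *)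

Lemma lbih_eq {R : realType} {d : nat} (U : set 'rV[R[i]]_d) (h h' k : 'rV[R[i]]_d -> 'rV[R[i]]_d) :
  nopen U -> (forall z, U z -> h' z = h z) -> lbih U h k -> lbih U h' k.
Proof.
move=> oU hh hk z Uz; have [h1 h2 [dl dl0 hdl]] := hk z Uz; rewrite hh //; split => //.
  have [e e0 he] := oU z Uz; apply: eq_near_vhol e0 _ h1 => v ve.
  by apply: hh; apply: he; rewrite [z + v]addrC addrK.
by exists dl => // w /hdl[Uk ? ?]; rewrite hh.
Qed.

Section BasinOrbits.
Local Open Scope quotient_scope.
Context {R : realType} {d : nat}.
Local Notation C := R[i].
Local Notation V := 'rV[C]_d.
Variable f : nat -> {fun (@polydisc R d 1) >-> (@polydisc R d 1)}.
Variables (Lam r0 : R) (kf : nat -> V -> V).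
Hypothesis Lam0 : 0 < Lam.
Hypothesis Lam1 : Lam < 1.
Hypothesis fle : forall n (z : V), nv z < 1 -> nv (f n z) <= Lam * nv z.
Hypothesis r01 : r0 < 1.
Hypothesis f_lbih : forall n, lbih [set z : V | nv z < r0] (f n) (kf n).
Variables (N0 : nat) (U : nat -> set V) (H K g g' : nat -> V -> V).
Hypothesis HK : forall n, lbih (U n) (H n) (K n).
Hypothesis U1 : forall n z, U n z -> nv z < 1.
Hypothesis Hf : forall n z, U n z ->
  U n.+1 (f (N0 + n)%N z) /\ H n.+1 (f (N0 + n)%N z) = g n (H n z).
Hypothesis gg : forall n z,
  [/\ g' n (g n z) = z, g n (g' n z) = z, vhol (g n) z & vhol (g' n) z].
Hypothesis Uin : forall c, exists N, forall n, (N <= n)%N ->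
  forall z, nv z <= c * Lam ^+ n -> U n z.
Hypothesis Hsurj : forall w, exists N, forall n, (N <= n)%N ->
  exists2 z, U n z & H n z = orb g n w.

Fixpoint unorb n w := if n is n'.+1 then unorb n' (g' n' w) else w.

Let orbK n w : unorb n (orb g n w) = w.
Proof. by elim: n => //= n IH; have [-> _ _ _] := gg n (orb g n w). Qed.

Let unorbK n w : orb g n (unorb n w) = w.
Proof. by elim: n w => //= n IH w; rewrite IH; have [_ -> _ _] := gg n w. Qed.

Let unorb_lbih n : lbih setT (unorb n) (orb g n).
Proof.
move=> z _; split; [|exact: unorbK|].
  elim: n z => [|n IH] z /=; first exact: vhol_id.
  by apply: vhol_comp (IH _); have [] := gg n z.
exists 1 => // w _; split => //.
elim: n {z} => [|n IH] /=; first exact: vhol_id.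
by apply: vhol_comp IH _; have [] := gg n (orb g n w).
Qed.

(** The point of C^d whose g-orbit passes through H n z at time n. *)
Definition height n z := unorb n (H n z).

Let height_lbih n : exists k, lbih (U n) (height n) k.
Proof.
exists (fun w => K n (orb g n w)).
exact: (lbih_comp (@HK n) (@unorb_lbih n) (fun _ _ => I)).
Qed.

Let height_inj n z z' : U n z -> U n z' -> height n z = height n z' -> z = z'.
Proof.
have [k hk] := height_lbih n => /hk[_ kz _] /hk[_ kz' _] E; by rewrite -kz E kz'.
Qed.

Let height_step n z : U n z -> U n.+1 (f (N0 + n)%N z) /\
  height n.+1 (f (N0 + n)%N z) = height n z.
Proof.
move=> /Hf[Uf E]; split => //; rewrite /height E /=.
by have [-> _ _ _] := gg n (H n z).
Qed.

Let height_orbit (s : Defs.orbit f) n l : (ostart s <= N0 + n)%N -> U n (s (N0 + n)%N) ->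
  U (n + l) (s (N0 + (n + l))%N) /\
  height (n + l) (s (N0 + (n + l))%N) = height n (s (N0 + n)%N).
Proof.
move=> sn Us; elim: l => [|l [IH1 IH2]]; first by rewrite addn0.
have sl : (ostart s <= N0 + (n + l))%N by rewrite addnA; apply: leq_trans sn (leq_addr _ _).
have [_] := orbitP sl; rewrite !addnS => ->.
by have [h1 h2] := height_step IH1; rewrite h2.
Qed.

Let decay (s : Defs.orbit f) l : nv (s (ostart s + l)%N) <= Lam ^+ l.
Proof.
elim: l => [|l IH].
  by rewrite expr0 ltW //; have [/polydiscE] := orbitP (leqnn (ostart s)); rewrite addn0.
have [/polydiscE h1] := orbitP (leq_addr l (ostart s)); rewrite addnS => ->.
by apply: le_trans (fle _ h1) _; rewrite exprS ler_pM2l.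
Qed.

Let enters (m : nat) : exists N, forall n, (N <= n)%N -> (m <= N0 + n)%N /\
  forall z, nv z <= Lam ^+ (N0 + n - m) -> U n z.
Proof.
have [N hN] := Uin (Lam ^+ N0 / Lam ^+ m); exists (maxn N m) => n.
rewrite geq_max => /andP[/hN hn mn].
have mn' : (m <= N0 + n)%N by apply: leq_trans mn (leq_addl _ _).
split => // z; rewrite expfB_cond ?gt_eqF // => zn; apply: hn.
apply: le_trans zn _; by rewrite exprD mulrAC.
Qed.

Let orbit_enters (s : Defs.orbit f) : exists N, forall n, (N <= n)%N ->
  (ostart s <= N0 + n)%N /\ U n (s (N0 + n)%N).
Proof.
have [N hN] := enters (ostart s); exists N => n /hN[sn h]; split => //.
by apply: h; have := decay s (N0 + n - ostart s); rewrite subnKC.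
Qed.

Let psi_ex (s : Defs.orbit f) : exists w, exists N, forall n, (N <= n)%N ->
  U n (s (N0 + n)%N) /\ height n (s (N0 + n)%N) = w.
Proof.
have [N hN] := orbit_enters s; have [sN UN] := hN N (leqnn N).
exists (height N (s (N0 + N)%N)), N => n Nn; rewrite -(subnKC Nn).
exact: height_orbit.
Qed.

(** The height of an orbit is constant once the orbit has entered the domains
    U n; this constant is the coordinate of its class. *)
Definition psi (x : basin f) : V := projT1 (cid (psi_ex (repr x))).

Let psi_late (s : Defs.orbit f) : exists N, forall n, (N <= n)%N ->
  U n (s (N0 + n)%N) /\ height n (s (N0 + n)%N) = psi (\pi_(basin f) s).
Proof.
rewrite /psi; case: cid => w /= [N1 h1].
have : \pi_(basin f) (repr (\pi_(basin f) s)) = \pi_(basin f) s by rewrite reprK.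
move=> /eqmodP /asboolP [N2 _ h2].
exists (maxn N1 N2) => n; rewrite geq_max => /andP[/h1[h3 h4] n2].
by rewrite -(h2 (N0 + n)%N) //=; apply: leq_trans n2 (leq_addl _ _).
Qed.

Let psi_height (s : Defs.orbit f) n : (ostart s <= N0 + n)%N -> U n (s (N0 + n)%N) ->
  psi (\pi_(basin f) s) = height n (s (N0 + n)%N).
Proof.
move=> sn Us; have [N hN] := psi_late s.
have [_ <-] := hN (n + N)%N (leq_addl _ _).
by have [_ ->] := height_orbit N sn Us.
Qed.

Lemma psi_inj x y : psi x = psi y -> x = y.
Proof.
move: (reprK x) (reprK y) => <- <-; set s := repr x; set t := repr y => st.
have [N1 h1] := psi_late s; have [N2 h2] := psi_late t.
apply/eqmodP/asboolP; exists (N0 + maxn N1 N2)%N => // n /= hn.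
have Nn : (N0 <= n)%N by apply: leq_trans (leq_addr _ _) hn.
move: hn; rewrite -(subnKC Nn) leq_add2l geq_max => /andP[/h1[U1s e1] /h2[U2t e2]].
by apply: (height_inj U1s U2t); rewrite e1 e2.
Qed.

Let orbit_fromE m z n : nv z < 1 -> oseq (orbit_from f m z) n = comp_from f m (n - m) z.
Proof. by move=> z1; rewrite /= asboolT //; apply/polydiscE. Qed.

Let psi_basin_map m z n : nv z < 1 -> (m <= N0 + n)%N -> U n (comp_from f m (N0 + n - m) z) ->
  psi (basin_map f m z) = height n (comp_from f m (N0 + n - m) z).
Proof. by move=> z1 mn Uz; rewrite -orbit_fromE // -psi_height // orbit_fromE. Qed.

Lemma psi_surj w : exists x, psi x = w.
Proof.
have [N h] := Hsurj w; have [z Uz Hz] := h N (leqnn N).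
exists (basin_map f (N0 + N) z).
rewrite (psi_basin_map (n := N)) ?subnn //=; last exact: U1 Uz.
by rewrite /height Hz orbK.
Qed.

Let comp_from_lbih m l : exists k, lbih [set z : V | nv z < r0] (comp_from f m l) k /\
  forall z, nv z < 1 -> nv (comp_from f m l z) <= Lam ^+ l * nv z.
Proof.
elim: l => [|l [k [hk kle]]].
  exists id; split => [z zr|z _]; last by rewrite expr0 mul1r.
  split; [exact: vhol_id|by []|].
  have [e e0 he] := nopen_ball zr; exists e => // w /he wr.
  by split => //; exact: vhol_id.
exists (fun w => k (kf (m + l)%N w)); split => [|z z1].
  apply: (lbih_comp hk (f_lbih (m + l))) => z /= zr.
  apply: (le_lt_trans _ zr); apply: le_trans (kle z (lt_trans zr r01)) _.
  by rewrite ler_piMl ?nv_ge0 // exprn_ile1 // ltW.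
have Ll : Lam ^+ l <= 1 by rewrite exprn_ile1 // ltW.
rewrite exprS -mulrA /=; apply: (le_trans (fle _ _)).
  by apply: (le_lt_trans (kle z z1)); apply: (le_lt_trans _ z1); rewrite ler_piMl ?nv_ge0.
by rewrite ler_pM2l // kle.
Qed.

(** The map f_{n,m} is biholomorphic on a ball independent of n and, for n large,
    it maps that ball into the domain U of [height]. *)
Lemma psi_chart m : exists k, lbih [set z : V | nv z < r0] (fun z => psi (basin_map f m z)) k.
Proof.
have [N hN] := enters m; have [mN hU] := hN N (leqnn N).
have [k [hk kle]] := comp_from_lbih m (N0 + N - m)%N.
have [k' hk'] := height_lbih N.
exists (fun w => k (k' w)).
have Uz z : nv z < 1 -> U N (comp_from f m (N0 + N - m) z).
  move=> z1; apply: hU; apply: le_trans (kle z z1) _.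
  by apply: ler_piMr (ltW z1); rewrite exprn_ge0 // ltW.
apply: (lbih_eq (@nopen_ball _ _ r0) (h := fun z => height N (comp_from f m (N0 + N - m) z))).
  move=> z zr; have z1 := lt_trans zr r01.
  by rewrite (psi_basin_map (n := N) z1 mN (Uz z z1)).
by apply: (lbih_comp hk hk') => z zr; apply: Uz; exact: lt_trans zr r01.
Qed.

(** Orbits tend to 0, and dropping initial terms does not change their class. *)
Lemma basin_map_small x r : 0 < r -> exists m z, nv z < r /\ basin_map f m z = x.
Proof.
move=> r_gt0; move: (reprK x) => <-; set s := repr x.
have [l hl] := vanishing_geo 1 (ltW Lam0) Lam1 (divr_gt0 r_gt0 (ltr0n R 2)).
have zr : nv (s (ostart s + l)%N) < r.
  apply: le_lt_trans (decay s l) _; have := hl l (leqnn l); rewrite mul1r; lra.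
exists (ostart s + l)%N, (s (ostart s + l)%N); split => //.
apply/eqmodP/asboolP; exists (ostart s + l)%N => // n ln; rewrite /= in ln.
have z1 : nv (s (ostart s + l)%N) < 1.
  by have [/polydiscE] := orbitP (leq_addr l (ostart s)).
rewrite [LHS]orbit_fromE // -{2}(subnKC ln).
elim: (n - _)%N => [|q IH] /=; first by rewrite addn0.
have sq : (ostart s <= ostart s + l + q)%N by rewrite -addnA leq_addr.
by rewrite IH addnS; have [_ ->] := orbitP sq.
Qed.

Lemma basin_coordinate : exists psi : basin f -> V, [/\ injective psi,
  forall w, exists x, psi x = w &
  forall m, exists k, lbih [set z : V | nv z < r0] (fun z => psi (basin_map f m z)) k].
Proof. by exists psi; split; [exact: psi_inj|exact: psi_surj|exact: psi_chart]. Qed.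

End BasinOrbits.

(** * Complex structures on the basin *)

Section BasinManifold.
Context {R : realType} {d : nat}.
Local Notation C := R[i].
Local Notation V := 'rV[C]_d.
Variable f : nat -> {fun (@polydisc R d 1) >-> (@polydisc R d 1)}.
Variables (r0 : R) (psi : basin f -> V) (phi : V -> basin f).
Hypothesis psiK : cancel psi phi.
Hypothesis phiK : cancel phi psi.
Hypothesis r0_gt0 : 0 < r0.
Hypothesis chart : forall m, exists k,
  lbih [set z : V | nv z < r0] (fun z => psi (basin_map f m z)) k.
Hypothesis small : forall x r, 0 < r -> exists m z, nv z < r /\ basin_map f m z = x.

(** The standard structure of C^d, transported to the basin: an atlas with a
    single parametrization. *)
Let phi_param : param (basin f) :=
  @Param R d (basin f) setT phi openT (fun z w _ _ e => can_inj phiK e).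

Let M := atlas_space [set phi_param].

Let openE (W : set M) : open W <-> open (phi @^-1` W : set V).
Proof.
rewrite atlas_openE; split=> [/(_ _ erefl)|oU p ->]; by rewrite setTI.
Qed.

Let nbhsE (x : M) (W : set M) : nbhs x W <-> nbhs (psi x) (phi @^-1` W).
Proof.
rewrite !nbhsE; split => -[A [oA Ax] AW].
  exists (phi @^-1` A); last by move=> w; exact: AW.
  by split; [exact/openE|rewrite /= psiK].
exists ((psi : M -> V) @^-1` A); last by move=> y /AW /=; rewrite psiK.
split => //; apply/openE; suff -> : phi @^-1` (psi @^-1` A) = A by [].
by apply/seteqP; split => w /=; rewrite ?phiK.
Qed.

Let cover (x : basin f) : exists p z, [/\ [set phi_param] p, dom p z & p z = x].
Proof. by exists phi_param, (psi x); split => //=; rewrite psiK. Qed.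

Let compat (p q : param (basin f)) : [set phi_param] p -> [set phi_param] q ->
  holo_in_params setT id p q.
Proof.
move=> -> ->; split.
  rewrite (_ : [set _ | _] = setT); first exact: openT.
  by apply/seteqP; split=> // z _; split=> //; exists z.
by exists id => z _; split.
Qed.

Let hausdorff : hausdorff_space M.
Proof.
move=> x y xy; apply: (can_inj psiK); apply: (@norm_hausdorff _ V) => A B xA yB.
have [| |z [Az Bz]] := xy (psi @^-1` A) (psi @^-1` B).
- by apply/nbhsE; apply: filterS xA => w /=; rewrite phiK.
- by apply/nbhsE; apply: filterS yB => w /=; rewrite phiK.
- by exists (psi z).
Qed.

Let countable : @second_countable M.
Proof.
have [B cB [oB bB]] := @std_countable R d.
exists [set psi @^-1` b | b in B].
  exact: sub_countable (card_image_le _ _) cB.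
split => [_ [b /oB /std_openE ob <-]|x W /nbhsE].
  apply/openE; suff -> : phi @^-1` (psi @^-1` b) = b by [].
  by apply/seteqP; split => w /=; rewrite ?phiK.
rewrite -std_nbhsE => /(bB (psi x))[b [Bb bx] bW].
exists (psi @^-1` b); first by split => //; exists b.
by move=> y /bW /=; rewrite psiK.
Qed.

Let S0 : complex_structure (basin f) := ComplexStructure cover compat hausdorff countable.

Let image_open m (D : set V) : nopen D -> (forall z, D z -> nv z < r0) ->
  nopen [set w | exists2 z, D z & basin_map f m z = phi w].
Proof.
have [k hk] := chart m => oD Dr w [z Dz zw].
have [_ _ [dl dl0 h]] := lbih_sub oD Dr hk Dz; exists dl => // w' ww' /=.
have [|h1 h2 _] := h w'; first by rewrite zw phiK.
by exists (k w') => //; rewrite -[LHS]psiK h2.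
Qed.

Lemma natural_exists : exists S : complex_structure (basin f), natural_structure S.
Proof.
exists S0; rewrite /natural_structure; near=> r.
have r_gt0 : 0 < r by near: r; exact: nbhs_right_gt.
have rr0 : r < r0 by near: r; exact: nbhs_right_lt.
move=> m; have [k hk] := chart m.
have opol : nopen [set z : V | nv z < r] by exact: nopen_ball.
have subr (z : V) : nv z < r -> nv z < r0 by move=> zr; exact: lt_trans zr rr0.
have {}hk := lbih_sub opol subr hk.
have polE : polydisc r = [set z : V | nv z < r].
  by apply/seteqP; split => z /polydiscE.
have oimg : open [set w | exists2 z, nv z < r & basin_map f m z = phi w].
  exact/open_nvP/(image_open opol).
exists (basin_map f m @` polydisc r); split.
- by apply/std_openE; rewrite polE; apply/open_nvP.
- by apply/openE; rewrite polE.
- by move=> z zr; exists z.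
- move=> _ _ -> ->; split.
    rewrite (_ : [set _ | _] = polydisc r); first by rewrite polE; exact/open_nvP.
    apply/seteqP; split => [z []//|z zr]; split => //.
    by exists (psi (basin_map f m z)) => //=; rewrite psiK.
  exists (fun z => psi (basin_map f m z)) => z [_ + _]; rewrite polE => /hk[h1 _ _].
  by split; [exact/differentiable_vhol|by []|rewrite /= psiK].
exists (fun x => k (psi x)); split.
- by move=> _ [z zr <-]; rewrite polE in zr *; have [_ -> _] := hk _ zr.
- by move=> z; rewrite inE polE => /hk[].
- by move=> x; rewrite inE => -[z zr <-]; rewrite polE in zr; have [_ -> _] := hk _ zr.
move=> _ _ -> ->; rewrite /holo_in_params; cbv zeta; set O := [set _ | _].
have OE : O = [set w | exists2 z, nv z < r & basin_map f m z = phi w].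
  apply/seteqP; split => w; first by move=> [_ + _]; rewrite polE.
  by move=> wE; split => //=; [rewrite polE|exists (k (psi (phi w)))].
split; first by rewrite OE.
exists k => w; rewrite OE => -[z zr zw]; split => //=; last by rewrite phiK.
have [_ _ [dl dl0 h]] := hk _ zr; apply/differentiable_vhol.
by have [|] := h w; first by rewrite zw phiK subrr nv0.
Unshelve. all: by end_near.
Qed.

(** Near each point of the basin some [basin_map f m] is at the same time
    biholomorphic for S and, composed with psi, a local biholomorphism of C^d;
    hence psi is biholomorphic for S. *)
Lemma natural_biholomorphic (S : complex_structure (basin f)) :
  natural_structure S -> biholomorphic S (@std_structure R d).
Proof.
move=> nS.
have [r [r_gt0 rr0 hS]] : exists r, [/\ 0 < r, r < r0 & forall m,
    exists U : set (manifold S),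
    biholomorphism (S := std_structure) (T := S) (polydisc r) U (basin_map f m)].
  near (0 : R)^'+ => r; exists r; split => //.
  by near: r; exact: nS.
exists psi; split => //; try exact: openT.
- move=> p _ Sp ->; split.
    rewrite (_ : [set _ | _] = dom p); first exact: dom_open.
    apply/seteqP; split => [z []//|z pz]; split => //.
    by exists (psi (p z)).
  exists (fun z => psi (p z)) => z0 [pz0 _ _]; split => //.
  have [m [y [yr yz]]] := small (p z0) r_gt0.
  have [U [_ oU AU _ [G [BG _ GK hG]]]] := hS m.
  have [k hk] := chart m.
  have := hG p std_param Sp erefl; rewrite /holo_in_params; cbv zeta; set O := [set _ | _] => -[oO [g hg]].
  have Oz : O z0.
    split => //; last by exists (G (p z0)).
    by rewrite -yz; apply: AU; exact/polydiscE.
  have [e e0 he] := (open_nvP _).1 oO _ Oz.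
  have loc z : O z -> nv (g z) < r0 /\ psi (p z) = psi (basin_map f m (g z)).
    move=> Oz'; have [_ _ /= gE] := hg _ Oz'; have [_ Uz _] := Oz'.
    rewrite gE GK ?inE //; split => //; apply: lt_trans rr0.
    exact/polydiscE/BG.
  apply/differentiable_vhol; apply: (eq_near_vhol e0
    (G := fun z => psi (basin_map f m (g z)))) => [v ve|].
    have [|_ //] := loc (z0 + v).
    by apply: he; rewrite addrC addrA addNr add0r.
  have [/differentiable_vhol gz _ _] := hg _ Oz; have [h _] := loc _ Oz.
  by have [hk1 _ _] := hk _ h; exact: (vhol_comp gz hk1).
exists phi; split => //; try exact: openT.
move=> _ q -> Sq; rewrite /holo_in_params; cbv zeta; set O := [set _ | _].
have loc w : O w -> exists e (g : V -> V), [/\ 0 < e, vhol g w &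
    forall w', nv (w' - w) < e -> dom q (g w') /\ q (g w') = phi w'].
  move=> [_ _ [y qy yw]]; have [m [z [zr zw]]] := small (phi w) r_gt0.
  have [U [_ _ _ hF _]] := hS m; have [k hk] := chart m.
  have := hF std_param q erefl Sq; rewrite /holo_in_params; cbv zeta.
  set O' := [set _ | _] => -[/open_nvP oO' [g hg]].
  have O'z : O' z by split => //=; [exact/polydiscE|exists y; rewrite ?zw].
  have sub z' : O' z' -> nv z' < r0.
    by move=> [_ /polydiscE h _]; exact: lt_trans h rr0.
  have [_ kz [dl dl0 h]] := lbih_sub oO' sub hk O'z; rewrite /= zw phiK in kz h.
  exists dl, (fun w' => g (k w')); split => // [|w' /h[h1 h2 _]].
    have [|_ _ kw] := h w; first by rewrite subrr nv0.
    by apply: (vhol_comp kw); rewrite kz; have [/differentiable_vhol] := hg _ O'z.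
  by have [_ h3 ->] := hg _ h1; split => //; rewrite -[LHS]psiK h2.
pose g w := xget 0 [set y | dom q y /\ q y = phi w].
have gP w : O w -> dom q (g w) /\ q (g w) = phi w.
  by move=> [_ _ [y qy yw]]; apply: (@xgetPex _ 0 [set y | dom q y /\ q y = phi w]); exists y.
split.
  apply/open_nvP => w /loc[e [g' [e0 _ h]]]; exists e => // w' /h[h1 h2].
  by split => //; exists (g' w').
exists g => w Ow; have [h1 h2] := gP w Ow; split => //.
have [e [g' [e0 hg' h]]] := loc w Ow; apply/differentiable_vhol.
apply: (eq_near_vhol e0 _ hg') => v ve.
have [|h3 h4] := h (w + v); first by rewrite addrC addrA addNr add0r.
have [|h5 h6] := gP (w + v); first by split => //; exists (g' (w + v)).
by apply: (pmap_inj h5 h3); rewrite h4.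
Unshelve. all: by end_near.
Qed.

End BasinManifold.

(** * The basin is biholomorphic to C^d *)

Lemma bunching_triple {R : realType} {d : nat} (a : nat -> 'I_d -> R) n l (j h k : 'I_d) :
  (forall m i, 0 <= a m i) -> (j <= k)%N ->
  \prod_(t < l) (a (n + t)%N h * a (n + t)%N k / a (n + t)%N j) <=
  (\big[Num.max/0]_(h < d) \prod_(n <= m < n + l) a m h) *
  (\big[Num.max/0]_(ij : 'I_d * 'I_d | (ij.1 <= ij.2)%N)
     \prod_(n <= m < n + l) (a m ij.2 / a m ij.1)).
Proof.
move=> a0 jk.
have reindex (b : nat -> R) : \prod_(t < l) b (n + t)%N = \prod_(n <= m < n + l) b m.
  by rewrite -{2}[n]add0n big_addn addKn big_mkord; apply: eq_bigr => t _; rewrite addnC.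
rewrite (reindex (fun m => a m h * a m k / a m j)).
rewrite (eq_bigr (fun m => a m h * (a m k / a m j))) => [|m _]; last by rewrite mulrA.
rewrite big_split /=; apply: ler_pM.
- by apply: prodr_ge0 => m _; exact: a0.
- by apply: prodr_ge0 => m _; rewrite divr_ge0.
- exact: (le_bigmax _ (fun h => \prod_(n <= m < n + l) a m h)).
- exact: (le_bigmax_cond _ (fun ij : 'I_d * 'I_d =>
    \prod_(n <= m < n + l) (a m ij.2 / a m ij.1)) (j := (j, k))).
Qed.

Theorem theorem1 (R : realType) (d : nat)
    (f : nat -> {fun (@polydisc R d 1) >-> (@polydisc R d 1)})
    (nu lam lam' : R) :
  (0 < d)%N ->
  (forall n z, polydisc 1 z -> differentiable (f n) z) ->
  0 < nu -> nu <= lam -> lam < 1 ->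
  (forall n z, polydisc 1 z ->
     nu%:C * `|z| <= `|f n z| /\ `|f n z| <= lam%:C * `|z|) ->
  let L : nat -> 'M[R[i]]_d := fun n => Dmx (f n) 0 in
  (forall n, is_trig_mx (L n)) ->
  let abs_lam : nat -> 'I_d -> R := fun n j => Normc.normc (L n j j) in
  0 < lam' -> lam' < 1 ->
  (forall theta : R, 1 < theta -> exists C : R, forall n l : nat,
     (\big[Num.max/0]_(h < d) \prod_(n <= k < n + l) abs_lam k h) *
     (\big[Num.max/0]_(ij : 'I_d * 'I_d | (ij.1 <= ij.2)%N)
        \prod_(n <= k < n + l) (abs_lam k ij.2 / abs_lam k ij.1))
     <= C * theta ^+ n * lam' ^+ l) ->
  (exists S : complex_structure (basin f), natural_structure S) /\
  (forall S : complex_structure (basin f), natural_structure S ->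
     biholomorphic S (@std_structure R d)).
Proof.
move=> _ fdiff nu0 nu_lam lam1 bounds L Ltrig abs_lam lam'0 lam'1 bunch.
pose F n : 'rV[R[i]]_d -> 'rV[R[i]]_d := f n.
pose D n i k : R[i] := L n i k.
have lam0 : 0 < lam by exact: lt_le_trans nu_lam.
have Fhol n (z : 'rV[R[i]]_d) : nv z < 1 -> vhol (F n) z.
  by move=> z1; apply/differentiable_vhol/fdiff/polydiscE.
have Fge n (z : 'rV[R[i]]_d) : nv z < 1 -> nu * nv z <= nv (F n z).
  by move=> /polydiscE/(bounds n)[+ _]; rewrite !nvE -rmorphM lecR.
have Fle n (z : 'rV[R[i]]_d) : nv z < 1 -> nv (F n z) <= lam * nv z.
  by move=> /polydiscE/(bounds n)[_]; rewrite !nvE -rmorphM lecR.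
have FD n i : sd (fun z => F n z 0 i) 0 (D n i).
  by apply: differentiable_sd; apply: fdiff; apply/polydiscE; rewrite nv0.
have Dtrig n (i k : 'I_d) : (i < k)%N -> D n i k = 0.
  by move=> ik; rewrite /D; have /is_trig_mxP-> := Ltrig n.
have Dbunch (theta : R) : 1 < theta -> exists K : R, forall n l (j h k : 'I_d),
    (j <= k)%N ->
    \prod_(t < l) (nc (D (n + t)%N h h) * nc (D (n + t)%N k k) / nc (D (n + t)%N j j)) <=
    K * theta ^+ n * lam' ^+ l.
  move=> /bunch[K hK]; exists K => n l j h k jk; apply: le_trans (hK n l).
  exact: (bunching_triple n l h (fun m i => nc_ge0 (D m i i)) jk).
have [r0 [r00 r01 [kf hkf]]] := uniform_lbih nu0 lam0 lam1 Fhol Fge Fle FD.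
have [N0 [U [H [K [g [g' [U1 HK gg Uin Hsurj]]]]]]] :=
  attracting_normal_form nu0 lam0 lam1 Fhol Fge Fle FD Dtrig lam'0 lam'1 Dbunch.
have [psi [psi_inj psi_surj chart]] := basin_coordinate lam0 lam1 Fle r01 hkf
  (fun n => (HK n).1) U1 (fun n => (HK n).2) gg Uin Hsurj.
have /choice[phi phiK] := psi_surj.
have psiK : cancel psi phi by move=> x; apply: psi_inj; rewrite phiK.
have small := basin_map_small lam0 lam1 Fle.
split; first exact: natural_exists psiK phiK r00 chart.
exact: natural_biholomorphic psiK phiK r00 chart small.
Qed.
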